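(* Let $(V,tV)$ be a discrete valuation ring with residue field $K=V/tV$, and let $\Delta$ be a finite simplicial complex on $n+1$ vertices $\{v_0,v_1,\dots,v_n\}$. Write $\underline{x}=x_1,\dots,x_n$. Regard $K$ as a $V[\underline{x}]$-module via $K\cong V[\underline{x}]/(t,\underline{x})$, and regard $V$ as a $V[x_0,\underline{x}]$-module via $V\cong V[x_0,\underline{x}]/(x_0,\underline{x})$. Then for all integers $i,j\ge 0$ there are isomorphisms of $K$-vector spaces $$\operatorname{Tor}_i^{V[\underline{x}]}(K, V\overline{[\Delta]})\;\cong\; \frac{\operatorname{Tor}_{i}^{V[x_0,\underline{x}]}(V, V[\Delta])}{t\cdot \operatorname{Tor}_{i}^{V[x_0,\underline{x}]}(V, V[\Delta])}\;\oplus\;\operatorname{Ann}_{\operatorname{Tor}_{i-1}^{V[x_0,\underline{x}]}(V, V[\Delta])}t,$$ $$\operatorname{Ext}^j_{V[\underline{x}]}(K, V\overline{[\Delta]})\;\cong\; \frac{\operatorname{Ext}^{j}_{V[x_0,\underline{x}]}(V, V[\Delta])}{t\cdot \operatorname{Ext}^{j}_{V[x_0,\underline{x}]}(V, V[\Delta])}\;\oplus\;\operatorname{Ann}_{\operatorname{Ext}^{j+1}_{V[x_0,\underline{x}]}(V, V[\Delta])}t .$$ Consequently, combining this with Hochster's formula (recalled in the context), the $K$-vector space dimensions of $\operatorname{Tor}_i^{V[\underline{x}]}(K, V\overline{[\Delta]})$ and $\operatorname{Ext}^j_{V[\underline{x}]}(K, V\overline{[\Delta]})$ are determined by the reduced simplicial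 cohomology modules $\widetilde{H}^q(\Delta-T;V)$ of the deletions $\Delta-T$, $T\subseteq\{v_0,\dots,v_n\}$.
   Context: A simplicial complex on $\{v_0,\dots,v_n\}$ is a set of subsets of $\{v_0,\dots,v_n\}$ (faces) closed under taking subsets; if nonempty, it contains the empty face. $V[\Delta]:=V[x_0,x_1,\dots,x_n]/I_\Delta$ is the Stanley-Reisner ring, where $I_\Delta$ is generated by the square-free monomials $\prod_{v_i\in F}x_i$ for $F\subseteq\{v_0,\dots,v_n\}$, $F\notin\Delta$. The $t$-Stanley-Reisner ring is $V\overline{[\Delta]}:=V[x_1,\dots,x_n]/\overline{I_\Delta}$, where $\overline{I_\Delta}$ is the ideal generated by the images of these same monomials under $x_0\mapsto t$ (so a non-face $F$ gives $\prod_{v_i\in F}x_i$ if $v_0\notin F$, and $t\prod_{v_0\ne v_i\in F}x_i$ if $v_0\in F$). $\operatorname{Ann}_M t=\{m\in M: tm=0\}$. Tor in negative degree is $0$. $\Delta-T=\{G\in\Delta:G\cap T=\emptyset\}$. $\widetilde H^\bullet$ is reduced simplicial cohomology, computed from the cochain complex including a term in degree $-1$ for the empty face; for the complex $\{\emptyset\}$ it is $V$ in degree $-1$ and $0$ otherwise; for the complex with no faces it is $0$. Hochster's formula (known): $\operatorname{Tor}_i^{V[x_0,\underline{x}]}(V,V[\Delta])\cong\bigoplus_{-1\le q\le n-i,\ |T|=n-i-q}\widetilde H^q(\Delta-T;V)$ and $\operatorname{Ext}^j_{V[x_0,\underline{x}]}(V,V[\Delta])\cong\bigoplus_{-1\le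 q\le j-1,\ |T|=j-q-1}\widetilde H^q(\Delta-T;V)$, with $T\subseteq\{v_0,\dots,v_n\}$. *)

(* Defs.v *)
From HB Require Import structures.
From mathcomp Require Import all_boot all_order all_algebra ring_quotient.
From mathcomp Require Import boolp functions.
From mathcomp Require Import freeg mpoly.

Set Implicit Arguments.
Unset Strict Implicit.
Unset Printing Implicit Defensive.

Import GRing.Theory.
Local Open Scope ring_scope.
Local Open Scope quotient_scope.

Section Submodule.
Context {R : comNzRingType} {M : lmodType R}.

Definition submod (N : submodClosed M) : Type := {x : M | x \in N}.

Section Instances.
Variable N : submodClosed M.
HB.instance Definition _ := SubChoice.on (submod N).
HB.instance Definition _ := [SubChoice_isSubLmodule of submod N by <:].
End Instances.

Definition zmod_pred (N : submodClosed M) : {pred M} := fun x => x \in N.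

Fact zmod_pred_closed N : zmod_closed (zmod_pred N).
Proof.
split=> [|x y Nx Ny]; first exact: rpred0.
by rewrite unfold_in /zmod_pred -scaleN1r rpredD ?rpredZ.
Qed.

HB.instance Definition _ N :=
  GRing.isZmodClosed.Build M (zmod_pred N) (zmod_pred_closed N).

Definition to_zmod (N : submodClosed M) : zmodClosed M := zmod_pred N.

Definition quotmod (N : submodClosed M) : Type := {ideal_quot (to_zmod N)}.

Section Quotient.
Variable N : submodClosed M.
HB.instance Definition _ := GRing.Zmodule.on (quotmod N).

Definition quotmod_pi (x : M) : quotmod N := \pi_{ideal_quot (to_zmod N)} x.

Definition quotmod_repr (x : quotmod N) : M := repr x.

Lemma quotmod_reprK : cancel quotmod_repr quotmod_pi.
Proof. exact: reprK. Qed.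

Lemma quotmod_eqE x y : (quotmod_pi x == quotmod_pi y) = (x - y \in N).
Proof. exact/esym/(Quotient.idealrBE (to_zmod N)). Qed.

Lemma quotmod_piD : {morph quotmod_pi : x y / x + y}.
Proof. exact: (raddfD \pi_{ideal_quot (to_zmod N)}). Qed.

Definition quotmod_scale (a : R) (x : quotmod N) : quotmod N :=
  quotmod_pi (a *: quotmod_repr x).

Lemma quotmod_scaleE a x :
  quotmod_scale a (quotmod_pi x) = quotmod_pi (a *: x).
Proof.
apply/eqP; rewrite quotmod_eqE -scalerBr; apply: rpredZ.
by rewrite -quotmod_eqE quotmod_reprK.
Qed.

Fact quotmod_scalerA a b x :
  quotmod_scale a (quotmod_scale b x) = quotmod_scale (a * b) x.
Proof. by rewrite -[x]quotmod_reprK !quotmod_scaleE scalerA. Qed.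

Fact quotmod_scale1r : left_id 1 quotmod_scale.
Proof. by move=> x; rewrite -[x]quotmod_reprK quotmod_scaleE scale1r. Qed.

Fact quotmod_scalerDr : right_distributive quotmod_scale +%R.
Proof.
move=> a x y; rewrite -[x]quotmod_reprK -[y]quotmod_reprK.
by rewrite -quotmod_piD !quotmod_scaleE scalerDr quotmod_piD.
Qed.

Fact quotmod_scalerDl x : {morph quotmod_scale^~ x : a b / a + b}.
Proof.
move=> a b; rewrite -[x]quotmod_reprK !quotmod_scaleE.
by rewrite scalerDl quotmod_piD.
Qed.

HB.instance Definition _ := GRing.Zmodule_isLmodule.Build R (quotmod N)
  quotmod_scalerA quotmod_scale1r quotmod_scalerDr quotmod_scalerDl.

Fact quotmod_pi_linear : linear quotmod_pi.
Proof. by move=> a x y; rewrite quotmod_piD -quotmod_scaleE. Qed.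

HB.instance Definition _ :=
  GRing.isLinear.Build R M (quotmod N) *:%R quotmod_pi quotmod_pi_linear.

End Quotient.

Definition span_pred (S : M -> Prop) : {pred M} := fun x =>
  `[< exists2 s : seq (R * M), {in s, forall u, S u.2} &
        x = \sum_(u <- s) u.1 *: u.2 >].

Fact span_submod S : GRing.submod_closed (span_pred S).
Proof.
split; first by apply/asboolP; exists [::]; rewrite ?big_nil.
move=> a x y /asboolP[s Ss ->] /asboolP[s' Ss' ->]; apply/asboolP.
exists ([seq (a * u.1, u.2) | u <- s] ++ s').
  by move=> u; rewrite mem_cat => /orP[/mapP[v /Ss ? ->]|/Ss'].
rewrite big_cat big_map scaler_sumr; congr (_ + _).
by apply: eq_bigr => u _; rewrite scalerA.
Qed.

HB.instance Definition _ S :=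
  GRing.isSubmodClosed.Build R M (span_pred S) (span_submod S).

Definition span_mod (S : M -> Prop) : submodClosed M := span_pred S.

Definition mults_pred (a : R) : {pred M} := fun x =>
  `[< exists y, x = a *: y >].

Fact mults_submod a : GRing.submod_closed (mults_pred a).
Proof.
split; first by apply/asboolP; exists 0; rewrite scaler0.
move=> b x y /asboolP[x' ->] /asboolP[y' ->]; apply/asboolP.
by exists (b *: x' + y'); rewrite scalerDr !scalerA mulrC.
Qed.

HB.instance Definition _ a :=
  GRing.isSubmodClosed.Build R M (mults_pred a) (mults_submod a).

Definition mults (a : R) : submodClosed M := mults_pred a.

Definition ann_pred (a : R) : {pred M} := fun x => a *: x == 0.

Fact ann_submod a : GRing.submod_closed (ann_pred a).
Proof.
split; first by rewrite unfold_in /ann_pred scaler0.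
move=> b x y /eqP ax0 /eqP ay0; rewrite unfold_in /ann_pred.
by rewrite scalerDr ay0 addr0 scalerA mulrC -scalerA ax0 scaler0.
Qed.

HB.instance Definition _ a :=
  GRing.isSubmodClosed.Build R M (ann_pred a) (ann_submod a).

Definition ann (a : R) : submodClosed M := ann_pred a.

End Submodule.

Section Subquotient.
Context {R : comNzRingType} {M : lmodType R}.

Definition subquot_pred (Z B : submodClosed M) : {pred submod Z} := fun x =>
  val x \in B.

Fact subquot_submod Z B : GRing.submod_closed (@subquot_pred Z B).
Proof.
split; first exact: (rpred0 B).
by move=> a x y Bx By; apply: (rpredD (rpredZ a Bx) By).
Qed.

HB.instance Definition _ Z B :=
  GRing.isSubmodClosed.Build R (submod Z) (@subquot_pred Z B)
    (@subquot_submod Z B).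

(** [Z / (Z \cap B)] *)
Definition subquot (Z B : submodClosed M) : lmodType R :=
  quotmod (@subquot_pred Z B).

End Subquotient.

Section KernelImage.
Context {R : comNzRingType} {M N : lmodType R} (f : {linear M -> N}).

Definition ker_pred : {pred M} := fun x => f x == 0.

Fact ker_submod : GRing.submod_closed ker_pred.
Proof.
split; first by rewrite unfold_in /ker_pred linear0.
move=> a x y /eqP fx0 /eqP fy0.
by rewrite unfold_in /ker_pred linearP fx0 fy0 scaler0 addr0.
Qed.

HB.instance Definition _ :=
  GRing.isSubmodClosed.Build R M ker_pred ker_submod.

Definition ker : submodClosed M := ker_pred.

Definition im_pred : {pred N} := fun y => `[< exists x, y = f x >].

Fact im_submod : GRing.submod_closed im_pred.
Proof.
split; first by apply/asboolP; exists 0; rewrite linear0.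
move=> a x y /asboolP[x' ->] /asboolP[y' ->]; apply/asboolP.
by exists (a *: x' + y'); rewrite linearP.
Qed.

HB.instance Definition _ :=
  GRing.isSubmodClosed.Build R N im_pred im_submod.

Definition im : submodClosed N := im_pred.

End KernelImage.

Definition homology (R : comNzRingType) (A B C : lmodType R)
  (f : {linear A -> B}) (g : {linear B -> C}) : lmodType R :=
  subquot (ker g) (im f).

Definition lin_iso (R : comNzRingType) (M N : lmodType R) : Prop :=
  exists f : {linear M -> N}, bijective f.

Definition has_dim (K : fieldType) (M : lmodType K) (d : nat) : Prop :=
  exists b : 'I_d -> M,
    forall x : M, exists! c : {ffun 'I_d -> K}, x = \sum_i c i *: b i.

Section Restriction.
Context {A B : comNzRingType}.

Definition restr (f : {rmorphism A -> B}) (M : lmodType B) : Type := M.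

Variables (f : {rmorphism A -> B}) (M : lmodType B).
HB.instance Definition _ := GRing.Zmodule.on (restr f M).

Definition restr_scale (a : A) (x : restr f M) : restr f M := f a *: (x : M).

Fact restr_scalerA a b x :
  restr_scale a (restr_scale b x) = restr_scale (a * b) x.
Proof. by rewrite /restr_scale scalerA rmorphM. Qed.
Fact restr_scale1r : left_id 1 restr_scale.
Proof. by move=> x; rewrite /restr_scale rmorph1 scale1r. Qed.
Fact restr_scalerDr : right_distributive restr_scale +%R.
Proof. by move=> a x y; rewrite /restr_scale scalerDr. Qed.
Fact restr_scalerDl x : {morph restr_scale^~ x : a b / a + b}.
Proof. by move=> a b; rewrite /restr_scale rmorphD scalerDl. Qed.

HB.instance Definition _ := GRing.Zmodule_isLmodule.Build A (restr f M)
  restr_scalerA restr_scale1r restr_scalerDr restr_scalerDl.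
End Restriction.

Section FreeModule.
Context {R : comNzRingType}.

Definition free_mod (X : choiceType) : lmodType R := {freeg X / R}.

Context {X : choiceType} {M : lmodType R} (h : X -> M).

Definition free_lift (u : free_mod X) : M := fglift h u.

Fact free_lift_linear : linear free_lift.
Proof.
have addf : {morph free_lift : u v / u - v >-> u - v}.
  exact: lift_is_additive.
have f0 : free_lift 0 = 0 by rewrite -[0 in LHS](subrr 0) addf subrr.
have addD : {morph free_lift : u v / u + v}.
  move=> u v; have {1}-> : v = - (0 - v) by rewrite sub0r opprK.
  by rewrite !addf f0 sub0r opprK.
have fsum I r (F : I -> free_mod X) :
    free_lift (\sum_(i <- r) F i) = \sum_(i <- r) free_lift (F i).
  exact: (big_morph free_lift addD f0).
move=> a u v; rewrite addD; congr (_ + _).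
rewrite -[u]freeg_sumE scaler_sumr !fsum scaler_sumr; apply: eq_bigr => x _.
have -> : a *: << coeff x u *g x >> = << a * coeff x u *g x >> :> free_mod X.
  by apply/eqP/freeg_eqP => y; rewrite coeffZ !coeffU mulrA.
by rewrite /free_lift !liftU scalerA.
Qed.

HB.instance Definition _ :=
  GRing.isLinear.Build R (free_mod X) M *:%R free_lift free_lift_linear.

End FreeModule.

Section Tensor.
Context {R : comNzRingType}.

Inductive tens_rel (M N : lmodType R) : free_mod (M * N)%type -> Prop :=
| TensDl m m' n : tens_rel (<< (m + m', n) >> - << (m, n) >> - << (m', n) >>)
| TensDr m n n' : tens_rel (<< (m, n + n') >> - << (m, n) >> - << (m, n') >>)
| TensZl a m n : tens_rel (<< (a *: m, n) >> - a *: << (m, n) >>)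
| TensZr a m n : tens_rel (<< (m, a *: n) >> - a *: << (m, n) >>).

Definition tensor (M N : lmodType R) : lmodType R :=
  quotmod (span_mod (@tens_rel M N)).

Definition tens (M N : lmodType R) (m : M) (n : N) : tensor M N :=
  quotmod_pi _ << (m, n) >>.

Context {M M' : lmodType R} (f : {linear M -> M'}) (N : lmodType R).

Definition tens_fun (p : M * N) : tensor M' N := tens (f p.1) p.2.

Definition tens_map (u : tensor M N) : tensor M' N :=
  free_lift tens_fun (quotmod_repr u).

Lemma tens_mapE (w : free_mod (M * N)%type) :
  tens_map (quotmod_pi _ w) = free_lift tens_fun w.
Proof.
pose F : {linear free_mod (M * N)%type -> tensor M' N} := free_lift tens_fun.
have FU m n : F << (m, n) >> = tens (f m) n.
  by rewrite /F /= /free_lift liftU scale1r.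
pose P : {linear free_mod (M' * N)%type -> tensor M' N} := quotmod_pi _.
have PU m n : P << (m, n) >> = tens m n by [].
have P0 z : tens_rel z -> P z = 0.
  move=> rz; apply/eqP; rewrite -[0](linear0 P) quotmod_eqE subr0.
  apply/asboolP; exists [:: (1, z)]; last by rewrite big_seq1 scale1r.
  by move=> u; rewrite inE => /eqP->.
have FZ a u : F (a *: u) = a *: F u by rewrite linearZ.
have PZ a u : P (a *: u) = a *: P u by rewrite linearZ.
have F0 z : tens_rel z -> F z = 0.
  case=> [m m' n|m n n'|a m n|a m n].
  - rewrite !(linearB F) !FU linearD -!PU -!(linearB P).
    by rewrite P0 //; apply: TensDl.
  - rewrite !(linearB F) !FU -!PU -!(linearB P).
    by rewrite P0 //; apply: TensDr.
  - rewrite (linearB F) FZ !FU linearZ -!PU -PZ -(linearB P).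
    by rewrite P0 //; apply: TensZl.
  - rewrite (linearB F) FZ !FU -!PU -PZ -(linearB P).
    by rewrite P0 //; apply: TensZr.
suff: F (quotmod_repr (quotmod_pi (span_mod (@tens_rel M N)) w) - w) = 0.
  by rewrite linearB => /eqP; rewrite subr_eq0 => /eqP.
have : quotmod_repr (quotmod_pi (span_mod (@tens_rel M N)) w) - w
    \in span_mod (@tens_rel M N).
  by rewrite -quotmod_eqE quotmod_reprK.
move=> /asboolP[s Ss ->]; rewrite linear_sum big_seq big1 // => u us.
by rewrite linearZ /= F0 ?scaler0 //; apply: Ss.
Qed.

Fact tens_map_linear : linear tens_map.
Proof.
move=> a u v; rewrite -[u]quotmod_reprK -[v]quotmod_reprK.
by rewrite -linearP !tens_mapE linearP.
Qed.

HB.instance Definition _ := GRing.isLinear.Build R (tensor M N) (tensor M' N)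
  *:%R tens_map tens_map_linear.

End Tensor.

Arguments tens_map {R M M'} f N u.

Section HomModule.
Context {R : comNzRingType}.

Definition hom_pred (M N : lmodType R) : {pred M -> N} :=
  fun f => `[< linear f >].

Fact hom_submod M N : GRing.submod_closed (@hom_pred M N).
Proof.
split; first by apply/asboolP=> a x y; rewrite /= scaler0 addr0.
move=> b f g /asboolP lf /asboolP lg; apply/asboolP=> a x y.
change (b *: f (a *: x + y) + g (a *: x + y) =
        a *: (b *: f x + g x) + (b *: f y + g y)).
by rewrite lf lg !scalerDr !scalerA [b * a]mulrC addrACA.
Qed.

HB.instance Definition _ (M N : lmodType R) :=
  GRing.isSubmodClosed.Build R (M -> N : lmodType R) (@hom_pred M N)
    (@hom_submod M N).

Definition hom (M N : lmodType R) : lmodType R := submod (@hom_pred M N).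

Context {M M' : lmodType R} (f : {linear M -> M'}) (N : lmodType R).

Fact hom_map_subproof (g : hom M' N) : @hom_pred M N (val g \o f).
Proof.
apply/asboolP=> a x y; rewrite /= linearP.
by have /asboolP -> := valP g.
Qed.

Definition hom_map (g : hom M' N) : hom M N :=
  exist _ (val g \o f) (hom_map_subproof g).

Fact hom_map_linear : linear hom_map.
Proof. by move=> a g g'; apply: val_inj. Qed.

HB.instance Definition _ := GRing.isLinear.Build R (hom M' N) (hom M N)
  *:%R hom_map hom_map_linear.

End HomModule.

Arguments hom_map {R M M'} f N g.

Section TorExt.
Context {R : comNzRingType}.

(** The standard free resolution of [M]: [syz M 0 = M], [res M i] is the free
    module on the underlying set of [syz M i], and [syz M i.+1] is the kernel
    of the canonical surjection [res M i -> syz M i]. *)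
Definition cover (M : lmodType R) : {linear free_mod M -> M} := free_lift id.

Fixpoint syz (M : lmodType R) (i : nat) : lmodType R :=
  if i is i'.+1 then submod (ker (cover (syz M i'))) else M.

Definition res (M : lmodType R) (i : nat) : lmodType R := free_mod (syz M i).

Definition res_d (M : lmodType R) (i : nat) : {linear res M i.+1 -> res M i} :=
  (val : syz M i.+1 -> res M i) \o cover (syz M i.+1).

Definition zero_mod : lmodType R := 'rV[R]_0.

Definition Tor (i : int) (M N : lmodType R) : lmodType R :=
  match i with
  | Posz i'.+1 =>
      homology (tens_map (res_d M i'.+1) N) (tens_map (res_d M i') N)
  | Posz 0 =>
      homology (tens_map (res_d M 0) N)
               (\0 : {linear tensor (res M 0) N -> zero_mod})
  | Negz _ => zero_mod
  end.

Definition Ext (j : nat) (M N : lmodType R) : lmodType R :=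
  match j with
  | j'.+1 => homology (hom_map (res_d M j') N) (hom_map (res_d M j'.+1) N)
  | 0 => homology (\0 : {linear zero_mod -> hom (res M 0) N})
                  (hom_map (res_d M 0) N)
  end.

End TorExt.

(** Local principal ideal domain whose maximal ideal, the set of non-units, is
    [tV]; [t != 0] excludes fields. *)
Definition is_dvr (V : idomainType) (t : V) : Prop :=
  [/\ t != 0,
      forall x : V, x \isn't a GRing.unit <-> exists y, x = y * t
    & forall I : submodClosed V^o,
        exists a : V, forall x : V, x \in I <-> exists y, x = y * a].

Record dvr := Dvr { dvr_ring :> idomainType; unif : dvr_ring;
                    dvrP : is_dvr unif }.

Section ResidueField.
Variable V : dvr.
Local Notation t := (unif V).

Definition max_ideal : {pred V} := fun x => `[< exists y, x = y * t >].

Lemma max_idealE x : (x \in max_ideal) = (x \isn't a GRing.unit).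
Proof. by have [_ h _] := dvrP V; apply/asboolP/idP => /h. Qed.

Fact max_ideal_closed : idealr_closed max_ideal.
Proof.
split; first by apply/asboolP; exists 0; rewrite mul0r.
  by rewrite max_idealE negbK unitr1.
move=> a x y /asboolP[x' ->] /asboolP[y' ->]; apply/asboolP.
by exists (a * x' + y'); rewrite mulrDl mulrA.
Qed.

HB.instance Definition _ := isIdealr.Build V max_ideal max_ideal_closed.

Definition resfield : Type := {ideal_quot max_ideal}.

HB.instance Definition _ := GRing.ComNzRing.on resfield.

Definition to_resfield (x : V) : resfield := \pi_{ideal_quot max_ideal} x.

Definition resfield_repr (x : resfield) : V := repr x.

Lemma resfield_reprK : cancel resfield_repr to_resfield.
Proof. exact: reprK. Qed.

Lemma to_resfield_eqE x y :
  (to_resfield x == to_resfield y) = (x - y \in max_ideal).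
Proof. exact/esym/(Quotient.idealrBE max_ideal). Qed.

Fact to_resfield_zmod_morphism : zmod_morphism to_resfield.
Proof. exact: (raddfB \pi_{ideal_quot max_ideal}). Qed.

Fact to_resfield_monoid_morphism : monoid_morphism to_resfield.
Proof. exact: pi_is_monoid_morphism. Qed.

HB.instance Definition _ := GRing.isZmodMorphism.Build V resfield to_resfield
  to_resfield_zmod_morphism.
HB.instance Definition _ := GRing.isMonoidMorphism.Build V resfield to_resfield
  to_resfield_monoid_morphism.

Definition resfield_inv (x : resfield) : resfield :=
  if x == 0 then 0 else to_resfield (resfield_repr x)^-1.

Fact resfield_mulVf x : x != 0 -> resfield_inv x * x = 1.
Proof.
move=> x0; rewrite /resfield_inv (negPf x0) -[x in _ * x]resfield_reprK.
rewrite -rmorphM mulVr ?rmorph1 //.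
rewrite -[_ \in _]negbK -max_idealE; apply: contra x0 => xI.
by rewrite -[x]resfield_reprK -(rmorph0 to_resfield) to_resfield_eqE subr0.
Qed.

Fact resfield_invr0 : resfield_inv 0 = 0.
Proof. by rewrite /resfield_inv eqxx. Qed.

HB.instance Definition _ :=
  GRing.ComNzRing_isField.Build resfield resfield_mulVf resfield_invr0.

End ResidueField.

Definition killed (V : dvr) (M : lmodType V) : Prop :=
  forall x : M, unif V *: x = 0.

Section VectorSpace.
Variables (V : dvr) (M : lmodType V) (M0 : killed M).

(** [M] itself, with [V / tV] acting through representatives in [V] *)
Definition kspace of killed M : Type := M.
Local Notation KM := (kspace M0).

HB.instance Definition _ := GRing.Zmodule.on KM.

Definition kspace_scale (c : resfield V) (x : KM) : KM :=
  resfield_repr c *: (x : M).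

Lemma kspace_scaleE (a : V) (x : KM) :
  kspace_scale (to_resfield a) x = a *: (x : M).
Proof.
apply/eqP; rewrite -subr_eq0 /kspace_scale -[_ - _]scalerBl.
have : resfield_repr (to_resfield a) - a \in @max_ideal V.
  by rewrite -to_resfield_eqE resfield_reprK.
by move=> /asboolP[y ->]; rewrite -scalerA M0 scaler0.
Qed.

Fact kspace_scalerA a b x :
  kspace_scale a (kspace_scale b x) = kspace_scale (a * b) x.
Proof.
rewrite -[a]resfield_reprK -[b]resfield_reprK -rmorphM !kspace_scaleE.
exact: scalerA.
Qed.

Fact kspace_scale1r : left_id 1 kspace_scale.
Proof.
move=> x; rewrite -(rmorph1 (@to_resfield V)) kspace_scaleE; exact: scale1r.
Qed.

Fact kspace_scalerDr : right_distributive kspace_scale +%R.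
Proof. by move=> a x y; apply: scalerDr. Qed.

Fact kspace_scalerDl x : {morph kspace_scale^~ x : a b / a + b}.
Proof.
move=> a b; rewrite -[a]resfield_reprK -[b]resfield_reprK -rmorphD.
by rewrite !kspace_scaleE; apply: scalerDl.
Qed.

HB.instance Definition _ := GRing.Zmodule_isLmodule.Build (resfield V) KM
  kspace_scalerA kspace_scale1r kspace_scalerDr kspace_scalerDl.

End VectorSpace.

Section TorsionParts.
Variables (V : dvr) (M : lmodType V).

Fact mod_t_killed : killed (quotmod (mults (unif V) : submodClosed M)).
Proof.
move=> x; rewrite -[x]quotmod_reprK -linearZ_LR.
rewrite -[RHS](linear0 (quotmod_pi _)); apply/eqP.
by rewrite quotmod_eqE subr0; apply/asboolP; exists (quotmod_repr x).
Qed.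

Fact ann_t_killed : killed (submod (ann (unif V) : submodClosed M)).
Proof. by move=> x; apply: val_inj; apply/eqP; apply: (valP x). Qed.

Definition mod_t : lmodType (resfield V) := kspace mod_t_killed.

Definition ann_t : lmodType (resfield V) := kspace ann_t_killed.

End TorsionParts.

(** The vertex [v_i] is [i : 'I_m]; it need not be a face. *)
Definition simplicial (m : nat) (D : {set {set 'I_m}}) : Prop :=
  forall F G : {set 'I_m}, F \in D -> G \subset F -> G \in D.

Definition deletion (m : nat) (D : {set {set 'I_m}}) (T : {set 'I_m}) :
  {set {set 'I_m}} := [set G in D | G :&: T == set0].

(** [R / (S)] *)
Definition cyclic_mod (R : comNzRingType) (S : R -> Prop) : lmodType R :=
  quotmod (span_mod (S : R^o -> Prop)).

Definition nonface_monomial (R : comNzRingType) (m : nat)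
  (D : {set {set 'I_m}}) (x : 'I_m -> R) (f : R) : Prop :=
  exists2 F : {set 'I_m}, F \notin D & f = \prod_(i in F) x i.

Section StanleyReisner.
Variables (V : dvr) (n : nat).
Local Notation t := (unif V).

(** In [V[x_0, ..., x_n]] the variable [x_i] is ['X_i] with [i : 'I_n.+1]; in
    [V[x_1, ..., x_n]] the variable [x_i] is ['X_j], [j : 'I_n], [i = j + 1]. *)
Local Notation Sx := {mpoly V[n.+1]}.
Local Notation Rx := {mpoly V[n]}.

(** The image of [x_i] under [x_0 |-> t]. *)
Definition subst_x0 (i : 'I_n.+1) : Rx :=
  if unlift ord0 i is Some j then 'X_j else t%:MP.

Definition SR (D : {set {set 'I_n.+1}}) : lmodType Sx :=
  cyclic_mod (nonface_monomial D (fun i => 'X_i)).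

Definition tSR (D : {set {set 'I_n.+1}}) : lmodType Rx :=
  cyclic_mod (nonface_monomial D subst_x0).

(** [V = V[x_0, ..., x_n] / (x_0, ..., x_n)] *)
Definition V_mod : lmodType Sx := cyclic_mod (fun f => exists i, f = 'X_i).

(** [K = V[x_1, ..., x_n] / (t, x_1, ..., x_n)] *)
Definition K_mod : lmodType Rx :=
  cyclic_mod (fun f => f = t%:MP \/ exists i, f = 'X_i).

(** The polynomial rings act through their constants [V]; the variables kill
    all of these modules. *)
Definition TorV (i : int) (D : {set {set 'I_n.+1}}) : lmodType V :=
  restr (@mpolyC n.+1 V) (Tor i V_mod (SR D)).
Definition TorK (i : int) (D : {set {set 'I_n.+1}}) : lmodType V :=
  restr (@mpolyC n V) (Tor i K_mod (tSR D)).
Definition ExtV (j : nat) (D : {set {set 'I_n.+1}}) : lmodType V :=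
  restr (@mpolyC n.+1 V) (Ext j V_mod (SR D)).
Definition ExtK (j : nat) (D : {set {set 'I_n.+1}}) : lmodType V :=
  restr (@mpolyC n V) (Ext j K_mod (tSR D)).

End StanleyReisner.

Section Cohomology.
Variables (A : comNzRingType) (m : nat) (D : {set {set 'I_m}}).

(** Cochains are functions on all subsets of the vertex set; those of degree
    [q] vanish outside the faces with [q + 1] vertices. *)
Definition cochain : lmodType A := {ffun {set 'I_m} -> A^o}.

Definition cochain_pred (q : int) : {pred cochain} := fun f =>
  [forall F : {set 'I_m},
     (f F != 0) ==> (F \in D) && (#|F|%:Z == q + 1)].

(** [(d f) F = \sum_k (-1)^k f (F minus its k-th vertex)] for a face [F] *)
Definition cobd (f : cochain) : cochain :=
  [ffun F : {set 'I_m} =>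
     if F \in D then
       \sum_(v in F) (-1) ^+ #|[set u in F | (u < v)%N]| * (f (F :\ v) : A)
     else 0].

Fact cobd_linear : linear cobd.
Proof.
move=> a f g; apply/ffunP=> F; rewrite !ffunE.
case: ifP => _; last by rewrite scaler0 addr0.
rewrite scaler_sumr -big_split /=; apply: eq_bigr => v _; rewrite !ffunE.
by rewrite mulrDr; congr (_ + _); rewrite /GRing.scale /= mulrCA.
Qed.

HB.instance Definition _ :=
  GRing.isLinear.Build A cochain cochain *:%R cobd cobd_linear.

Definition cocycle_pred (q : int) : {pred cochain} := fun f =>
  (f \in cochain_pred q) && (cobd f == 0).

Definition cobound_pred (q : int) : {pred cochain} := fun f =>
  `[< exists2 g, g \in cochain_pred (q - 1) & f = cobd g >].

Fact cochain_submod q : GRing.submod_closed (cochain_pred q).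
Proof.
split; first by apply/forallP=> F; rewrite !ffunE eqxx.
move=> a f g /forallP Cf /forallP Cg; apply/forallP=> F; rewrite !ffunE.
apply/implyP=> nz; have [gF0|gF] := eqVneq (g F) 0; last first.
  by have := Cg F; rewrite gF.
have := Cf F; case: (eqVneq (f F) 0) nz => // ->.
by rewrite gF0 scaler0 addr0 eqxx.
Qed.

Fact cocycle_submod q : GRing.submod_closed (cocycle_pred q).
Proof.
have [C0 CP] := cochain_submod q; split.
  by rewrite unfold_in /cocycle_pred C0 linear0 eqxx.
move=> a f g /andP[Cf /eqP df] /andP[Cg /eqP dg].
apply/andP; split; first exact: CP.
by apply/eqP; rewrite linearP [X in _ *: X + _]df [X in _ + X]dg scaler0 addr0.
Qed.

Fact cobound_submod q : GRing.submod_closed (cobound_pred q).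
Proof.
have [C0 CP] := cochain_submod (q - 1); split.
  by apply/asboolP; exists 0; rewrite ?linear0.
move=> a f g /asboolP[f' Cf ->] /asboolP[g' Cg ->]; apply/asboolP.
by exists (a *: f' + g'); [apply: CP | rewrite linearP].
Qed.

HB.instance Definition _ q :=
  GRing.isSubmodClosed.Build A cochain (cocycle_pred q) (cocycle_submod q).
HB.instance Definition _ q :=
  GRing.isSubmodClosed.Build A cochain (cobound_pred q) (cobound_submod q).

Definition rcohomology (q : int) : lmodType A :=
  subquot (cocycle_pred q) (cobound_pred q).

End Cohomology.

(* Main.v *)
From HB Require Import structures.
From mathcomp Require Import all_boot all_order all_algebra.
From mathcomp Require Import boolp functions.
From mathcomp Require Import freeg mpoly.
From mathcomp Require Import zify.
Require Import Defs.

(** By comparison of projective resolutions, [Tor] and [Ext] of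
    [A / (y_0, ..., y_n)] with a module are read off the Koszul complex of [y]
    as soon as the latter resolves [A / (y_0, ..., y_n)]. As that complex is
    self-dual, both are the cohomology of a single cochain complex, [Ext^j] in
    degree [j] and [Tor_i] in degree [n + 1 - i].

    For [y = (x_0, ..., x_n)] and the module [V[Delta]] this cochain complex is
    multigraded. A multidegree [a] with some [a_i >= 2] contributes nothing, by
    contraction along [v_i]; the squarefree multidegree supported on the
    complement of [T] contributes the cochains of [Delta - T]. This is
    Hochster's formula. Contracting along [v_i] whenever [a_i >= 1] shows in the
    same way that the Koszul complex of [V[x_0, ..., x_n]] is a resolution.

    The element [x_0 - t] is a nonzerodivisor on [V[Delta]] with quotient the
    [t]-Stanley-Reisner ring, and [x_0] is null-homotopic on the Koszul complex,
    so [x_0 - t] acts as [-t] on cohomology. The long exact sequence therefore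
    breaks up into
    [0 -> H^j / t H^j -> H^j (quotient) -> Ann_(H^(j+1)) t -> 0].
    For the full simplex this yields exactness of the Koszul complex of
    [(t, x_1, ..., x_n)]; in general all three terms are finite-dimensional over
    [V / tV], so both isomorphisms follow by counting dimensions. *)

Set Implicit Arguments.
Unset Strict Implicit.
Unset Printing Implicit Defensive.

Import Order.TTheory GRing.Theory.
Local Open Scope ring_scope.

(** * Presentations of subquotients and tensor products *)

(** [Tor], [Ext] and the reduced cohomology live in nested quotient types over different rings.
    Instead of composing isomorphisms between them, each is presented as [Z / B] by two predicates
    on an ambient module, and the comparisons take place between predicates. In the end the ambient
    module is the same for [Tor], [Ext] and their specializations: the functions from vertex sets to
    [V[Delta]], with the polynomial action restricted to [V]. The short exact sequence splits only
    after a choice of bases, so the isomorphisms come from equal dimensions, and counting needs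
    finiteness. As a [V]-module [V[Delta]] is in general of infinite rank; finiteness appears only
    once Hochster's reduction has replaced it by cochains on finitely many sets. Hence Hochster's
    formula is proved, at the level of dimensions, and serves the two isomorphisms as well as the
    last claim. Exactness for [(t, x_1, ..., x_n)] is not a matter of multidegrees, [t] being a
    scalar. Reduction modulo [x_0 - t] is therefore set up for an abstract quotient of the
    polynomial ring, so as to apply to the ring itself and to [V[Delta]] alike. *)

(* [X] is isomorphic to [Z / B]; outside [Z] the map [p] is arbitrary. *)
Definition pres (A : comNzRingType) (X M : lmodType A) (Z B : M -> Prop) :=
  exists p : M -> X,
    [/\ forall a x y, Z x -> Z y -> p (a *: x + y) = a *: p x + p y,
        forall x, exists2 z, Z z & p z = x
      & forall z, Z z -> (p z = 0 <-> B z)].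

Section Presentations.
Variable A : comNzRingType.

Lemma quotmod_pi_eq0 (M : lmodType A) (N : submodClosed M) x :
  (quotmod_pi N x == 0) = (x \in N).
Proof.
have pi0 : quotmod_pi N 0 = 0 by apply: linear0.
by rewrite -[X in _ == X]pi0 quotmod_eqE subr0.
Qed.

Lemma pres_subquot (M : lmodType A) (Z B : submodClosed M) :
  pres (subquot Z B) (fun x => x \in Z) (fun x => x \in B).
Proof.
exists (fun x => quotmod_pi (@subquot_pred _ _ Z B) (insubd (0 : submod Z) x)).
split=> [a x y Zx Zy|x|z Zz].
- rewrite -linearP; congr quotmod_pi; apply: val_inj => /=.
  have Zxy : a *: x + y \in Z by rewrite rpredD ?rpredZ.
  by rewrite !insubdK.
- exists (val (quotmod_repr x)); first exact: valP.
  by rewrite valKd quotmod_reprK.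
- have e : quotmod_pi (@subquot_pred _ _ Z B) (insubd (0 : submod Z) z) == 0
             = (z \in B).
    by rewrite quotmod_pi_eq0 unfold_in /= /subquot_pred insubdK.
  by rewrite -e; split=> /eqP.
Qed.

(** A presentation is pulled back along any [phi] that induces an isomorphism [Z' / B' -> Z / B]:
    the last two hypotheses are its injectivity, with well-definedness, and its surjectivity. *)
Lemma pres_back (X M M' : lmodType A) (Z B : M -> Prop) (Z' B' : M' -> Prop)
    (phi : M' -> M) :
    (forall a x y, phi (a *: x + y) = a *: phi x + phi y) ->
    (forall a x y, Z x -> Z y -> Z (a *: x + y)) ->
    (forall z, Z' z -> Z (phi z)) ->
    (forall z, Z' z -> (B (phi z) <-> B' z)) ->
    (forall z, Z z -> exists2 z', Z' z' & B (z - phi z')) ->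
  pres X Z B -> pres X Z' B'.
Proof.
move=> phiP Zl Z'Z BB' surj [p [pl ps pk]]; exists (p \o phi); split=> /=.
- by move=> a x y Zx Zy; rewrite phiP pl //; apply: Z'Z.
- move=> x; have [z Zz pz] := ps x; have [z' Zz' Bz] := surj z Zz.
  exists z' => //; rewrite -pz; have Zp := Z'Z _ Zz'.
  have e : z - phi z' = (-1) *: phi z' + z by rewrite scaleN1r addrC.
  have Zd : Z (z - phi z') by rewrite e; apply: Zl.
  have := (pk _ Zd).2 Bz; rewrite e pl // scaleN1r => /eqP.
  by rewrite addrC subr_eq0 => /eqP.
- by move=> z Zz; rewrite pk ?BB' //; apply: Z'Z.
Qed.

Lemma pres_ext (X M : lmodType A) (Z B Z' B' : M -> Prop) :
    (forall z, Z' z <-> Z z) -> (forall z, Z z -> (B' z <-> B z)) ->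
  pres X Z B -> pres X Z' B'.
Proof.
move=> ZZ BB [p [pl ps pk]]; exists p; split.
- by move=> a x y /ZZ ? /ZZ ?; apply: pl.
- by move=> x; have [z /ZZ ? ?] := ps x; exists z.
- by move=> z /ZZ Zz; rewrite BB // pk.
Qed.

Lemma pres_restr (B' : comNzRingType) (f : {rmorphism B' -> A})
    (X M : lmodType A) (Z B : M -> Prop) :
  pres X Z B -> pres (restr f X) (Z : restr f M -> Prop) B.
Proof.
by case=> p [pl ps pk]; exists p; split=> // a x y Zx Zy; apply: pl.
Qed.

End Presentations.

Lemma submod_valP (A : comNzRingType) (M : lmodType A) (N : submodClosed M) a
    (x y : submod N) :
  val (a *: x + y) = a *: val x + val y.
Proof. exact: (linearP (val : submod N -> M)). Qed.

Lemma submod_val0 (A : comNzRingType) (M : lmodType A) (N : submodClosed M) :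
  val (0 : submod N) = 0.
Proof. exact: (linear0 (val : submod N -> M)). Qed.

Lemma quot_lift (A : comNzRingType) (M L : lmodType A) (N : submodClosed M)
    (G : {linear M -> L}) :
  (forall x, x \in N -> G x = 0) ->
  {F : {linear quotmod N -> L} | forall x, F (quotmod_pi N x) = G x}.
Proof.
move=> G0; pose F (u : quotmod N) := G (quotmod_repr u).
have FE x : F (quotmod_pi N x) = G x.
  apply/eqP; rewrite -subr_eq0 -linearB; apply/eqP/G0.
  by rewrite -quotmod_eqE quotmod_reprK.
have Fl : linear F.
  move=> a u v; rewrite -[u]quotmod_reprK -[v]quotmod_reprK -linearP !FE.
  exact: linearP.
pose H : {linear quotmod N -> L} :=
  HB.pack F (GRing.isLinear.Build A (quotmod N) L *:%R F Fl).
by exists H.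
Qed.

Lemma span_vanish (A : comNzRingType) (M L : lmodType A) (S : M -> Prop)
    (G : {linear M -> L}) :
  (forall x, S x -> G x = 0) -> forall x, x \in span_mod S -> G x = 0.
Proof.
move=> G0 x /asboolP[s Ss ->]; rewrite linear_sum big_seq big1 // => u us.
by rewrite linearZ /= G0 ?scaler0 //; apply: Ss.
Qed.

Section TensorTheory.
Context {A : comNzRingType}.

Lemma tens_rel_pi (M N : lmodType A) (z : free_mod (M * N)%type) :
  tens_rel z -> quotmod_pi (span_mod (@tens_rel A M N)) z = 0.
Proof.
move=> rz; apply/eqP; rewrite quotmod_pi_eq0; apply/asboolP.
exists [:: (1, z)]; last by rewrite big_seq1 scale1r.
by move=> u; rewrite inE => /eqP->.
Qed.

Lemma tensDl (M N : lmodType A) (m m' : M) (n : N) :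
  tens (m + m') n = tens m n + tens m' n.
Proof.
have := tens_rel_pi (TensDl m m' n); rewrite !linearB => /eqP.
by rewrite -addrA -opprD subr_eq0 => /eqP.
Qed.

Lemma tensDr (M N : lmodType A) (m : M) (n n' : N) :
  tens m (n + n') = tens m n + tens m n'.
Proof.
have := tens_rel_pi (TensDr m n n'); rewrite !linearB => /eqP.
by rewrite -addrA -opprD subr_eq0 => /eqP.
Qed.

Lemma tensZl (M N : lmodType A) a (m : M) (n : N) :
  tens (a *: m) n = a *: tens m n.
Proof.
have := tens_rel_pi (TensZl a m n); rewrite linearB linearZ => /eqP.
by rewrite subr_eq0 => /eqP.
Qed.

Lemma tensZr (M N : lmodType A) a (m : M) (n : N) :
  tens m (a *: n) = a *: tens m n.
Proof.
have := tens_rel_pi (TensZr a m n); rewrite linearB linearZ => /eqP.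
by rewrite subr_eq0 => /eqP.
Qed.

Lemma tens_suml (M N : lmodType A) I (r : seq I) P (F : I -> M) (n : N) :
  tens (\sum_(i <- r | P i) F i) n = \sum_(i <- r | P i) tens (F i) n.
Proof.
apply: (big_morph (fun m => tens m n)) => [x y|]; first exact: tensDl.
by rewrite -[0 in LHS](scale0r (0 : M)) tensZl scale0r.
Qed.

Lemma tens_map_tens (M M' N : lmodType A) (f : {linear M -> M'}) (m : M) (n : N) :
  tens_map f N (tens m n) = tens (f m) n.
Proof. by rewrite /tens tens_mapE /free_lift liftU scale1r. Qed.

Lemma free_span (X : choiceType) (u : free_mod X) :
  exists s : seq (A * X), u = \sum_(c <- s) c.1 *: (<< c.2 >> : free_mod X).
Proof.
exists [seq (coeff x u, x) | x <- dom u]; rewrite big_map -[LHS]freeg_sumE.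
apply: eq_bigr => x _ /=; apply/eqP/freeg_eqP => y.
by rewrite coeffZ !coeffU mul1r.
Qed.

Lemma free_ext (X : choiceType) (M : lmodType A) (f g : {linear free_mod X -> M}) :
  (forall x, f << x >> = g << x >>) -> f =1 g.
Proof.
move=> fg u; have [s ->] := free_span u; rewrite !linear_sum.
by apply: eq_bigr => c _; rewrite !linearZ /= fg.
Qed.

Lemma tens_ext (M N L : lmodType A) (f g : {linear tensor M N -> L}) :
  (forall m n, f (tens m n) = g (tens m n)) -> f =1 g.
Proof.
move=> fg u; rewrite -[u]quotmod_reprK.
pose F : {linear free_mod (M * N)%type -> L} := f \o quotmod_pi _.
pose G : {linear free_mod (M * N)%type -> L} := g \o quotmod_pi _.
have FG : F =1 G by apply: free_ext => -[m n]; apply: fg.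
exact: FG.
Qed.

Lemma free_liftU (X : choiceType) (M : lmodType A) (h : X -> M) x :
  free_lift h << x >> = h x.
Proof. by rewrite /free_lift liftU scale1r. Qed.

Lemma tens_lift (M N L : lmodType A) (b : M -> N -> L) :
    (forall n, linear (b^~ n)) -> (forall m, linear (b m)) ->
  {F : {linear tensor M N -> L} | forall m n, F (tens m n) = b m n}.
Proof.
move=> bl br.
have blD m m' n : b (m + m') n = b m n + b m' n.
  by have := bl n 1 m m'; rewrite !scale1r.
have brD m n n' : b m (n + n') = b m n + b m n'.
  by have := br m 1 n n'; rewrite !scale1r.
have bl0 n : b 0 n = 0 by apply: (addrI (b 0 n)); rewrite -blD !addr0.
have br0 m : b m 0 = 0 by apply: (addrI (b m 0)); rewrite -brD !addr0.
have blZ a m n : b (a *: m) n = a *: b m n.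
  by have := bl n a m 0; rewrite bl0 !addr0.
have brZ a m n : b m (a *: n) = a *: b m n.
  by have := br m a n 0; rewrite br0 !addr0.
pose G : {linear free_mod (M * N)%type -> L} := free_lift (fun p => b p.1 p.2).
have GU m n : G << (m, n) >> = b m n by rewrite /G /= free_liftU.
have [|F FE] := @quot_lift A _ L (span_mod (@tens_rel A M N)) G.
  apply: span_vanish => _ [m m' n|m n n'|a m n|a m n]; rewrite !linearB.
  - by rewrite !GU blD addrAC addrK subrr.
  - by rewrite !GU brD addrAC addrK subrr.
  - by rewrite linearZ !GU blZ subrr.
  - by rewrite linearZ !GU brZ subrr.
by exists F => m n; rewrite -GU -FE.
Qed.

End TensorTheory.

(** * Comparison of projective resolutions *)

Section Resolutions.
Context {A : comNzRingType}.

(** Lifting is asked against every [g] whose image contains that of [f], not only against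
    surjections. It then applies directly to a differential, without restricting its codomain to the
    cycles. *)
Definition projective (P : lmodType A) := forall (B C : lmodType A)
    (g : {linear B -> C}) (f : {linear P -> C}),
  (forall x, exists y, g y = f x) ->
  exists h : {linear P -> B}, forall x, g (h x) = f x.

Lemma free_projective (X : choiceType) : projective (@free_mod A X).
Proof.
move=> B C g f gf; have /choice[h hP] x := gf << x >>.
exists (free_lift h) => x.
pose F : {linear free_mod X -> C} := g \o free_lift h.
by apply: (free_ext (f := F)) => {}x; rewrite /F /= free_liftU.
Qed.

Record resolution (M : lmodType A) := Resolution {
  rmod :> nat -> lmodType A;
  rdiff : forall i, {linear rmod i.+1 -> rmod i};
  raug : {linear rmod 0%N -> M};
  rmod_projective : forall i, projective (rmod i);
  raug_surj : forall x, exists y, raug y = x;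
  rexact0 : forall x, raug x = 0 <-> exists y, rdiff 0 y = x;
  rexact : forall i x, rdiff i x = 0 <-> exists y, rdiff i.+1 y = x }.

Definition rcycle (M : lmodType A) (P : resolution M) (i : nat) : P i -> Prop :=
  if i is i'.+1 then fun x => rdiff P i' x = 0 else fun x => raug P x = 0.

Lemma rcycleP (M : lmodType A) (P : resolution M) i (x : P i) :
  rcycle x <-> exists y, rdiff P i y = x.
Proof. by case: i x => [|i] x; [apply: rexact0 | apply: rexact]. Qed.

Lemma rcycle_diff (M : lmodType A) (P : resolution M) i x :
  rcycle (rdiff P i x).
Proof. by apply/rcycleP; exists x. Qed.

(** Chain maps and homotopies are built by recursion, where the existence of each stage depends on
    an invariant of the previous one; here [T i] carries the stage together with its invariant. *)
Lemma dep_choice (T : nat -> Type) (R : forall i, T i -> T i.+1 -> Prop) t0 :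
    (forall i t, exists t', R i t t') ->
  exists2 s : forall i, T i, s 0%N = t0 & forall i, R i (s i) (s i.+1).
Proof.
move=> step; pose nxt i t := projT1 (cid (step i t)).
exists (nat_rect T t0 nxt) => // i.
exact: projT2 (cid (step i _)).
Qed.

Lemma chain_lift (M : lmodType A) (P Q : resolution M) :
  exists f : forall i, {linear P i -> Q i},
    (forall x, raug Q (f 0%N x) = raug P x) /\
    forall i x, rdiff Q i (f i.+1 x) = f i (rdiff P i x).
Proof.
have [f0 f0P] := rmod_projective (g := raug Q) (f := raug P)
  (fun x => raug_surj Q (raug P x)).
(* The invariant: [f] sends boundaries to cycles. By exactness of [Q] this is what the next lift
   needs. *)
pose T i := {f : {linear P i -> Q i} | forall x, rcycle (f (rdiff P i x))}.
have t0P x : rcycle (f0 (rdiff P 0%N x)).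
  by rewrite /rcycle f0P; apply: (rcycle_diff (P := P) (i := 0%N)).
pose R i (t : T i) (t' : T i.+1) :=
  forall x, rdiff Q i (sval t' x) = sval t (rdiff P i x).
have [i [f fP]|s s0 sP] := @dep_choice T R (exist _ f0 t0P).
  have [|g gP] := rmod_projective (g := rdiff Q i) (f := f \o rdiff P i).
    by move=> x; apply/rcycleP/fP.
  have gP' x : rcycle (g (rdiff P i.+1 x)).
    rewrite /= gP /=.
    have -> : rdiff P i (rdiff P i.+1 x) = 0.
      exact: (rcycle_diff (P := P) (i := i.+1)).
    by rewrite linear0.
  by exists (exist _ g gP').
by exists (fun i => sval (s i)); split=> [x|i x]; [rewrite s0 f0P | rewrite sP].
Qed.

Lemma chain_null (M : lmodType A) (P Q : resolution M)
    (f : forall i, {linear P i -> Q i}) :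
    (forall x, raug Q (f 0%N x) = 0) ->
    (forall i x, rdiff Q i (f i.+1 x) = f i (rdiff P i x)) ->
  exists h : forall i, {linear P i -> Q i.+1},
    (forall x, rdiff Q 0 (h 0%N x) = f 0%N x) /\
    forall i x, rdiff Q i.+1 (h i.+1 x) + h i (rdiff P i x) = f i.+1 x.
Proof.
move=> f0 fP.
have dd i x : rdiff P i (rdiff P i.+1 x) = 0.
  exact: (rcycle_diff (P := P) (i := i.+1)).
have [|h0 h0P] := rmod_projective (g := rdiff Q 0) (f := f 0%N).
  by move=> x; apply/(rcycleP (P := Q) (i := 0%N))/f0.
(* The defect [f - h d] takes values in cycles of [Q], hence in boundaries, and so can be lifted at
   the next stage. *)
pose T i := {h : {linear P i -> Q i.+1} |
  forall x, rdiff Q i (f i.+1 x - h (rdiff P i x)) = 0}.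
have t0P x : rdiff Q 0 (f 1%N x - h0 (rdiff P 0 x)) = 0.
  by rewrite linearB /= fP h0P subrr.
pose R i (t : T i) (t' : T i.+1) :=
  forall x, rdiff Q i.+1 (sval t' x) = f i.+1 x - sval t (rdiff P i x).
have [i [h hP]|s s0 sP] := @dep_choice T R (exist _ h0 t0P).
  have [|g gP] := rmod_projective (g := rdiff Q i.+1)
      (f := f i.+1 \- (h \o rdiff P i)).
    by move=> x; apply/(rcycleP (P := Q) (i := i.+1))/hP.
  have gP' x : rdiff Q i.+1 (f i.+2 x - g (rdiff P i.+1 x)) = 0.
    by rewrite linearB /= fP gP /= dd linear0 subr0 subrr.
  by exists (exist _ g gP').
exists (fun i => sval (s i)); split=> [x|i x]; first by rewrite s0 h0P.
by rewrite sP subrK.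
Qed.

Lemma chain_homotopy (M : lmodType A) (P Q : resolution M)
    (f : forall i, {linear P i -> Q i}) (g : forall i, {linear Q i -> P i}) :
    (forall x, raug Q (f 0%N x) = raug P x) ->
    (forall i x, rdiff Q i (f i.+1 x) = f i (rdiff P i x)) ->
    (forall x, raug P (g 0%N x) = raug Q x) ->
    (forall i x, rdiff P i (g i.+1 x) = g i (rdiff Q i x)) ->
  exists h : forall i, {linear P i -> P i.+1},
    (forall x, rdiff P 0 (h 0%N x) = x - g 0%N (f 0%N x)) /\
    forall i x, rdiff P i.+1 (h i.+1 x) + h i (rdiff P i x) = x - g i.+1 (f i.+1 x).
Proof.
move=> f0 fP g0 gP; pose e i : {linear P i -> P i} := idfun \- (g i \o f i).
have [x|i x|h hP] := @chain_null M P P e; last by exists h.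
- by rewrite /e /= linearB /= g0 f0 subrr.
- by rewrite /e /= linearB /= gP fP.
Qed.

Lemma cover_surj (L : lmodType A) (x : L) : exists y, cover L y = x.
Proof. by exists << x >>; rewrite /cover /= free_liftU. Qed.

Lemma cover_exact (L : lmodType A) (x : free_mod L) :
  cover L x = 0 <-> exists y : free_mod (submod (ker (cover L))),
    val (cover (submod (ker (cover L))) y) = x.
Proof.
split=> [x0|[y <-]].
  have kx : x \in ker (cover L) by apply/eqP.
  have [y yx] := cover_surj (exist _ x kx : submod (ker (cover L))).
  by exists y; rewrite yx.
by apply/eqP; exact: (valP (cover (submod (ker (cover L))) y)).
Qed.

(** The inclusion [val] is injective, so [res_d] has the same kernel as the cover it is composed
    with, and exactness is that of the next cover. *)
Lemma res_d_exact (M : lmodType A) i x :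
  res_d M i x = 0 <-> exists y, res_d M i.+1 y = x.
Proof.
rewrite -[X in _ <-> X]cover_exact; split=> x0.
  by apply: val_inj; rewrite [LHS]x0.
by rewrite /res_d /= x0.
Qed.

Definition std_resolution (M : lmodType A) : resolution M :=
  @Resolution M (res M) (res_d M) (cover M)
    (fun i => @free_projective (syz M i)) (@cover_surj M) (@cover_exact M)
    (@res_d_exact M).

End Resolutions.

Section HomTheory.
Context {A : comNzRingType}.

Lemma homP (M N : lmodType A) (z : hom M N) : linear (val z).
Proof. exact/asboolP/(valP z). Qed.

Definition hom_lin (M N : lmodType A) (z : hom M N) : {linear M -> N} :=
  HB.pack (val z : M -> N)
    (GRing.isLinear.Build A M N *:%R (val z : M -> N) (homP z)).

Definition lin_hom (M N : lmodType A) (f : {linear M -> N}) : hom M N :=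
  exist _ (f : M -> N) (introT (asboolP _) (linearP f)).

Lemma hom_linE (M N : lmodType A) (z : hom M N) x : hom_lin z x = val z x.
Proof. by []. Qed.

Lemma lin_homE (M N : lmodType A) (f : {linear M -> N}) x : val (lin_hom f) x = f x.
Proof. by []. Qed.

Lemma hom_ext (M N : lmodType A) (z w : hom M N) : val z =1 val w -> z = w.
Proof. by move=> zw; apply/val_inj/funext. Qed.

Lemma hom_mapE (M M' N : lmodType A) (f : {linear M -> M'}) (z : hom M' N) x :
  val (hom_map f N z) x = val z (f x).
Proof. by []. Qed.

End HomTheory.

(** * Independence of Tor and Ext from the chosen resolution *)

Section Comparison.
Context {A : comNzRingType}.

Definition homotopic_id (M : lmodType A) (P : resolution M)
    (e : forall i, P i -> P i) (h : forall i, {linear P i -> P i.+1}) : Prop :=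
  (forall x, rdiff P 0 (h 0%N x) = x - e 0%N x) /\
  (forall i x, rdiff P i.+1 (h i.+1 x) + h i (rdiff P i x) = x - e i.+1 x).

Lemma resolution_equiv (M : lmodType A) (P Q : resolution M) :
  exists (f : forall i, {linear P i -> Q i}) (g : forall i, {linear Q i -> P i})
    (h : forall i, {linear P i -> P i.+1}) (k : forall i, {linear Q i -> Q i.+1}),
    [/\ forall i x, rdiff Q i (f i.+1 x) = f i (rdiff P i x),
        forall i x, rdiff P i (g i.+1 x) = g i (rdiff Q i x),
        homotopic_id (fun i => g i \o f i) h
      & homotopic_id (fun i => f i \o g i) k].
Proof.
have [f [f0 fP]] := chain_lift P Q; have [g [g0 gP]] := chain_lift Q P.
have [h hP] := chain_homotopy f0 fP g0 gP.
have [k kP] := chain_homotopy g0 gP f0 fP.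
by exists f, g, h, k.
Qed.

Definition ext_cocycle (M N : lmodType A) (P : resolution M) j (z : hom (P j) N) :=
  forall x, val z (rdiff P j x) = 0.

Definition ext_cobound (M N : lmodType A) (P : resolution M) j :
    hom (P j) N -> Prop :=
  if j is j'.+1
  then fun z => exists w : hom (P j') N, forall x, val z x = val w (rdiff P j' x)
  else fun z => z = 0.

Lemma Ext_std (M N : lmodType A) j :
  pres (Ext j M N) (@ext_cocycle M N (std_resolution M) j)
    (@ext_cobound M N (std_resolution M) j).
Proof.
have kerE i (z : hom (res M i) N) :
    @ext_cocycle M N (std_resolution M) i z <-> z \in ker (hom_map (res_d M i) N).
  split=> [zc|/eqP zd x]; last by have /(congr1 val) := zd => /(congr1 (@^~ x)).
  by apply/eqP/hom_ext => x; apply: zc.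
case: j => [|j]; apply: pres_ext (pres_subquot _ _) => // z _ /=.
  split=> [->|/asboolP[y]//]; by apply/asboolP; exists 0.
split=> [[w zw]|/asboolP[w ->]]; last by exists w.
by apply/asboolP; exists w; apply: hom_ext.
Qed.

Lemma ext_comparison (X M N : lmodType A) (P Q : resolution M) j :
  pres X (@ext_cocycle M N P j) (@ext_cobound M N P j) ->
  pres X (@ext_cocycle M N Q j) (@ext_cobound M N Q j).
Proof.
have [f [g [h [k [fP gP [h0 hP] [k0 kP]]]]]] := resolution_equiv P Q.
apply: (pres_back (phi := hom_map (f j) N)).
- by move=> a x y; apply: linearP.
- move=> a x y Zx Zy u.
  change (a *: val x (rdiff P j u) + val y (rdiff P j u) = 0).
  by rewrite Zx Zy scaler0 addr0.
- by move=> z Zz x; rewrite hom_mapE -fP Zz.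
- case: j => [|j] z Zz; split.
  + move=> /(congr1 val) zf0; apply: hom_ext => x.
    have zf y : val z (f 0%N y) = 0 by rewrite -hom_mapE zf0.
    have := k0 x; move=> /(congr1 (hom_lin z)); rewrite linearB !hom_linE Zz zf.
    by rewrite subr0 => <-.
  + by move=> ->; apply: hom_ext.
  (* Apply [z] to [id - f g = d k + k d]. Since [z d = 0] and [z f = w d], this gives
     [z = (w g + z k) d]. *)
  + case=> w zw; exists (lin_hom ((hom_lin w \o g j) \+ (hom_lin z \o k j))) => x.
    have := kP j x; move=> /(congr1 (hom_lin z)); rewrite linearB linearD !hom_linE.
    rewrite Zz add0r => /eqP; rewrite -subr_eq opprK => /eqP <-.
    by rewrite lin_homE /= addrC; congr (_ + _); rewrite -gP -zw.
  + case=> w zw; exists (hom_map (f j) N w) => x.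
    by rewrite !hom_mapE zw fP.
- move=> z Zz; exists (hom_map (g j) N z); first by move=> x; rewrite hom_mapE -gP Zz.
  case: j z Zz => [|j] z Zz.
    apply: hom_ext => x; have := h0 x; move=> /(congr1 (hom_lin z)).
    by rewrite linearB !hom_linE Zz.
  exists (lin_hom (hom_lin z \o h j)) => x.
  have := hP j x; move=> /(congr1 (hom_lin z)); rewrite linearB linearD !hom_linE.
  by rewrite Zz add0r.
Qed.

Definition tor_cycle (M N : lmodType A) (P : resolution M) i :
    tensor (P i) N -> Prop :=
  if i is i'.+1 then fun z => tens_map (rdiff P i') N z = 0 else fun=> True.

Definition tor_bound (M N : lmodType A) (P : resolution M) i
    (z : tensor (P i) N) :=
  exists w, z = tens_map (rdiff P i) N w.

Lemma Tor_std (M N : lmodType A) (i : nat) :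
  pres (Tor i M N) (@tor_cycle M N (std_resolution M) i)
    (@tor_bound M N (std_resolution M) i).
Proof.
have imE n z : @tor_bound M N (std_resolution M) n z
    <-> z \in im (tens_map (res_d M n) N) by split=> /asboolP.
case: i => [|i]; apply: pres_ext (pres_subquot _ _) => z; first 2 last.
- by split=> /eqP.
- by move=> _; apply: imE.
- by split=> // _; apply/eqP.
- by move=> _; apply: imE.
Qed.

Lemma tens_map_comp (M M' M'' N : lmodType A) (f : {linear M -> M'})
    (g : {linear M' -> M''}) u :
  tens_map g N (tens_map f N u) = tens_map (g \o f) N u.
Proof.
pose F : {linear tensor M N -> tensor M'' N} := tens_map g N \o tens_map f N.
by apply: (tens_ext (f := F)) => m n; rewrite /F /= !tens_map_tens.
Qed.

Lemma tens_map_eq (M M' N : lmodType A) (f g : {linear M -> M'}) :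
  f =1 g -> tens_map f N =1 tens_map g N.
Proof. by move=> fg; apply: tens_ext => m n /=; rewrite !tens_map_tens fg. Qed.

Lemma tens_mapD (M M' N : lmodType A) (f g : {linear M -> M'}) u :
  tens_map (f \+ g) N u = tens_map f N u + tens_map g N u.
Proof.
pose F : {linear tensor M N -> tensor M' N} := tens_map f N \+ tens_map g N.
apply: (tens_ext (g := F)) => m n.
by rewrite /F /= !tens_map_tens /= tensDl.
Qed.

Lemma tens_mapB (M M' N : lmodType A) (f g : {linear M -> M'}) u :
  tens_map (f \- g) N u = tens_map f N u - tens_map g N u.
Proof.
apply/eqP; rewrite eq_sym subr_eq -tens_mapD; apply/eqP/tens_map_eq => x /=.
by rewrite subrK.
Qed.

Lemma tens_map_id (M N : lmodType A) u : tens_map (idfun : M -> M) N u = u.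
Proof.
by apply: (tens_ext (g := idfun)) => m n /=; rewrite tens_map_tens.
Qed.

Lemma tor_comparison (X M N : lmodType A) (P Q : resolution M) i :
  pres X (@tor_cycle M N P i) (@tor_bound M N P i) ->
  pres X (@tor_cycle M N Q i) (@tor_bound M N Q i).
Proof.
have [f [g [h [k [fP gP hH kH]]]]] := resolution_equiv P Q.
have chain (R S : resolution M) (r : forall i, {linear R i -> S i}) :
    (forall i x, rdiff S i (r i.+1 x) = r i (rdiff R i x)) -> forall i u,
    tens_map (rdiff S i) N (tens_map (r i.+1) N u)
    = tens_map (r i) N (tens_map (rdiff R i) N u).
  by move=> rP n u; rewrite !tens_map_comp; apply: tens_map_eq => x /=; apply: rP.
have htpy (R S : resolution M) (r : forall i, {linear R i -> S i})
    (s : forall i, {linear S i -> R i}) l :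
    homotopic_id (fun i => s i \o r i) l -> forall i u,
    @tor_cycle M N R i u -> @tor_bound M N R i (u - tens_map (s i) N (tens_map (r i) N u)).
  case=> l0 lP n u; rewrite tens_map_comp -[X in X - _]tens_map_id -tens_mapB.
  case: n u => [|n] u; rewrite /tor_cycle.
    move=> _; exists (tens_map (l 0%N) N u).
    by rewrite tens_map_comp; apply: tens_map_eq => x /=; rewrite l0.
  move=> u0; exists (tens_map (l n.+1) N u); rewrite tens_map_comp.
  have e0 : tens_map (l n) N (tens_map (rdiff R n) N u) = 0 by rewrite u0 linear0.
  rewrite -[RHS]addr0 -e0.
  by rewrite tens_map_comp -tens_mapD; apply: tens_map_eq => x /=; rewrite lP.
have cyc (R S : resolution M) (r : forall i, {linear R i -> S i}) :
    (forall i x, rdiff S i (r i.+1 x) = r i (rdiff R i x)) ->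
    forall i u, @tor_cycle M N R i u -> @tor_cycle M N S i (tens_map (r i) N u).
  by move=> rP [|n] u //=; rewrite chain // => ->; rewrite linear0.
apply: (pres_back (phi := tens_map (g i) N)).
- by move=> a x y; apply: linearP.
- by case: (i) => [|n] a x y //= Zx Zy; rewrite linearP /= Zx Zy scaler0 addr0.
- exact: cyc.
- move=> z Zz; split=> [[w zw]|[w ->]]; last first.
    by exists (tens_map (g i.+1) N w); rewrite chain.
  have [w' zw'] := htpy _ _ _ _ _ kH _ _ Zz.
  exists (tens_map (f i.+1) N w + w'); rewrite linearD /= -zw' chain // -zw.
  by rewrite addrC subrK.
- by move=> z Zz; exists (tens_map (f i) N z); [apply: cyc | apply: htpy hH _ _ Zz].
Qed.

End Comparison.

(** * Koszul cochains *)

Section Signs.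
Variable m : nat.
Implicit Types (F T : {set 'I_m}) (u v w : 'I_m).

Definition par F v : bool := odd #|[set u in F | (u < v)%N]|.

Lemma parU F T w : [disjoint F & T] -> par (F :|: T) w = par F w (+) par T w.
Proof.
move=> FT; rewrite /par -oddD -cardsUI.
have -> : [set u in F | (u < w)%N] :&: [set u in T | (u < w)%N] = set0.
  apply/setP => u; rewrite !inE; apply/negP => /andP[/andP[uF _] /andP[uT _]].
  by move/pred0P: FT => /(_ u) /=; rewrite uF uT.
rewrite cards0 addn0; congr (odd #|pred_of_set _|).
by apply/setP => u; rewrite !inE andb_orl.
Qed.

Lemma par1 v w : par [set v] w = (v < w)%N.
Proof.
rewrite /par; have [vw|wv] := boolP (v < w)%N.
  have -> : [set u in [set v] | (u < w)%N] = [set v].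
    by apply/setP => u; rewrite !inE; case: eqP => // ->.
  by rewrite cards1.
have -> : [set u in [set v] | (u < w)%N] = set0.
  by apply/setP => u; rewrite !inE; case: eqP => // ->; rewrite (negPf wv).
by rewrite cards0.
Qed.

Lemma parU1 F v w : v \notin F -> par (v |: F) w = (v < w)%N (+) par F w.
Proof. by move=> vF; rewrite parU ?par1 // disjoints1. Qed.

Lemma parD1 F v w : v \in F -> par (F :\ v) w = (v < w)%N (+) par F w.
Proof.
move=> vF; rewrite -{2}(setD1K vF) parU1 ?setD11 //.
by rewrite addbA addbb.
Qed.

(** Exactly [w] vertices lie below [w], each either in [F] or in its complement. *)
Lemma parC F w : par (~: F) w = odd w (+) par F w.
Proof.
have e : par (F :|: ~: F) w = odd w.
  rewrite setUCr /par -sum1_card.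
  under eq_bigl do rewrite !inE /=.
  by rewrite (big_ord_narrow (ltnW (ltn_ord w))) sum1_card card_ord.
move: e; rewrite parU; last by rewrite -setI_eq0 setICr.
by move=> <-; rewrite addbC addbA addbb.
Qed.

End Signs.

Section Sign.
Context {R : comNzRingType} {N : lmodType R}.

Definition sg (b : bool) (x : N) : N := if b then - x else x.

Fact sg_linear b : linear (sg b).
Proof. by move=> a x y; case: b => //=; rewrite opprD scalerN. Qed.

HB.instance Definition _ b :=
  GRing.isLinear.Build R N N *:%R (sg b) (sg_linear b).

Lemma sgM b c x : sg b (sg c x) = sg (b (+) c) x.
Proof. by case: b; case: c => //=; rewrite opprK. Qed.

Lemma sgN b x : - sg b x = sg (~~ b) x.
Proof. by case: b => //=; rewrite opprK. Qed.

Lemma sg_eq0 b x : (sg b x == 0) = (x == 0).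
Proof. by case: b => //=; rewrite oppr_eq0. Qed.

Lemma sgE b x : sg b x = (-1) ^+ b *: x.
Proof. by case: b => /=; rewrite ?expr1 ?expr0 ?scaleN1r ?scale1r. Qed.

Lemma scaler_sg (a : R) b x : a *: sg b x = sg b (a *: x).
Proof. by case: b => //=; rewrite scalerN. Qed.

End Sign.

Lemma linear_sg (R : comNzRingType) (M N : lmodType R) (f : {linear M -> N}) b x :
  f (sg b x) = sg b (f x).
Proof. by case: b => //=; rewrite linearN. Qed.

Section Koszul.
Context {m : nat} {R : comNzRingType} {N : lmodType R}.
Variable y : 'I_m -> {linear N -> N}.
Implicit Types (F G : {set 'I_m}) (f g : {set 'I_m} -> N).

(* The complex [Hom (Koszul complex of y, N)], a cochain being given by its
   values on the basis vectors, which are indexed by sets of vertices. *)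
Definition kos f : {set 'I_m} -> N :=
  fun F => \sum_(v in F) sg (par F v) (y v (f (F :\ v))).

Fact kos_linear : linear kos.
Proof.
move=> a f g; apply: funext => F.
change (kos (a *: f + g) F = a *: kos f F + kos g F).
rewrite /kos scaler_sumr -big_split; apply: eq_bigr => v _ /=.
by rewrite -linearZ -linearD -linearZ -linearD.
Qed.

HB.instance Definition _ :=
  GRing.isLinear.Build R ({set 'I_m} -> N) ({set 'I_m} -> N) *:%R kos kos_linear.

(** Interior product with the [i]-th basis vector of the Koszul complex. *)
Definition contr (i : 'I_m) f : {set 'I_m} -> N :=
  fun F => if i \in F then 0 else sg (par F i) (f (i |: F)).

Fact contr_linear i : linear (contr i).
Proof.
move=> a f g; apply: funext => F.
change (contr i (a *: f + g) F = a *: contr i f F + contr i g F).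
rewrite /contr; case: ifP => _; first by rewrite scaler0 addr0.
by rewrite -linearZ -linearD.
Qed.

HB.instance Definition _ i :=
  GRing.isLinear.Build R ({set 'I_m} -> N) ({set 'I_m} -> N) *:%R (contr i)
    (contr_linear i).

(** With integer degrees, degree [0] is no exception: a cochain of degree [-1] vanishes because no
    set has that cardinality. *)
Definition kdeg (j : int) f := forall F, #|F|%:Z != j -> f F = 0.

Lemma kdeg_lin j a f g : kdeg j f -> kdeg j g -> kdeg j (a *: f + g).
Proof.
move=> hf hg F jF; change (a *: f F + g F = 0).
by rewrite hf ?hg // scaler0 addr0.
Qed.

Lemma kdeg_kos j f : kdeg j f -> kdeg (j + 1) (kos f).
Proof.
move=> hf F jF; rewrite /kos big1 // => v vF; rewrite hf ?linear0 //.
apply: contra jF => /eqP <-; rewrite (cardsD1 v F) vF add1n.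
by rewrite intS addrC.
Qed.

Lemma kdeg_contr i j f : kdeg j f -> kdeg (j - 1) (contr i f).
Proof.
move=> hf F jF; rewrite /contr; case: ifPn => // iF; rewrite hf ?linear0 //.
apply: contra jF => /eqP <-; rewrite cardsU1 iF add1n intS.
by rewrite addrC addKr.
Qed.

(** Removing a vertex [v] different from [i] anticommutes with inserting [i], so only the terms that
    insert and remove [i] itself survive. This one homotopy is behind all acyclicity statements and
    behind the action of [x_0] on cohomology. *)
Lemma kos_contr i f : kos (contr i f) + contr i (kos f) = y i \o f.
Proof.
apply: funext => F; change (kos (contr i f) F + contr i (kos f) F = y i (f F)).
rewrite [in X in _ + X]/contr; case: ifPn => iF.
  rewrite addr0 /kos (bigD1 i) //= big1 ?addr0.
    rewrite /contr setD11 setD1K // parD1 // ltnn addFb.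
    by rewrite linear_sg sgM addbb.
  move=> v /andP[vF vi]; rewrite /contr !inE eq_sym vi iF /=.
  by rewrite !linear0.
rewrite {2}/kos (bigD1 i) ?setU11 //= linearD /= sgM setU1K //.
rewrite parU1 // ltnn addFb addbb /= addrCA -[RHS]addr0; congr (_ + _).
have eI : \sum_(v in i |: F | v != i)
     sg (par (i |: F) v) (y v (f ((i |: F) :\ v)))
   = \sum_(v in F) sg (par (i |: F) v) (y v (f ((i |: F) :\ v))).
  apply: eq_bigl => v; rewrite !inE.
  by case: (eqVneq v i) => [->|]; rewrite ?(negPf iF) //= ?andbT.
rewrite eI linear_sum /= /kos -big_split big1 //= => v vF.
have vi : v != i by apply: contraNneq iF => <-.
rewrite /contr !inE (negPf iF) andbF parD1 // parU1 // linear_sg !sgM.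
have -> : i |: F :\ v = (i |: F) :\ v.
  apply/setP => u; rewrite !inE; case: (eqVneq u i) => [->|] //=.
  by rewrite eq_sym vi.
(* Of [i] and [v] exactly one precedes the other, so the two orders of operation differ by one
   sign. *)
have -> : (v < i)%N = ~~ (i < v)%N.
  by case: ltngtP => // /val_inj vE; rewrite vE eqxx in vi.
apply/eqP; rewrite addr_eq0 sgN; apply/eqP; congr (sg _ _).
by case: (i < v)%N; case: (par F v); case: (par F i).
Qed.

Hypothesis yC : forall u v x, y u (y v x) = y v (y u x).

Lemma kos_kos f : kos (kos f) = 0.
Proof.
apply: funext => F; rewrite [LHS]/kos.
pose T v w := sg (par F v (+) par (F :\ v) w) (y v (y w (f (F :\ v :\ w)))).
have -> : \sum_(v in F) sg (par F v) (y v (kos f (F :\ v)))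
  = \sum_(v in F) \sum_(w in F | w != v) T v w.
  apply: eq_bigr => v vF; rewrite /kos !linear_sum /=.
  apply: eq_big => [w|w _]; first by rewrite !inE andbC.
  by rewrite linear_sg sgM.
have split v : v \in F -> \sum_(w in F | w != v) T v w
   = \sum_(w in F | (w < v)%N) T v w + \sum_(w in F | (v < w)%N) T v w.
  move=> vF; rewrite (bigID (fun w : 'I_m => (w < v)%N)) /=; congr (_ + _).
    apply: eq_bigl => w; case: (w \in F) => //=.
    by case: ltngtP => [| |/val_inj ->]; rewrite ?eqxx ?andbF ?andbT //;
      case: eqP => // ->; rewrite ltnn.
  apply: eq_bigl => w; case: (w \in F) => //=.
  by case: ltngtP => [| |/val_inj ->]; rewrite ?eqxx ?andbF ?andbT //;
    case: eqP => // ->; rewrite ltnn.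
rewrite (eq_bigr _ split) big_split /=.
(* Exchanging the summations in the half [w < v] matches each [T v w] with [T w v] from the other
   half, which has the opposite sign. *)
rewrite (exchange_big_dep (mem F)) //=; last by move=> ? ? _ /andP[].
rewrite -big_split big1 //= => w wF.
have -> : \sum_(v in F | (w \in F) && (w < v)%N) T v w
   = \sum_(v in F | (w < v)%N) T v w.
  by apply: eq_bigl => v; rewrite wF.
rewrite -big_split big1 //= => v /andP[vF wv]; rewrite /T yC.
have vw : (v < w)%N = false by rewrite ltnNge ltnW.
rewrite !parD1 // wv vw addFb.
have -> : F :\ v :\ w = F :\ w :\ v by rewrite setDDl setUC -setDDl.
apply/eqP; rewrite addr_eq0 sgN; apply/eqP; congr (sg _ _).
by case: (par F v); case: (par F w).
Qed.

Definition kcycle j f := kdeg j f /\ kos f = 0.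
Definition kbound j f := exists2 g, kdeg (j - 1) g & f = kos g.

Lemma kbound_cycle j f : kbound j f -> kcycle j f.
Proof.
move=> [g hg ->]; split; last exact: kos_kos.
by have := kdeg_kos hg; rewrite subrK.
Qed.

Lemma kcycle_lin j a f g : kcycle j f -> kcycle j g -> kcycle j (a *: f + g).
Proof.
move=> [hf cf] [hg cg]; split; first exact: kdeg_lin.
by rewrite linearP /= cf cg scaler0 addr0.
Qed.

Lemma kbound_lin j a f g : kbound j f -> kbound j g -> kbound j (a *: f + g).
Proof.
move=> [f' hf ->] [g' hg ->]; exists (a *: f' + g'); first exact: kdeg_lin.
by rewrite linearP.
Qed.

End Koszul.

(** * The Koszul resolution *)

Section KoszulResolution.
Context {A : comNzRingType} {m : nat}.
Variable y : 'I_m -> A.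
Implicit Types (F G : {set 'I_m}).

Definition yact (N : lmodType A) (v : 'I_m) : {linear N -> N} := *:%R (y v).

Lemma yactC (N : lmodType A) u v (x : N) :
  yact N u (yact N v x) = yact N v (yact N u x).
Proof. by rewrite /yact /= !scalerA mulrC. Qed.

Definition kdeg_pred (j : int) : {pred {set 'I_m} -> A^o} :=
  fun f => `[< kdeg j f >].

Fact kdeg_submod j : GRing.submod_closed (kdeg_pred j).
Proof.
split; first exact/asboolP.
by move=> a f g /asboolP hf /asboolP hg; apply/asboolP/kdeg_lin.
Qed.

HB.instance Definition _ j :=
  GRing.isSubmodClosed.Build A ({set 'I_m} -> A^o) (kdeg_pred j) (kdeg_submod j).

(* Homological degree [i] is placed in cohomological degree [m - i], so that
   the Koszul differential becomes [kos]. *)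
Definition kmod (i : nat) : lmodType A := submod (kdeg_pred (m%:Z - i%:Z)).

Lemma kmodP i (f : kmod i) : kdeg (m%:Z - i%:Z) (val f).
Proof. exact/asboolP/(valP f). Qed.

Definition kval i F (f : kmod i) : A^o := val f F.

Fact kval_linear i F : linear (@kval i F).
Proof. by move=> a f g; rewrite /kval submod_valP. Qed.

HB.instance Definition _ i F :=
  GRing.isLinear.Build A (kmod i) A^o *:%R (@kval i F) (kval_linear F).

Lemma kvalP i F a (f g : kmod i) :
  kval F (a *: f + g) = (a * (kval F f : A) + kval F g : A).
Proof. exact: linearP. Qed.

Lemma kval_inj i (f g : kmod i) : (forall F, kval F f = kval F g) -> f = g.
Proof. by move=> fg; apply/val_inj/funext. Qed.

Definition mk_kmod i (f : {set 'I_m} -> A^o) (hf : kdeg (m%:Z - i%:Z) f) : kmod i :=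
  exist _ f (introT (asboolP _) hf).

Definition kfun i (f : kmod i) : {set 'I_m} -> A^o := fun F => kval F f.

Lemma kfunP i (f : kmod i) : kdeg (m%:Z - i%:Z) (kfun f).
Proof. exact: kmodP. Qed.

Fact kdiff_subproof i (f : kmod i.+1) :
  kdeg (m%:Z - i%:Z) (kos (yact A^o) (kfun f)).
Proof.
have := kdeg_kos (yact A^o) (kfunP f).
by have -> : m%:Z - i.+1%:Z + 1 = m%:Z - i%:Z by lia.
Qed.

Definition kdiff_fun i (f : kmod i.+1) : kmod i := mk_kmod (kdiff_subproof f).

Lemma kval_diff i F (f : kmod i.+1) :
  kval F (kdiff_fun f) = kos (yact A^o) (kfun f) F.
Proof. by []. Qed.

Lemma kfun_lin i a (f g : kmod i) : kfun (a *: f + g) = a *: kfun f + kfun g.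
Proof. by apply: funext => F; rewrite /kfun linearP. Qed.

Fact kdiff_linear i : linear (@kdiff_fun i).
Proof.
move=> a f g; apply: kval_inj => F.
by rewrite linearP /= !kval_diff kfun_lin linearP.
Qed.

HB.instance Definition _ i :=
  GRing.isLinear.Build A (kmod i.+1) (kmod i) *:%R (@kdiff_fun i) (@kdiff_linear i).

Definition kdiff i : {linear kmod i.+1 -> kmod i} := @kdiff_fun i.

(** The default [0] is taken when [F] has the wrong cardinality for degree [i], so that expansions
    can run over all sets. *)
Definition kdelta i F : kmod i :=
  insubd 0 (fun G => (G == F)%:R : A^o).

Lemma kdeltaE i F G :
  kval G (kdelta i F) = (((#|F|%:Z == m%:Z - i%:Z) && (G == F))%:R : A^o).
Proof.
rewrite /kval val_insubd; case: ifPn => [/asboolP FP|FP].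
  have [FE|FE] := eqVneq G F; rewrite ?andbF //.
  case: eqP => // /eqP/FP/=; rewrite eqxx => /eqP.
  by rewrite oner_eq0.
have [Fi|_] := boolP (#|F|%:Z == m%:Z - i%:Z); last by rewrite submod_val0.
case/negP: FP; apply/asboolP => H Hi; have [HF|//] := eqVneq H F.
by rewrite HF Fi in Hi.
Qed.

Lemma kmod_expand i (f : kmod i) : f = \sum_F kval F f *: kdelta i F.
Proof.
apply: kval_inj => G; rewrite linear_sum (bigD1 G) //= big1 => [|F /= FG].
  rewrite linearZ /= kdeltaE eqxx andbT addr0.
  case: eqVneq => [|d]; first by rewrite /GRing.scale /= mulr1.
  by rewrite scaler0; apply: kmodP.
by rewrite linearZ /= kdeltaE [G == F]eq_sym (negPf FG) andbF scaler0.
Qed.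

(** The linear extension of [b] from the basis [kdelta i]; the values of [b] at sets of the wrong
    cardinality do not matter, as [u] vanishes there. *)
Definition kcomb i (B : lmodType A) (b : {set 'I_m} -> B) (u : kmod i) : B :=
  \sum_F (kval F u : A) *: b F.

Fact kcomb_linear i B b : linear (@kcomb i B b).
Proof.
move=> a u v; rewrite /kcomb scaler_sumr -big_split; apply: eq_bigr => F _ /=.
by rewrite kvalP scalerDl scalerA.
Qed.

HB.instance Definition _ i (B : lmodType A) (b : {set 'I_m} -> B) :=
  GRing.isLinear.Build A (kmod i) B *:%R (@kcomb i B b) (@kcomb_linear i B b).

Lemma linear_kcomb i (B C : lmodType A) (g : {linear B -> C}) b (u : kmod i) :
  g (kcomb b u) = kcomb (g \o b) u.
Proof. by rewrite /kcomb linear_sum; apply: eq_bigr => F _; rewrite linearZ. Qed.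

Lemma kcomb_expand i (C : lmodType A) (f : {linear kmod i -> C}) (u : kmod i) :
  f u = kcomb (f \o kdelta i) u.
Proof. by rewrite -linear_kcomb; congr (f _); apply: kmod_expand. Qed.

Lemma kcomb_delta i (B : lmodType A) (b : {set 'I_m} -> B) F :
  #|F|%:Z == m%:Z - i%:Z -> kcomb b (kdelta i F) = b F.
Proof.
move=> Fi; rewrite /kcomb (bigD1 F) //= big1 => [|G GF].
  by rewrite kdeltaE Fi eqxx scale1r addr0.
by rewrite kdeltaE (negPf GF) andbF scale0r.
Qed.

Lemma kmod_projective i : projective (kmod i).
Proof.
move=> B C g f gf; have /choice[b bP] F := gf (kdelta i F).
exists (kcomb b) => u.
have e : g \o b = f \o kdelta i by apply: funext.
rewrite linear_kcomb e; exact/esym/kcomb_expand.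
Qed.

Variables (M : lmodType A) (e : {linear A^o -> M}).
Hypothesis e_surj : forall x, exists a, e a = x.
Hypothesis e_ker : forall a, e a = 0 <-> exists c, a = \sum_v y v * c v.
Hypothesis kos_exact : forall j f, j != m%:Z ->
  kcycle (yact A^o) j f -> kbound (yact A^o) j f.

Lemma kbound_top (f : {set 'I_m} -> A^o) : kdeg m%:Z f ->
  (kbound (yact A^o) m%:Z f <-> exists c, f setT = \sum_v y v * c v).
Proof.
move=> hf; split=> [[g hg ->]|[c fc]].
  exists (fun v => sg (par setT v) (g (setT :\ v))); rewrite /kos.
  by apply: eq_big => [v|v _]; rewrite ?inE // -linear_sg.
(* Concentrated on the complements of single vertices; for a given [G] the sum has at most one
   term. *)
exists (fun G => \sum_(v | G == setT :\ v) sg (par setT v) (c v : A^o)).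
  move=> G Gm; rewrite big_pred0 // => v; apply: contraNF Gm => /eqP ->.
  have := cardsD1 v [set: 'I_m]; rewrite cardsT card_ord inE add1n => mE.
  by lia.
apply: funext => F; have [->|FT] := eqVneq F setT.
  rewrite fc /kos; apply: eq_big => [v|v _]; first by rewrite inE.
  rewrite (bigD1 v) //= big1 ?addr0 => [|u /andP[/eqP/setP/(_ u) uv vu]].
    by rewrite linear_sg sgM addbb.
  by move: uv; rewrite !inE eqxx vu.
have cF : #|F| != m.
  apply: contra FT => cF; rewrite eqEcard subsetT cardsT card_ord.
  by rewrite (eqP cF) leqnn.
rewrite hf ?eqz_nat // /kos big1 // => v vF; rewrite big_pred0 ?linear0 // => u.
apply/negP => /eqP Fu; have := cardsD1 v F; rewrite vF Fu add1n => cF'.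
have := cardsD1 u [set: 'I_m]; rewrite cardsT card_ord inE add1n -cF' => mF.
by move: cF; rewrite [X in _ != X]mF eqxx.
Qed.

Definition kaug : {linear kmod 0 -> M} := e \o kval setT.

Lemma kaugE f : kaug f = e (kval setT f).
Proof. by []. Qed.

Lemma kvalZ i F a (f : kmod i) : kval F (a *: f) = a * (kval F f : A) :> A.
Proof. exact: linearZ. Qed.

Lemma kdelta0T : kval setT (kdelta 0 setT) = 1 :> A.
Proof. by rewrite kdeltaE cardsT card_ord subr0 !eqxx. Qed.

Lemma kaug_surj x : exists f, kaug f = x.
Proof.
have [a <-] := e_surj x; exists (a *: kdelta 0 setT).
by rewrite kaugE kvalZ kdelta0T mulr1.
Qed.

Lemma kdiff_im i (f : kmod i) :
  (exists u, kdiff i u = f) <-> kbound (yact A^o) (m%:Z - i%:Z) (kfun f).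
Proof.
have iE : m%:Z - i%:Z - 1 = m%:Z - i.+1%:Z by lia.
split=> [[u <-]|[g]]; first by exists (kfun u) => //; rewrite iE; apply: kfunP.
rewrite iE => hg fE; exists (mk_kmod hg); apply: kval_inj => F.
by rewrite -[RHS]/(kfun f F) fE.
Qed.

Lemma kexact0 f : kaug f = 0 <-> exists u, kdiff 0 u = f.
Proof.
rewrite kdiff_im subr0 kbound_top; first exact: e_ker.
by have := kfunP f; rewrite subr0.
Qed.

Lemma kfun_diff_eq0 i (f : kmod i.+1) :
  kdiff i f = 0 <-> kos (yact A^o) (kfun f) = 0.
Proof.
split=> [f0|f0]; last by apply: kval_inj => F; rewrite linear0 kval_diff f0.
by apply: funext => F; rewrite -kval_diff [kdiff_fun f]f0 linear0.
Qed.

Lemma kexact i f : kdiff i f = 0 <-> exists u, kdiff i.+1 u = f.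
Proof.
rewrite kdiff_im kfun_diff_eq0.
split=> [f0|/(kbound_cycle (@yactC A^o))[_ f0]] //.
apply: kos_exact; last by split; [apply: kfunP | ].
by lia.
Qed.

Definition koszul_resolution : resolution M :=
  @Resolution A M kmod kdiff kaug kmod_projective kaug_surj kexact0 kexact.

End KoszulResolution.

(** * Tor and Ext as cohomology of one Koszul cochain complex *)

Section KoszulTorExt.
Context {A : comNzRingType} {m : nat}.
Variable y : 'I_m -> A.
Variables (M : lmodType A) (e : {linear A^o -> M}).
Hypothesis e_surj : forall x, exists a, e a = x.
Hypothesis e_ker : forall a, e a = 0 <-> exists c, a = \sum_v y v * c v.
Hypothesis kos_exact : forall j f, j != m%:Z ->
  kcycle (yact y A^o) j f -> kbound (yact y A^o) j f.
Let K := koszul_resolution e_surj e_ker kos_exact.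
Variable N : lmodType A.
Implicit Types (F G : {set 'I_m}) (f g : {set 'I_m} -> N).

Lemma sum_setD1 (T : {set 'I_m} -> 'I_m -> N) :
  \sum_(F : {set 'I_m}) \sum_(v in F) T (F :\ v) v
    = \sum_(F : {set 'I_m}) \sum_(v | v \notin F) T F v.
Proof.
rewrite (exchange_big_dep xpredT) //= [RHS](exchange_big_dep xpredT) //=.
apply: eq_bigr => v _.
rewrite (reindex_onto (fun F => v |: F) (fun F => F :\ v)) /=; last first.
  by move=> F vF; rewrite setD1K.
apply: eq_big => [F|F /andP[_ /eqP ->] //]; rewrite setU11 /=.
apply/eqP/idP => [<-|vF]; first by rewrite setD11.
by rewrite setU1K.
Qed.

(* Complementing sets of vertices turns [kos] into its transpose up to the sign
   [eps]: this is the self-duality of the Koszul complex. *)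
Definition eps F : bool := odd (\sum_(u in F) u).

Lemma epsD1 F v : v \in F -> eps (F :\ v) = odd v (+) eps F.
Proof.
move=> vF; rewrite /eps (big_setD1 v vF) /= oddD addbA addbb addFb.
by [].
Qed.

Definition ecomb f F : N := sg (eps (~: F)) (f (~: F)).

Lemma ecomb_lin a f g : ecomb (a *: f + g) = a *: ecomb f + ecomb g.
Proof.
apply: funext => F; change (ecomb (a *: f + g) F = a *: ecomb f F + ecomb g F).
by rewrite /ecomb -linearP.
Qed.

(** Both sides are sums over pairs of a set and a vertex outside it. Passing to complements changes
    [par] by [odd v], and removing [v] changes [eps] by [odd v] as well, so the two discrepancies
    cancel. This dictates the choice of [eps]. *)
Lemma kcomb_kdiff i f (u : @kmod A m i.+1) :
  kcomb (ecomb f) (kdiff y i u) = kcomb (ecomb (kos (yact y N) f)) u.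
Proof.
pose T G w := sg (par G w) (((kval G u : A) * y w) *: ecomb f (w |: G)).
transitivity (\sum_(F : {set 'I_m}) \sum_(v in F) T (F :\ v) v).
  apply: eq_bigr => F _; rewrite kval_diff /kos scaler_suml.
  apply: eq_bigr => v vF; rewrite /T setD1K // parD1 // ltnn addFb.
  have -> : yact y A^o v (kfun u (F :\ v)) = (kval (F :\ v) u : A) * y v :> A.
    by rewrite mulrC.
  by rewrite /sg; case: (par F v) => //; rewrite scaleNr.
rewrite sum_setD1; apply: eq_bigr => F _.
rewrite /ecomb /kos linear_sum scaler_sumr /=.
apply: eq_big => [v|v vF]; first by rewrite inE.
rewrite /T sgM /ecomb.
have -> : ~: (v |: F) = ~: F :\ v by apply/setP => u0; rewrite !inE negb_or.
have vF' : v \in ~: F by rewrite inE.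
rewrite parC (epsD1 vF') !scaler_sg sgM -scalerA; congr (sg _ _).
by case: (eps _); case: (par F v); case: (odd v).
Qed.

Lemma kcomb_inj i f : kdeg i%:Z f -> (i <= m)%N ->
  (forall u : @kmod A m i, kcomb (ecomb f) u = 0) -> f = 0.
Proof.
move=> hf im f0; apply: funext => F; have [Fi|Fi] := eqVneq #|F|%:Z i%:Z.
  have := f0 (kdelta i (~: F)); rewrite kcomb_delta.
    by rewrite /ecomb setCK => /eqP; rewrite sg_eq0 => /eqP.
  by have := cardsC F; rewrite card_ord; move: Fi; lia.
exact: hf.
Qed.

Lemma card_setC_int F : #|~: F|%:Z = m%:Z - #|F|%:Z.
Proof. by apply/eqP; rewrite eq_sym subr_eq addrC -PoszD cardsC card_ord. Qed.

Lemma kcomb_rep i (z : {linear @kmod A m i -> N}) :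
  exists2 f, kdeg i%:Z f & forall u, z u = kcomb (ecomb f) u.
Proof.
exists (fun F => if #|F|%:Z == i%:Z then sg (eps F) (z (kdelta i (~: F))) else 0).
  by move=> F /negPf ->.
move=> u; rewrite kcomb_expand; apply: eq_bigr => F _; rewrite /ecomb /= setCK.
case: ifPn => Fi; first by rewrite sgM addbb.
have -> : kval F u = 0; last by rewrite !scale0r.
apply: kmodP; apply: contra Fi => /eqP FE.
by rewrite card_setC_int FE opprB addrCA subrr addr0.
Qed.

Lemma kdeg_gt j f : (m%:Z < j) -> kdeg j f -> f = 0.
Proof.
move=> mj hf; apply: funext => F; apply: hf.
have cF : (#|F| <= m)%N by rewrite -[X in (_ <= X)%N]card_ord max_card.
by apply: contraTneq mj => <-; rewrite ltz_nat ltnNge cF.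
Qed.

Lemma kdeg_lt0 j f : (j < 0) -> kdeg j f -> f = 0.
Proof. by move=> j0 hf; apply: funext => F; apply: hf; lia. Qed.

Lemma kcomb_eq0 i f : kdeg i%:Z f ->
  (forall u : @kmod A m i, kcomb (ecomb f) u = 0) -> f = 0.
Proof.
have [im|mi] := leqP i m; first by move=> hf; apply: kcomb_inj.
by move=> hf _; apply: kdeg_gt hf; lia.
Qed.

Theorem Ext_koszul j :
  pres (Ext j M N) (kcycle (yact y N) j%:Z) (kbound (yact y N) j%:Z).
Proof.
pose kap i f : hom (@kmod A m i) N := lin_hom (kcomb (ecomb f)).
have kapE i f u : val (kap i f) u = kcomb (ecomb f) u by [].
have kdegS i f : kdeg i%:Z f -> kdeg i.+1%:Z (kos (yact y N) f).
  by move=> /(kdeg_kos (yact y N)); rewrite addrC -intS.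
have kcyc i f u : val (kap i f) (kdiff y i u) = val (kap i.+1 (kos (yact y N) f)) u.
  exact: kcomb_kdiff.
have := ext_comparison K (Ext_std M N j).
apply: (pres_back (phi := kap j)).
- move=> a f g; apply: hom_ext => u; rewrite submod_valP.
  rewrite -[RHS]/(a *: kcomb (ecomb f) u + kcomb (ecomb g) u) kapE ecomb_lin.
  rewrite /kcomb scaler_sumr -big_split; apply: eq_bigr => F _.
  rewrite -[(a *: ecomb f + ecomb g) F]/(a *: ecomb f F + ecomb g F).
  by rewrite scalerDr !scalerA mulrC.
- move=> a z w Zz Zw u; rewrite submod_valP.
  rewrite -[LHS]/(a *: val z (rdiff K j u) + val w (rdiff K j u)).
  by rewrite Zz Zw scaler0 addr0.
- move=> f [hf cf] u; rewrite [LHS]kcyc cf kapE /kcomb big1 // => F _.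
  by rewrite /ecomb linear0 scaler0.
- move=> f [hf cf]; case: j hf => [|j] hf.
    split=> [/(congr1 val) f0|[g hg ->]].
      exists 0 => //; rewrite linear0; apply: kcomb_eq0 hf _ => u.
      by rewrite -kapE f0.
    apply: hom_ext => u; rewrite (kdeg_lt0 _ hg) // linear0.
    by rewrite kapE /kcomb big1 // => F _; rewrite /ecomb linear0 scaler0.
  have j1 : j.+1%:Z - 1 = j%:Z by lia.
  split=> [[w wP]|[g]]; last first.
    by rewrite j1 => hg ->; exists (kap j g) => u; rewrite [RHS]kcyc.
  have [g hg gP] := kcomb_rep (hom_lin w); exists g; first by rewrite j1.
  apply/eqP; rewrite -subr_eq0; apply/eqP.
  have hfg : kdeg j.+1%:Z (f - kos (yact y N) g).
    by rewrite addrC -scaleN1r; apply: kdeg_lin hf; apply: kdegS.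
  apply: kcomb_eq0 hfg _ => u.
  have -> : f - kos (yact y N) g = (-1) *: kos (yact y N) g + f.
    by rewrite scaleN1r addrC.
  have := wP u; rewrite kapE => fu.
  have kgu : kcomb (ecomb (kos (yact y N) g)) u = val w (rdiff K j u).
    by rewrite -kcomb_kdiff -gP.
  rewrite ecomb_lin /kcomb.
  transitivity (- kcomb (ecomb (kos (yact y N) g)) u + kcomb (ecomb f) u).
    rewrite /kcomb -sumrN -big_split; apply: eq_bigr => F _ /=.
    by rewrite scaleN1r -scalerN -scalerDr.
  by rewrite fu kgu addNr.
- move=> z Zz; have [f hf fP] := kcomb_rep (hom_lin z).
  have zE : z = kap j f by apply: hom_ext => u; rewrite kapE -fP.
  exists f.
    split=> //; apply: kcomb_eq0 (kdegS _ _ hf) _ => u.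
    by rewrite -kapE -kcyc -zE [LHS]Zz.
  rewrite -zE subrr; case: (j) => [|j'] //=; exists 0 => u.
  by rewrite !submod_val0.
Qed.

Lemma tens_koszul i : exists X : {linear tensor (@kmod A m i) N -> {set 'I_m} -> N},
  forall u n F, X (tens u n) F = (kval F u : A) *: n.
Proof.
have [n|u|X XP] := @tens_lift A (@kmod A m i) N ({set 'I_m} -> N)
  (fun u n F => (kval F u : A) *: n).
- move=> a u v; apply: funext => F.
  rewrite -[RHS]/(a *: ((kval F u : A) *: n) + (kval F v : A) *: n).
  by rewrite kvalP scalerDl scalerA.
- move=> a n n'; apply: funext => F.
  rewrite -[RHS]/(a *: ((kval F u : A) *: n) + (kval F u : A) *: n').
  by rewrite scalerDr !scalerA mulrC.
by exists X => u n F; rewrite XP.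
Qed.

(** Unlike for [Ext], no dualization and no sign is involved: [kmod] is already graded by
    cohomological degree, and [X], [kap] below are inverse identifications of its tensor product
    with [N]-valued cochains. *)
Theorem Tor_koszul i :
  pres (Tor i%:Z M N) (kcycle (yact y N) (m%:Z - i%:Z))
    (kbound (yact y N) (m%:Z - i%:Z)).
Proof.
pose X n := sval (cid (tens_koszul n)).
have XP n u x F : X n (tens u x) F = (kval F u : A) *: x := svalP (cid (tens_koszul n)) u x F.
pose kap n (f : {set 'I_m} -> N) : tensor (@kmod A m n) N :=
  \sum_F tens (kdelta n F) (f F).
have kapl n a f g : kap n (a *: f + g) = a *: kap n f + kap n g.
  rewrite /kap scaler_sumr -big_split; apply: eq_bigr => F _.
  rewrite -[(a *: f + g) F]/(a *: f F + g F).
  by rewrite tensDr tensZr.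
have Xsum n I (r : seq I) (G : I -> tensor (@kmod A m n) N) F :
    X n (\sum_(i <- r) G i) F = \sum_(i <- r) X n (G i) F.
  by rewrite linear_sum fct_sumE.
have Xkap n f : kdeg (m%:Z - n%:Z) f -> X n (kap n f) = f.
  move=> hf; apply: funext => F; rewrite Xsum (bigD1 F) //= big1 => [|G GF].
    rewrite XP kdeltaE eqxx andbT addr0; case: eqVneq => [|Fn].
      by rewrite scale1r.
    by rewrite scale0r hf.
  by rewrite XP kdeltaE [F == G]eq_sym (negPf GF) andbF scale0r.
have kapX n t : kap n (X n t) = t.
  pose L : {linear tensor (@kmod A m n) N -> tensor (@kmod A m n) N} :=
    HB.pack (kap n \o X n) (GRing.isLinear.Build _ _ _ *:%R (kap n \o X n)
      (fun a u v => etrans (congr1 (kap n) (linearP (X n) a u v)) (kapl n a _ _))).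
  have -> : kap n (X n t) = L t by [].
  apply: (tens_ext (g := idfun)) => u x; rewrite /L /= {2}(kmod_expand u) tens_suml.
  by apply: eq_bigr => F _; rewrite XP tensZr tensZl.
have Xdeg n t : kdeg (m%:Z - n%:Z) (X n t).
  move=> F Fn; rewrite -(kapX n t) Xsum big1 // => G _.
  rewrite XP kdeltaE; case: (eqVneq F G) => [<-|_]; last by rewrite andbF scale0r.
  by rewrite (negPf Fn) scale0r.
have Xd n t : X n (tens_map (kdiff y n) N t) = kos (yact y N) (X n.+1 t).
  pose L : {linear tensor (@kmod A m n.+1) N -> {set 'I_m} -> N} :=
    X n \o tens_map (kdiff y n) N.
  pose L' : {linear tensor (@kmod A m n.+1) N -> {set 'I_m} -> N} :=
    kos (yact y N) \o X n.+1.
  apply: (tens_ext (f := L) (g := L')) => u x; apply: funext => F.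
  rewrite /L /L' /= tens_map_tens XP kval_diff /kos scaler_suml.
  apply: eq_bigr => v vF; rewrite XP /sg; case: (par F v).
    by rewrite scaleNr -scalerA.
  by rewrite -scalerA.
have Xinj n t t' : X n t = X n t' -> t = t'.
  by move=> tt'; rewrite -(kapX n t) -(kapX n t') tt'.
have n1 n : m%:Z - n%:Z - 1 = m%:Z - n.+1%:Z by lia.
have := tor_comparison K (Tor_std M N i).
apply: (pres_back (phi := kap i)).
- exact: kapl.
- by case: (i) => [|n] a x y' //= Zx Zy; rewrite linearP /= Zx Zy scaler0 addr0.
- move=> f [hf cf]; case: i hf => [|n] hf //=.
  by apply: (Xinj n); rewrite [LHS]Xd Xkap // cf linear0.
- move=> f [hf cf]; split=> [[w fw]|[g]].
    exists (X i.+1 w); first by rewrite n1.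
    by rewrite -Xd -[tens_map _ _ _]fw Xkap.
  rewrite n1 => hg ->; exists (kap i.+1 g); apply: (Xinj i).
  rewrite [RHS]Xd !Xkap //.
  have := kdeg_kos (yact y N) hg.
  by have -> : m%:Z - i.+1%:Z + 1 = m%:Z - i%:Z by lia.
- move=> t Zt; exists (X i t); last first.
    by exists 0; rewrite kapX subrr linear0.
  split=> //; case: i t Zt => [|n] t Zt.
    apply: kdeg_gt (kdeg_kos (yact y N) (Xdeg _ t)).
    by lia.
  by rewrite -Xd -(linear0 (X n)); congr (X n _).
Qed.

End KoszulTorExt.

(** * Dimensions of subquotients over the residue field *)

Section QuotientDimension.
Variable V : dvr.
Local Notation t := (unif V).

(** Coefficients stay in [V]: independence over the residue field is expressed by saying that a
    relation modulo [B] has all its coefficients in [tV]. This avoids giving [Z / B] a residue field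
    action. *)
Definition qbasis (M : lmodType V) (Z B : M -> Prop) (I : finType) (z : I -> M) :=
  [/\ forall i, Z (z i),
      forall x, Z x -> exists a : I -> V, B (x - \sum_i a i *: z i)
    & forall a : I -> V, B (\sum_i a i *: z i) -> forall i, exists b, a i = b * t].

(* For [B] between [tZ] and [Z] this says that [Z / B] has dimension [d] over
   [V / tV]. *)
Definition qdim (M : lmodType V) (Z B : M -> Prop) (d : nat) :=
  exists z : 'I_d -> M, qbasis Z B z.

Definition closed_lin (M : lmodType V) (Z : M -> Prop) :=
  Z 0 /\ forall a x y, Z x -> Z y -> Z (a *: x + y).

(* With [Q = Z / B], the pair [(Z, mod_rel Z B)] presents [Q / tQ] and the pair
   [(ann_rel Z B, B)] presents [Ann_Q t]. *)
Definition mod_rel (M : lmodType V) (Z B : M -> Prop) (x : M) :=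
  exists2 w, Z w & B (x - t *: w).

Definition ann_rel (M : lmodType V) (Z B : M -> Prop) (x : M) := Z x /\ B (t *: x).

Section Closed.
Variables (M : lmodType V) (Z : M -> Prop).
Hypothesis cZ : closed_lin Z.

Lemma closedD x y : Z x -> Z y -> Z (x + y).
Proof. by move=> Zx Zy; rewrite -[x]scale1r; apply: cZ.2. Qed.

Lemma closedZ a x : Z x -> Z (a *: x).
Proof. by move=> Zx; rewrite -[_ *: _]addr0; apply: cZ.2 => //; apply: cZ.1. Qed.

Lemma closedN x : Z x -> Z (- x).
Proof. by move=> Zx; rewrite -scaleN1r; apply: closedZ. Qed.

Lemma closedB x y : Z x -> Z y -> Z (x - y).
Proof. by move=> Zx Zy; apply: closedD => //; apply: closedN. Qed.

Lemma closed_sum I (r : seq I) (P : pred I) (F : I -> M) :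
  (forall i, P i -> Z (F i)) -> Z (\sum_(i <- r | P i) F i).
Proof. by move=> ZF; elim/big_rec: _ => [|i x Pi Zx]; [apply: cZ.1|apply/closedD/Zx/ZF]. Qed.
End Closed.

Section LinearOn.
Variables (M X : lmodType V) (Z : M -> Prop) (p : M -> X).
Hypothesis cZ : closed_lin Z.
Hypothesis pl : forall a x y, Z x -> Z y -> p (a *: x + y) = a *: p x + p y.

Lemma linear_on0 : p 0 = 0.
Proof. by have := pl (-1) cZ.1 cZ.1; rewrite scaler0 addr0 scaleN1r addNr. Qed.

Lemma linear_onZ a z : Z z -> p (a *: z) = a *: p z.
Proof. by move=> Zz; have := pl a Zz cZ.1; rewrite !addr0 linear_on0 addr0. Qed.

Lemma linear_onD x y : Z x -> Z y -> p (x + y) = p x + p y.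
Proof. by move=> Zx Zy; have := pl 1 Zx Zy; rewrite !scale1r. Qed.
End LinearOn.

Lemma qdim_fin (M : lmodType V) (Z B : M -> Prop) (I : finType) (z : I -> M) :
  qbasis Z B z -> qdim Z B #|I|.
Proof.
case=> Zz span free; exists (z \o enum_val).
have E (a : I -> V) :
    \sum_(i < #|I|) a (enum_val i) *: z (enum_val i) = \sum_i a i *: z i.
  rewrite [RHS](reindex (enum_val : 'I_#|I| -> I)) //=.
  by exists enum_rank => x _; [apply: enum_valK | apply: enum_rankK].
split=> [i|x /span[a Ba]|a Ba i]; first exact: Zz.
  by exists (a \o enum_val); rewrite [X in _ - X]E.
have := free (a \o enum_rank); rewrite -E /=.
have -> : \sum_(i < #|I|) a (enum_rank (enum_val i)) *: z (enum_val i)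
        = \sum_(i < #|I|) a i *: z (enum_val i).
  by apply: eq_bigr => k _; rewrite enum_valK.
by move=> /(_ Ba (enum_val i)); rewrite enum_valK.
Qed.

Lemma qdim0 (M : lmodType V) (Z B : M -> Prop) : (forall x, Z x -> B x) -> qdim Z B 0.
Proof.
move=> ZB; exists (fun=> 0); split=> [[]//|z Zz|_ _ []//].
by exists (fun=> 0); rewrite big_ord0 subr0; apply: ZB.
Qed.

Lemma qdim_ext (M : lmodType V) (Z B Z' B' : M -> Prop) d :
  (forall x, Z x <-> Z' x) -> (forall x, B x <-> B' x) -> qdim Z B d -> qdim Z' B' d.
Proof.
move=> ZZ BB [z [Zz span free]]; exists z; split=> [i|x /ZZ/span[a /BB]|a /BB/free//].
  exact/ZZ.
by exists a.
Qed.

(** If [phi] induces an isomorphism [Z / B -> Z' / B'], preimages of a basis, taken modulo [B'],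
    form a basis. *)
Lemma qdim_back (M M' : lmodType V) (Z B : M -> Prop) (Z' B' : M' -> Prop)
    (phi : {linear M -> M'}) d :
    closed_lin Z -> closed_lin B' ->
    (forall z, Z z -> Z' (phi z)) ->
    (forall z, Z z -> B' (phi z) -> B z) ->
    (forall z, Z z -> B z -> B' (phi z)) ->
    (forall z', Z' z' -> exists2 z, Z z & B' (z' - phi z)) ->
  qdim Z' B' d -> qdim Z B d.
Proof.
move=> cZ cB ZZ BB BB' surj [z' [Zz' span free]].
have /choice[z zP] i : exists z, Z z /\ B' (z' i - phi z).
  by have [z Zz Bz] := surj _ (Zz' i); exists z.
have phiS (a : 'I_d -> V) :
    B' (\sum_i a i *: z' i - phi (\sum_i a i *: z i)).
  rewrite linear_sum -sumrB; apply: closed_sum => // i _.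
  by rewrite linearZ -scalerBr; apply: closedZ => //; apply: (zP i).2.
have ZS (a : 'I_d -> V) : Z (\sum_i a i *: z i).
  by apply: closed_sum => // i _; apply: closedZ => //; apply: (zP i).1.
exists z; split=> [i|x Zx|a Ba]; first exact: (zP i).1.
  have [a Ba] := span _ (ZZ _ Zx); exists a; apply: BB; first exact: closedB.
  rewrite linearB; have := closedD cB Ba (phiS a).
  by rewrite addrA subrK.
apply: free; have := closedD cB (phiS a) (BB' _ (ZS a) Ba).
by rewrite subrK.
Qed.

Lemma mod_rel_closed (M : lmodType V) (Z B : M -> Prop) :
  closed_lin Z -> closed_lin B -> closed_lin (mod_rel Z B).
Proof.
move=> [Z0 Zl] [B0 Bl]; split; first by exists 0; rewrite // scaler0 subr0.
move=> a x y [w Zw Bw] [w' Zw' Bw']; exists (a *: w + w'); first exact: Zl.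
have -> : a *: x + y - t *: (a *: w + w') = a *: (x - t *: w) + (y - t *: w').
  by rewrite scalerBr scalerDr !scalerA [t * a]mulrC opprD addrACA.
exact: Bl.
Qed.

Lemma ann_rel_closed (M : lmodType V) (Z B : M -> Prop) :
  closed_lin Z -> closed_lin B -> closed_lin (ann_rel Z B).
Proof.
move=> [Z0 Zl] [B0 Bl]; split; first by split; rewrite // scaler0.
move=> a x y [Zx Bx] [Zy By]; split; first exact: Zl.
by rewrite scalerDr scalerA mulrC -scalerA; apply: Bl.
Qed.

Section BackRel.
Variables (M M' : lmodType V) (Z B : M -> Prop) (Z' B' : M' -> Prop).
Variables (phi : {linear M -> M'}) (d : nat).
Hypotheses (cZ : closed_lin Z) (cZ' : closed_lin Z') (cB' : closed_lin B').
Hypothesis ZZ : forall z, Z z -> Z' (phi z).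
Hypothesis BB : forall z, Z z -> B' (phi z) -> B z.
Hypothesis BB' : forall z, Z z -> B z -> B' (phi z).
Hypothesis surj : forall z', Z' z' -> exists2 z, Z z & B' (z' - phi z).

(** An isomorphism [Q -> Q'] of the quotients induces one of [Q / tQ] and, in the next lemma, one of
    the [t]-annihilators. *)
Lemma qdim_back_mod : qdim Z' (mod_rel Z' B') d -> qdim Z (mod_rel Z B) d.
Proof.
apply: (qdim_back (phi := phi)) => //; first exact: mod_rel_closed.
- move=> z Zz [w' Zw' Bw']; have [w Zw Bw] := surj Zw'; exists w => //.
  apply: BB; first by apply: closedB => //; apply: closedZ.
  have := closedD cB' Bw' (closedZ cB' t Bw); rewrite scalerBr addrA subrK => h.
  by rewrite linearB linearZ.
- move=> z Zz [w Zw Bw]; exists (phi w); first exact: ZZ.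
  rewrite -linearZ -linearB; apply: BB' => //.
  by apply: closedB => //; apply: closedZ.
- move=> z' Zz'; have [z Zz Bz] := surj Zz'; exists z => //.
  by exists 0; [apply: cZ'.1 | rewrite scaler0 subr0].
Qed.

Lemma qdim_back_ann : closed_lin B ->
  qdim (ann_rel Z' B') B' d -> qdim (ann_rel Z B) B d.
Proof.
move=> cB; apply: (qdim_back (phi := phi)) => //; first exact: ann_rel_closed.
- move=> z [Zz Bz]; split; first exact: ZZ.
  by rewrite -linearZ; apply: BB' => //; apply: closedZ.
- by move=> z [Zz _]; apply: BB.
- by move=> z [Zz _]; apply: BB'.
- move=> z' [Zz' Bz']; have [z Zz Bz] := surj Zz'; exists z => //; split=> //.
  apply: BB; first exact: closedZ.
  have := closedB cB' Bz' (closedZ cB' t Bz).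
  by rewrite scalerBr opprB addrC subrK linearZ.
Qed.
End BackRel.

Lemma pres_mod_t (X M : lmodType V) (Z B : M -> Prop) :
  closed_lin Z -> pres X Z B ->
  pres (quotmod (mults t : submodClosed X)) Z (mod_rel Z B).
Proof.
move=> cZ [p [pl ps pk]]; exists (quotmod_pi _ \o p); split=> [a x y Zx Zy|x|z Zz] /=.
- by rewrite pl // linearP.
- have [z Zz pz] := ps (quotmod_repr x); exists z => //=.
  by rewrite pz quotmod_reprK.
have pB w : Z w -> p (z - t *: w) = p z - t *: p w.
  move=> Zw; have := pl (- t) w z Zw Zz.
  by rewrite !scaleNr ![- _ + _]addrC.
have ZB w : Z w -> Z (z - t *: w).
  by move=> Zw; apply: closedB => //; apply: closedZ.
transitivity (p z \in (mults t : submodClosed X)).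
  by rewrite -quotmod_pi_eq0; split=> /eqP.
split=> [/asboolP[y pz]|[w Zw /pk]].
  have [w Zw wy] := ps y; exists w => //; apply/pk; first exact: ZB.
  by rewrite pB // wy pz subrr.
rewrite pB // => /(_ (ZB _ Zw))/eqP; rewrite subr_eq0 => /eqP pz.
by apply/asboolP; exists (p w).
Qed.

Lemma pres_ann_t (X M : lmodType V) (Z B : M -> Prop) :
  closed_lin Z -> pres X Z B ->
  pres (submod (ann t : submodClosed X)) (ann_rel Z B) B.
Proof.
move=> cZ [p [pl ps pk]].
have pZ := linear_onZ cZ pl.
have pann z : ann_rel Z B z -> p z \in (ann t : submodClosed X).
  by move=> [Zz Bz]; apply/eqP; rewrite -pZ //; apply/pk => //; apply: closedZ.
exists (fun z => insubd (0 : submod (ann t : submodClosed X)) (p z)).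
split=> [a x y Zx Zy|x|z Zz].
- have pE := pl a x y Zx.1 Zy.1.
  have pxy : p (a *: x + y) \in (ann t : submodClosed X).
    by rewrite pE; apply: rpredD; [apply/rpredZ/pann | apply: pann].
  apply: val_inj; rewrite submod_valP.
  by rewrite (insubdK _ pxy) (insubdK _ (pann _ Zx)) (insubdK _ (pann _ Zy)).
- have [z Zz pz] := ps (val x).
  have Bz : ann_rel Z B z.
    split=> //; apply/pk; first exact: closedZ.
    by rewrite pZ // pz; apply/eqP; apply: (valP x).
  by exists z => //; apply: val_inj; rewrite insubdK ?pann.
rewrite -pk; last exact: Zz.1.
split=> [|pz].
  by move=> /(congr1 val); rewrite insubdK ?pann // submod_val0.
by apply: val_inj; rewrite insubdK ?pann // submod_val0.
Qed.

Lemma pres_killed (X M : lmodType V) (Z B : M -> Prop) :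
  closed_lin Z -> (forall z, Z z -> B (t *: z)) -> pres X Z B -> killed X.
Proof.
move=> cZ tB [p [pl ps pk]] x; have [z Zz <-] := ps x.
have /pk := tB z Zz; rewrite (linear_onZ cZ pl) //.
by apply; apply: closedZ.
Qed.

Lemma has_dim_kspace (X M : lmodType V) (hX : killed X) (Z B : M -> Prop) d :
  closed_lin Z -> pres X Z B -> qdim Z B d -> has_dim (kspace hX) d.
Proof.
move=> cZ [p [pl ps pk]] [z [Zz span free]].
have p0 := linear_on0 cZ pl; have pZ := linear_onZ cZ pl.
have pD := linear_onD pl.
have ZS (a : 'I_d -> V) : Z (\sum_i a i *: z i).
  by apply: closed_sum => // i _; apply: closedZ.
have pS (a : 'I_d -> V) : p (\sum_i a i *: z i) = \sum_i a i *: p (z i).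
  suff [] : Z (\sum_i a i *: z i) /\ p (\sum_i a i *: z i) = \sum_i a i *: p (z i).
    by [].
  elim/big_rec2: _ => [|i x y _ [Zx <-]]; first by split => //; apply: cZ.1.
  have Zi : Z (a i *: z i) by apply: closedZ.
  by split; [apply: closedD | rewrite pD // pZ].
pose b i : kspace hX := p (z i).
have cE (c : {ffun 'I_d -> resfield V}) :
    \sum_i c i *: b i = p (\sum_i resfield_repr (c i) *: z i).
  by rewrite pS; apply: eq_bigr.
exists b => x; have [y Zy <-] := ps x; have [a Ba] := span _ Zy.
(* Uniqueness of coordinates: two families of representatives for the same vector differ by a
   relation modulo [B], hence by multiples of [t]. *)
have aE (c : {ffun 'I_d -> resfield V}) : p y = \sum_i c i *: b i ->
    forall i, c i = to_resfield (a i).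
  rewrite cE => e i; rewrite -[c i]resfield_reprK; apply/eqP.
  rewrite to_resfield_eqE; apply/asboolP.
  pose a' i := resfield_repr (c i) - a i.
  apply: (free a'); apply/pk; first exact: ZS.
  rewrite /a'; under eq_bigr do rewrite scalerBl.
  have ZSa := ZS a; have ZSc := ZS (fun i => resfield_repr (c i)).
  rewrite sumrB addrC -scaleN1r pl // -e.
  by have /pk := Ba; rewrite -scaleN1r addrC pl // => /(_ (cZ.2 _ _ _ ZSa Zy)).
exists [ffun i => to_resfield (a i)]; split=> [|c cy]; last first.
  by apply/ffunP => i; rewrite ffunE (aE c).
rewrite (eq_bigr (fun i => (a i *: p (z i) : kspace hX))); last first.
  by move=> i _; rewrite ffunE; apply: kspace_scaleE.
rewrite -pS; have ZSa := ZS a.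
have /pk := Ba; rewrite -scaleN1r addrC => /(_ (cZ.2 _ _ _ ZSa Zy)).
by rewrite pl // scaleN1r addrC => /eqP; rewrite subr_eq0 => /eqP.
Qed.

End QuotientDimension.

(** * Finite generation and finite dimension over a discrete valuation ring *)

Section Existence.
Variable V : dvr.
Local Notation t := (unif V).

Lemma unif_unit (x : V) : (exists y, x = y * t) \/ x \is a GRing.unit.
Proof.
have [_ h _] := dvrP V; have [|xu] := boolP (x \is a GRing.unit); first by right.
by left; apply/h.
Qed.

(** The values of [e] on [Z] form an ideal of [V], so its generator is itself such a value. *)
Lemma principal_image (M : lmodType V) (Z : M -> Prop) (e : {linear M -> V^o}) :
  closed_lin Z -> exists2 z, Z z & forall x, Z x -> exists y, e x = y * e z.
Proof.
move=> cZ; have [_ _ pid] := dvrP V.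
have [a aP] := pid (span_mod (fun v => exists2 x, Z x & v = e x)).
have mem x : Z x -> e x \in span_mod (fun v => exists2 x, Z x & v = e x).
  move=> Zx; apply/asboolP; exists [:: (1, e x)]; last by rewrite big_seq1 scale1r.
  by move=> u; rewrite inE => /eqP ->; exists x.
have [z Zz zE] : exists2 z, Z z & e z = a.
  have : a \in span_mod (fun v => exists2 x, Z x & v = e x).
    by apply/aP; exists 1; rewrite mul1r.
  move=> /asboolP[s sP ->]; elim: s sP => [|u s IH] sP.
    by exists 0; [apply: cZ.1 | rewrite big_nil linear0].
  have [|z Zz zE] := IH; first by move=> w ws; apply: sP; rewrite inE ws orbT.
  have [x Zx ux] := sP u (mem_head _ _).
  by exists (u.1 *: x + z); [apply: cZ.2 | rewrite linearP big_cons ux zE].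
by exists z => // x /mem/aP; rewrite zE.
Qed.

(** Submodules of a finite free module over a principal ideal domain are finitely generated: the
    image of the last coordinate is principal, and its kernel embeds by one coordinate fewer. *)
Lemma fg_coords (M : lmodType V) (n : nat) (e : nat -> {linear M -> V^o})
    (Z : M -> Prop) : closed_lin Z ->
    (forall x, Z x -> (forall i, (i < n)%N -> e i x = 0) -> x = 0) ->
  exists k (z : 'I_k -> M), (forall i, Z (z i)) /\
    forall x, Z x -> exists a : 'I_k -> V, x = \sum_i a i *: z i.
Proof.
elim: n Z => [|n IH] Z cZ e0.
  exists 0%N, (fun=> 0); split=> [[]//|x Zx]; exists (fun=> 0).
  by rewrite big_ord0; apply: e0.
have [||k [z [Zz zP]]] := IH (fun x => Z x /\ e n x = 0).
- split; first by split; [apply: cZ.1 | rewrite linear0].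
  move=> a x y [Zx ex] [Zy ey]; split; first exact: cZ.2.
  by rewrite linearP ex ey scaler0 addr0.
- move=> x [Zx ex] h; apply: e0 => // i; rewrite ltnS leq_eqVlt => /orP[/eqP ->//|].
  exact: h.
have [z0 Zz0 z0P] := principal_image (e n) cZ.
exists k.+1, (fun i => oapp z z0 (unlift ord0 i)); split=> [i|x Zx].
  by case: (unlift ord0 i) => [j|] //=; apply: (Zz j).1.
have [y ey] := z0P x Zx.
have [|a xE] := zP (x - y *: z0).
  split; first by apply: closedB => //; apply: closedZ.
  by rewrite linearB linearZ /= ey subrr.
exists (fun i => oapp a y (unlift ord0 i)); rewrite big_ord_recl unlift_none /=.
under eq_bigr do rewrite liftK /=.
by rewrite -xE addrC subrK.
Qed.

(** If some relation modulo [B] has a coefficient outside [tV], that coefficient is a unit and its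
    generator can be discarded; when no such relation exists the generators form a basis. *)
Lemma qdim_exists (M : lmodType V) (Z B : M -> Prop) k (z : 'I_k -> M) :
    closed_lin Z -> closed_lin B -> (forall x, Z x -> B (t *: x)) ->
    (forall i, Z (z i)) ->
    (forall x, Z x -> exists a : 'I_k -> V, B (x - \sum_i a i *: z i)) ->
  exists d, qdim Z B d.
Proof.
move=> cZ cB tB; elim: k z => [|k IH] z Zz span.
  by exists 0%N, z; split=> // a _ [].
have [free|] := pselect (forall a : 'I_k.+1 -> V, B (\sum_i a i *: z i) ->
    forall i, exists b, a i = b * t).
  by exists k.+1, z.
move=> /existsNP[a /not_implyP[Ba /existsNP[i0 ai0]]].
have [//|ui] := unif_unit (a i0).
have [||d qd] := IH (fun i : 'I_k => z (fintype.lift i0 i)); last (by exists d); first by move=> i; apply: Zz.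
move=> x Zx.
have [c Bc] := span x Zx.
(* Adding [-b] times the relation [a] to the expansion of [x] eliminates the generator [z i0]. *)
pose b := c i0 * (a i0)^-1.
exists (fun i => c (fintype.lift i0 i) - b * a (fintype.lift i0 i)).
have := closedD cB Bc (closedZ cB b Ba).
rewrite (bigD1_ord i0) //= (bigD1_ord i0 (P := xpredT)) //= scalerDr scalerA mulrVK //.
have vE (p q u : M) : x - (p + q) + (p + u) = x - (q - u).
  by rewrite opprB -addrA; congr (_ + _); rewrite opprD addrACA addNr add0r addrC.
rewrite vE scaler_sumr -sumrB.
move=> h; rewrite (eq_bigr (fun i => c (fintype.lift i0 i) *: z (fintype.lift i0 i)
  - b *: (a (fintype.lift i0 i) *: z (fintype.lift i0 i)))) // => i _.
by rewrite scalerBl scalerA.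
Qed.

Lemma qdim_fun (fT : finType) (M : lmodType V) (Z B : fT -> M -> Prop)
    (r : fT -> nat) :
    (forall T, B T 0) ->
    (forall T, Z T 0) ->
    (forall T, qdim (Z T) (B T) (r T)) ->
  qdim (fun g : fT -> M => forall T, Z T (g T)) (fun g => forall T, B T (g T))
    (\sum_T r T).
Proof.
move=> B0 Z0 /(_ _)/cid h; pose z T := sval (h T).
have zP T : qbasis (Z T) (B T) (z T) := svalP (h T).
pose tg T (i : 'I_(r T)) : {T : fT & 'I_(r T)} := existT (fun T => 'I_(r T)) T i.
pose y (p : {T : fT & 'I_(r T)}) : fT -> M :=
  fun T => if T == tag p then z (tag p) (tagged p) else 0.
have -> : \sum_T r T = #|{: {T : fT & 'I_(r T)}}|.
  by rewrite card_tagged sumnE big_map big_enum; apply: eq_bigr => T _; rewrite card_ord.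
have yS (a : {T : fT & 'I_(r T)} -> V) T :
    (\sum_p a p *: y p) T = \sum_i a (tg _ i) *: z T i.
  rewrite fct_sumE.
  transitivity (\sum_T' \sum_(i < r T') (a (tg T' i) *: y (tg T' i)) T).
    by rewrite sig_big_dep; apply: eq_bigr => -[T' i] _.
  rewrite (bigD1 T) //= [X in _ + X]big1 ?addr0 => [|T' T'T].
    apply: eq_bigr => i _; rewrite -[LHS]/(_ *: y _ T).
    by rewrite /y /= eqxx.
  rewrite big1 // => i _; rewrite -[LHS]/(_ *: y _ T).
  by rewrite /y /= eq_sym (negPf T'T) scaler0.
apply: (qdim_fin (z := y)); split=> [p T|x Zx|a Ba p].
- by rewrite /y; case: eqP => [->|_]; [case: (zP (tag p)) => + _ _; apply | ].
- have h' T : {a : 'I_(r T) -> V | B T (x T - \sum_i a i *: z T i)}.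
    by apply: cid; case: (zP T) => _ + _; apply.
  exists (fun p => sval (h' (tag p)) (tagged p)) => T.
  rewrite -[X in B T X]/(x T - (\sum_p sval (h' (tag p)) (tagged p) *: y p) T) yS.
  exact: svalP (h' T).
- case: p => T i; case: (zP T) => _ _ /(_ (fun i => a (tg _ i))).
  by apply; rewrite -yS.
Qed.

End Existence.

(** * Isomorphism of vector spaces by dimension *)

Section LinearAlgebra.
Variable K : fieldType.

Lemma has_dim_prod (M N : lmodType K) a b :
  has_dim M a -> has_dim N b -> has_dim (M * N)%type (a + b).
Proof.
move=> [x xP] [y yP].
pose z (i : 'I_(a + b)) : M * N :=
  match fintype.split i with inl i => (x i, 0) | inr j => (0, y j) end.
have zl i : z (lshift b i) = (x i, 0) by rewrite /z (fintype.unsplitK (inl i)).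
have zr j : z (rshift a j) = (0, y j) by rewrite /z (fintype.unsplitK (inr j)).
have zS (c : 'I_(a + b) -> K) : \sum_i c i *: z i
   = (\sum_i c (lshift b i) *: x i, \sum_j c (rshift a j) *: y j).
  rewrite big_split_ord /=; under eq_bigr do rewrite zl.
  under [X in _ + X]eq_bigr do rewrite zr.
  have eM (I : finType) (c' : I -> K) (x' : I -> M) :
      \sum_i c' i *: (x' i, 0 : N) = (\sum_i c' i *: x' i, 0).
    elim/big_rec2: _ => // i u v _ ->; congr (_, _) => /=.
    by rewrite scaler0 addr0.
  have eN (I : finType) (c' : I -> K) (x' : I -> N) :
      \sum_i c' i *: (0 : M, x' i) = (0, \sum_i c' i *: x' i).
    elim/big_rec2: _ => // i u v _ ->; congr (_, _) => /=.
    by rewrite scaler0 addr0.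
  by rewrite eM eN; congr (_, _) => /=; rewrite ?addr0 ?add0r.
exists z => -[u v]; have [c [uE cU]] := xP u; have [d [vE dU]] := yP v.
exists [ffun i => match fintype.split i with inl i => c i | inr j => d j end]; split.
  rewrite zS uE vE; congr (_, _); apply: eq_bigr => i _; rewrite ffunE.
    by rewrite (fintype.unsplitK (inl i)).
  by rewrite (fintype.unsplitK (inr i)).
move=> e; rewrite zS => -[uE' vE'].
have ce : c = [ffun i => e (lshift b i)].
  by apply: cU; rewrite uE'; apply: eq_bigr => i _; rewrite ffunE.
have de : d = [ffun i => e (rshift a i)].
  by apply: dU; rewrite vE'; apply: eq_bigr => i _; rewrite ffunE.
apply/ffunP => i; rewrite ffunE -[in RHS](fintype.splitK i).
by case: (fintype.split i) => j; rewrite ?ce ?de ffunE.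
Qed.

Lemma has_dim_iso (M N : lmodType K) d :
  has_dim M d -> has_dim N d -> lin_iso M N.
Proof.
move=> [x xP] [y yP].
have [f fP] := choice (fun u => let: ex_intro c (conj e _) := xP u in ex_intro _ c e).
have [g gP] := choice (fun u => let: ex_intro c (conj e _) := yP u in ex_intro _ c e).
have xU (c c' : {ffun 'I_d -> K}) : \sum_i c i *: x i = \sum_i c' i *: x i -> c = c'.
  by move=> e; have [c0 [_ cU]] := xP (\sum_i c i *: x i); rewrite -(cU c) // -(cU c').
have yU (c c' : {ffun 'I_d -> K}) : \sum_i c i *: y i = \sum_i c' i *: y i -> c = c'.
  by move=> e; have [c0 [_ cU]] := yP (\sum_i c i *: y i); rewrite -(cU c) // -(cU c').
pose F u := \sum_i f u i *: y i.
have Fl : linear F.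
  move=> a u v; rewrite /F scaler_sumr -big_split; apply: eq_bigr => i _ /=.
  have -> : f (a *: u + v) = [ffun i => a * f u i + f v i].
    apply: xU; rewrite -fP [X in a *: X + _]fP [X in _ + X]fP scaler_sumr -big_split.
    by apply: eq_bigr => j _ /=; rewrite ffunE scalerDl scalerA.
  by rewrite ffunE scalerDl scalerA.
pose L : {linear M -> N} := HB.pack F (GRing.isLinear.Build K M N *:%R F Fl).
exists L; exists (fun v => \sum_i g v i *: x i) => [u|v].
  have -> : g (L u) = f u by apply: yU; rewrite -gP.
  by rewrite -fP.
rewrite /L /= /F.
have -> : f (\sum_i g v i *: x i) = g v by apply: xU; rewrite -fP.
by rewrite -gP.
Qed.

End LinearAlgebra.

(** * Reduction modulo a nonzerodivisor homotopic to a scalar *)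

Section Reduction.
Variables (V : dvr) (C : lmodType V).
Local Notation t := (unif V).
Variables (deg : int -> C -> Prop) (d s phi : {linear C -> C}).
Hypothesis cdeg : forall j, closed_lin (deg j).
Hypothesis deg_d : forall j x, deg j x -> deg (j + 1) (d x).
Hypothesis deg_s : forall j x, deg j x -> deg (j - 1) (s x).
Hypothesis deg_phi : forall j x, deg j (phi x) <-> deg j x.
Hypothesis dd : forall x, d (d x) = 0.
Hypothesis phi_inj : forall x, phi x = 0 -> x = 0.
Hypothesis d_phi : forall x, d (phi x) = phi (d x).
Hypothesis s_phi : forall x, s (phi x) = phi (s x).
Hypothesis ds : forall x, d (s x) + s (d x) = phi x + t *: x.

Definition rcyc j x := deg j x /\ d x = 0.
Definition rbnd j x := exists2 g, deg (j - 1) g & x = d g.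
(* cocycles and coboundaries of the quotient complex [C / phi C] *)
Definition qcyc j x := deg j x /\ exists b, d x = phi b.
Definition qbnd j x := exists g e, deg (j - 1) g /\ x = d g + phi e.

Lemma rcyc_closed j : closed_lin (rcyc j).
Proof.
split; first by split; [apply: (cdeg j).1 | apply: linear0].
move=> a x y [hx dx] [hy dy]; split; first exact: (cdeg j).2.
by rewrite linearP dx dy scaler0 addr0.
Qed.

Lemma qcyc_closed j : closed_lin (qcyc j).
Proof.
split; first by split; [apply: (cdeg j).1 | exists 0; rewrite !linear0].
move=> a x y [hx [b dx]] [hy [c dy]]; split; first exact: (cdeg j).2.
by exists (a *: b + c); rewrite !linearP dx dy.
Qed.

Lemma qcyc_killed j x : qcyc j x -> qbnd j (t *: x).
Proof.
move=> [hx [b dx]]; exists (s x), (s b - x); split; first exact: deg_s.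
by rewrite linearB /= -s_phi -dx addrA ds addrAC subrr add0r.
Qed.

Let scale_rcyc j x : rcyc j x -> t *: x = d (s x) - phi x.
Proof.
by move=> [_ dx]; have := ds x; rewrite dx linear0 addr0 => ->; rewrite addrAC addrN add0r.
Qed.

(** The long exact sequence is replaced by an explicit basis: the classes [c i] from the complex
    itself, and for each [b k] killed by [t] a preimage under the connecting map. *)
Theorem qdim_reduction j p q :
  qdim (rcyc j) (mod_rel (rcyc j) (rbnd j)) p ->
  qdim (ann_rel (rcyc (j + 1)) (rbnd (j + 1))) (rbnd (j + 1)) q ->
  qdim (qcyc j) (qbnd j) (p + q).
Proof.
move=> [c [cZ cspan cfree]] [b [bZ bspan bfree]].
have /choice[g gP] k : exists g, deg j g /\ t *: b k = d g.
  by have [_ [g hg gE]] := bZ k; exists g; rewrite addrK in hg.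
(* As [d (b k) = 0], the homotopy gives [d (s (b k)) = phi (b k) + t b k], and [g k] removes the
   last term. So [d (b' k) = phi (b k)]: the connecting map sends [b' k] to [b k]. *)
pose b' k := s (b k) - g k.
have degj (I : finType) (a : I -> V) (f : I -> C) :
    (forall i, deg j (f i)) -> deg j (\sum_i a i *: f i).
  by move=> fj; apply: closed_sum => // i _; apply: closedZ.
have b'deg k : deg j (b' k).
  apply: closedB => //; last exact: (gP k).1.
  by have := deg_s (bZ k).1.1; rewrite addrK.
have db' k : d (b' k) = phi (b k).
  rewrite /b' linearB /= -(gP k).2; have := ds (b k).
  by rewrite (bZ k).1.2 linear0 addr0 => ->; rewrite addrK.
have dS (a : 'I_q -> V) : d (\sum_k a k *: b' k) = phi (\sum_k a k *: b k).
  rewrite !linear_sum; apply: eq_bigr => k _.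
  by rewrite [LHS]linearZ [RHS]linearZ /= db'.
pose z (i : 'I_p + 'I_q) := match i with inl i => c i | inr k => b' k end.
suff zQ : qbasis (qcyc j) (qbnd j) z.
  by have := qdim_fin zQ; rewrite card_sum !card_ord.
have zS (a : 'I_p + 'I_q -> V) : \sum_i a i *: z i
    = \sum_i a (inl i) *: c i + \sum_k a (inr k) *: b' k by rewrite big_sumType.
have cS (a : 'I_p -> V) : rcyc j (\sum_i a i *: c i).
  by apply: closed_sum => [|i _]; [|apply: closedZ]; rewrite //; apply: rcyc_closed.
split=> [[i|k]|x [hx [y dx]]|a].
- by have [hc dc] := cZ i; split=> //; exists 0; rewrite dc linear0.
- by split; [apply: b'deg | exists (b k); apply: db'].
(* Spanning. The image [y] of [x] under the connecting map is a cocycle with [t y = d (s y - x)],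
   hence a combination of the [b k] up to a coboundary [d e]. *)
- have hy : deg (j + 1) y by apply/deg_phi; rewrite -dx; apply: deg_d.
  have dy : d y = 0 by apply: phi_inj; rewrite -d_phi -dx dd.
  have [|a [e he yE]] := bspan y.
    split=> //; exists (s y - x).
      by rewrite addrK; apply: closedB => //; have := deg_s hy; rewrite addrK.
    by rewrite linearB /= dx -(scale_rcyc (j := j + 1)).
  rewrite addrK in he.
  (* Once corrected, [x] is a genuine cocycle and can be expanded in the [c i] modulo [t]; the
     multiple [t w'] that remains is [d (s w') - phi w'], trivial in the quotient complex. *)
  pose w := x - \sum_k a k *: b' k - phi e.
  have hw : rcyc j w.
    split.
      by do 2?[apply: closedB => //]; [apply: degj | apply/deg_phi].
    by rewrite /w !linearB /= dS dx d_phi -!linearB /= -yE subrr linear0.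
  have [a' [w' hw' [h hh hE]]] := cspan w hw.
  exists (fun i => match i with inl i => a' i | inr k => a k end).
  exists (h + s w'), (e - w'); split.
    by apply: closedD => //; apply: deg_s hw'.1.
  rewrite zS; have := hE; rewrite /w.
  set S1 := \sum_i _; set S2 := \sum_k _ => /eqP.
  rewrite !subr_eq => /eqP ->; rewrite (scale_rcyc hw') [d (h + _)]linearD [phi (e - _)]linearB /=.
  have zid (u1 u2 u3 u4 u5 : C) :
      u1 + (u2 - u3) + u4 + u5 = u1 + u2 + (u5 - u3) + u4.
    by rewrite [LHS]addrAC; congr (_ + _); rewrite !addrA [LHS]addrAC.
  by apply/eqP; rewrite subr_eq zid [in X in _ == X]addrA.
rewrite zS; set S1 := \sum_i _ *: c i; set S2 := \sum_k _ *: b' k.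
have hS1 : rcyc j S1 by apply: cS.
have hS2 : deg j S2 by apply: degj.
move=> [g0 [e [hg0 SE]]].
have he : deg j e.
  apply/deg_phi; have -> : phi e = S1 + S2 - d g0 by rewrite SE addrC addKr.
  apply: closedB => //; first by apply: closedD => //; apply: hS1.1.
  by have := deg_d hg0; rewrite subrK.
(* Independence, first for the [b' k]: applying [d] to the relation and cancelling [phi] leaves a
   relation among the [b k]. *)
have be : \sum_k a (inr k) *: b k = d e.
  apply/eqP; rewrite -subr_eq0; apply/eqP/phi_inj; rewrite linearB /= -dS -d_phi.
  have := congr1 d SE; rewrite !linearD /= hS1.2 dd !add0r => ->.
  exact: subrr.
have b_t : forall k, exists b0, a (inr k) = b0 * t.
  by apply: (bfree (fun k => a (inr k))); exists e; rewrite ?addrK.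
have [bt btE] := choice b_t; case=> [i|k]; last exact: b_t.
apply: (cfree (fun i => a (inl i))).
pose G := \sum_k bt k *: s (b' k); pose E := \sum_k bt k *: g k.
(* Because [t b' k = d (s (b' k)) + phi (g k)], the part with coefficients in [tV] is a coboundary
   of the quotient complex. *)
have S2E : S2 = d G + phi E.
  rewrite /S2 /G /E !linear_sum -big_split; apply: eq_bigr => k _ /=.
  rewrite btE -scalerA [X in _ = X + _]linearZ [X in _ = _ + X]linearZ -scalerDr; congr (_ *: _).
  have gE : g k = s (b k) - b' k by rewrite /b' opprB addrCA subrr addr0.
  have -> : phi (g k) = phi (s (b k)) - phi (b' k) by rewrite gE linearB.
  rewrite [in RHS]addrA; apply: (addrI (phi (b' k))).
  by rewrite -ds db' s_phi [RHS]addrC subrK.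
have S1E : S1 = d (g0 - G) + phi (e - E).
  rewrite !linearB addrACA -opprD /= -SE S2E addrK.
  by [].
have hE : deg j (e - E).
  by apply: closedB => //; apply: degj => k; apply: (gP k).1.
have dE : d (e - E) = 0.
  apply: phi_inj; rewrite -d_phi.
  by have := congr1 d S1E; rewrite hS1.2 [d (d _ + _)]linearD dd add0r.
(* On the cocycle [e - E] the map [phi] is [-t] up to a coboundary, so [S1] lies in [t Z] modulo
   coboundaries. *)
exists (- (e - E)); first by apply: closedN => //; apply: rcyc_closed.
exists (g0 - G + s (e - E)); last first.
  rewrite -[X in X - _]/S1 S1E scalerN opprK (scale_rcyc (conj hE dE)) -addrA.
  by rewrite [X in _ + X]addrC subrK -linearD.
apply: closedD => //; last exact: deg_s.
apply: closedB => //; apply: closed_sum => // k _; apply: closedZ => //.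
exact: deg_s.
Qed.

End Reduction.

(** * Multidegrees and Hochster's formula *)

Definition msupport (m : nat) (a : 'X_{1..m}) : {set 'I_m} := [set i | a i != 0%N].

(* [N] behaves like the Stanley-Reisner module of [D]: over the coefficients it
   is free on the monomials whose support is a face. *)
Record monomial_coordinates (V : comNzRingType) (m : nat) (D : {set {set 'I_m}})
    (N : lmodType V) (x : 'I_m -> {linear N -> N})
    (cf : 'X_{1..m} -> {linear N -> V^o}) : Prop := MonomialCoordinates {
  coords_inj : forall u, (forall b, cf b u = 0) -> u = 0;
  coords_nonface : forall b u, msupport b \notin D -> cf b u = 0;
  coords_var : forall b v u, msupport b \in D ->
    cf b (x v u) = if b v == 0%N then 0 else cf (b - U_(v))%MM u;
  coords_bound : forall u, exists k, forall b, cf b u != 0 -> (mdeg b < k)%N;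
  coords_exist : forall (c : 'X_{1..m} -> V) k,
    (forall b, c b != 0 -> msupport b \in D /\ (mdeg b < k)%N) ->
    exists u, forall b, cf b u = c b }.

Section Multidegree.
Variables (V : comNzRingType) (m : nat) (D : {set {set 'I_m}}).
Variables (N : lmodType V) (x : 'I_m -> {linear N -> N}).
Variable cf : 'X_{1..m} -> {linear N -> V^o}.
Implicit Types (F G T : {set 'I_m}) (a b : 'X_{1..m}).

Hypothesis mc : monomial_coordinates D x cf.

Let cf_inj := coords_inj mc.
Let cf_nonface := coords_nonface mc.
Let cf_x := coords_var mc.
Let cf_bound := coords_bound mc.
Let cf_exists := coords_exist mc.

(* The basis element indexed by [G] has multidegree [mind (~: G)]. *)
Definition mind T : 'X_{1..m} := [multinom (i \in T : nat) | i < m].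
Definition msub a G : 'X_{1..m} := [multinom (a i - (i \notin G))%N | i < m].

(** The summand indexed by [G] can be nonzero in multidegree [a] only if the monomial [msub a G]
    makes sense and survives in [N]. Subtraction in [msub] truncates, hence the condition on
    supports. *)
Definition admissible a G := (~: G \subset msupport a) && (msupport (msub a G) \in D).

(* the part of [f] of multidegree [a] *)
Definition piece a (f : {set 'I_m} -> N) : {set 'I_m} -> V^o :=
  fun G => if ~: G \subset msupport a then cf (msub a G) (f G) else 0.

Local Notation kos1 := (kos (fun _ : 'I_m => idfun : {linear V^o -> V^o})).

Lemma msubD b G : msub (b + mind (~: G))%MM G = b.
Proof. by apply/mnmP => i; rewrite !mnmE inE addnK. Qed.

Lemma mind_sub b G : ~: G \subset msupport (b + mind (~: G))%MM.
Proof.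
apply/subsetP => i; rewrite !inE mnmDE mnmE inE => ->.
by rewrite addn1.
Qed.

Lemma msubK a G : ~: G \subset msupport a -> (msub a G + mind (~: G))%MM = a.
Proof.
move=> /subsetP Ga; apply/mnmP => i; rewrite !mnmE inE.
have := Ga i; rewrite !inE; case: (i \in G) => /= [_|/(_ isT)]; first by rewrite subn0 addn0.
by case: (a i) => // k _; rewrite addn1 subn1.
Qed.

Lemma pieceE b f G : piece (b + mind (~: G))%MM f G = cf b (f G).
Proof. by rewrite /piece mind_sub msubD. Qed.

Lemma piece_eq0 f : (forall a, piece a f = 0) -> f = 0.
Proof.
by move=> f0; apply: funext => G; apply: cf_inj => b; rewrite -pieceE f0.
Qed.

Lemma piece_admissible a f G : ~~ admissible a G -> piece a f G = 0.
Proof. by rewrite /piece /admissible; case: ifP => //= _ /cf_nonface. Qed.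

Fact piece_lin a c f g : piece a (c *: f + g) = c *: piece a f + piece a g.
Proof.
apply: funext => G; rewrite -[RHS]/(c *: piece a f G + piece a g G) /piece.
case: ifP => _; last by rewrite scaler0 addr0.
by rewrite -[(c *: f + g) G]/(c *: f G + g G) linearP.
Qed.

Lemma pieceB a f g : piece a (f - g) = piece a f - piece a g.
Proof. by rewrite -[f - g]addrC -scaleN1r piece_lin scaleN1r addrC. Qed.

(** Within one multidegree a variable carries the coordinate of one monomial to that of the next
    unchanged, so the differential is that of the Koszul complex of identities, cut down to
    admissible sets. *)
Lemma piece_kos a f F :
  piece a (kos x f) F = if admissible a F then kos1 (piece a f) F else 0.
Proof.
case: ifPn => [/andP[Fa FD]|]; last exact: piece_admissible.
rewrite {1}/piece Fa /kos linear_sum /=; apply: eq_bigr => v vF.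
rewrite linear_sg cf_x //; congr (sg _ _); rewrite /piece.
have -> : (msub a F v == 0%N) = (a v == 0%N) by rewrite mnmE vF subn0.
have -> : (~: (F :\ v) \subset msupport a) = (a v != 0%N).
  apply/subsetP/idP => [/(_ v)|av u]; first by rewrite !inE eqxx; apply.
  rewrite !inE negb_and negbK => /orP[/eqP ->//|uF].
  by have := subsetP Fa u; rewrite !inE; apply.
case: eqVneq => // av; congr (cf _ _); apply/mnmP => u; rewrite !mnmE !inE.
by case: (eqVneq v u) => [<-|]; rewrite ?eqxx ?vF //= ?subn0 ?andbF //= eq_sym => /negPf ->.
Qed.

(* Then contraction along [i] preserves the multidegree-[a] part. *)
Definition stable_at a i := forall F, admissible a (i |: F) = admissible a F.

(** The exponent of [x_i] in [msub a F] is [a i] or [a i - 1], nonzero in both cases, so the support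
    does not see whether [i] is in [F]. *)
Lemma stable_at2 a i : (1 < a i)%N -> stable_at a i.
Proof.
move=> ai F; rewrite /admissible; congr (_ && (_ \in D)).
  apply/subsetP/subsetP => h u; have := h u; rewrite !inE.
    case: (eqVneq u i) => [-> _ _|_]; last by [].
    by rewrite -lt0n ltnW.
  by case: (eqVneq u i).
apply/setP => u; rewrite !inE !mnmE !inE; case: (eqVneq u i) => [->|] //=.
by rewrite subn0; case: (i \in F); rewrite ?subn0 //=; lia.
Qed.

Lemma stable_at1 a i : D = setT -> a i != 0%N -> stable_at a i.
Proof.
move=> DT ai F; rewrite /admissible DT !inE !andbT.
apply/subsetP/subsetP => h u; have := h u; rewrite !inE.
  by case: (eqVneq u i) => [->|].
by case: (eqVneq u i).
Qed.

Lemma contr_admissible a i (h : {set 'I_m} -> V^o) F :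
    stable_at a i -> (forall G, ~~ admissible a G -> h G = 0) ->
  ~~ admissible a F -> contr i h F = 0.
Proof.
move=> st h0 nF; rewrite /contr; case: ifP => // iF.
by rewrite h0 ?st // linear0.
Qed.

Section Selection.
Variable sel : 'X_{1..m} -> option 'I_m.
Hypothesis selP : forall a i, sel a = Some i -> stable_at a i.

(** The direction of contraction may vary with the multidegree. The contracted pieces assemble to
    one cochain because the values of [f] involve only monomials of bounded degree. *)
Lemma sel_contr (f : {set 'I_m} -> N) j : kdeg j f ->
  exists2 g, kdeg (j - 1) g &
    forall a, piece a g = if sel a is Some i then contr i (piece a f) else 0.
Proof.
move=> hf.
pose h a : {set 'I_m} -> V^o := if sel a is Some i then contr i (piece a f) else 0.
have hN a F : ~~ admissible a F -> h a F = 0.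
  rewrite /h; case E : (sel a) => [i|] // nF.
  apply: contr_admissible nF; first exact: selP E.
  by move=> G; apply: piece_admissible.
have hK a : kdeg (j - 1) (h a).
  rewrite /h; case: (sel a) => [i|] //; apply: kdeg_contr => G Gj.
  by rewrite /piece hf // linear0 if_same.
have /choice[k kP] := cf_bound.
have /choice[g gP] F : exists u, forall b, cf b u = h (b + mind (~: F))%MM F.
  (* A coordinate of the contraction at [F] comes from the value of [f] at some [i |: F], at a
     monomial of larger degree; so a bound over all [i] suffices. *)
  apply: (cf_exists (k := (\max_(i < m) k (f (i |: F))).+1)) => b hb.
  have adm : admissible (b + mind (~: F))%MM F.
    by apply: contraNT hb => /hN ->.
  split; first by have /andP[_] := adm; rewrite msubD.
  move: hb; rewrite /h; case E : (sel _) => [i|]; last by rewrite eqxx.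
  rewrite /contr; case: ifPn => iF; first by rewrite eqxx.
  move=> hb; have : piece (b + mind (~: F))%MM f (i |: F) != 0.
    by apply: contraNneq hb => ->; rewrite /sg oppr0 if_same.
  rewrite /piece; case: ifP => _; last by rewrite eqxx.
  move=> /kP lt; rewrite ltnS; apply: leq_trans (leq_bigmax i).
  apply: leq_trans (ltnW lt); rewrite !mdegE; apply: leq_sum => u _.
  by rewrite !mnmE !inE; case: (u == i); case: (u \in F) => /=; lia.
exists g => [F Fj|a]; first by apply: cf_inj => b; rewrite gP hK.
apply: funext => F; rewrite -[RHS]/(h a F) /piece.
case: ifPn => Fa; first by rewrite gP msubK.
by rewrite hN // /admissible (negPf Fa).
Qed.

Lemma sel_acyclic (f : {set 'I_m} -> N) j : kcycle x j f ->
  (forall a, sel a = None -> piece a f = 0) -> kbound x j f.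
Proof.
move=> [hf cf0] fN; have [g hg gP] := sel_contr hf; exists g => //.
apply/eqP; rewrite -subr_eq0; apply/eqP/piece_eq0 => a; rewrite pieceB.
apply/eqP; rewrite subr_eq0; apply/eqP/funext => F; rewrite piece_kos gP.
case E : (sel a) => [i|]; last first.
  by rewrite fN // linear0; case: ifP.
case: ifPn => adm; last exact: piece_admissible.
have kE : kos1 (contr i (piece a f)) F + contr i (kos1 (piece a f)) F = piece a f F.
  have /(congr1 (fun h => h F)) :=
    kos_contr (fun _ : 'I_m => idfun : {linear V^o -> V^o}) i (piece a f).
  exact.
(* By stability [i |: F] is admissible too, so [kos1] of the piece is there the piece of [kos f],
   which is zero. *)
rewrite -kE -[RHS]addr0; congr (_ + _).
rewrite /contr; case: ifPn => // iF; apply/eqP; rewrite sg_eq0.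
have := piece_kos a f (i |: F); rewrite (selP E) adm => <-.
by rewrite cf0 /piece; case: ifP => // _; rewrite linear0.
Qed.

End Selection.

(* the sign comparing the orderings of [F] and of [T :|: F] *)
Definition twist T F : bool := odd (\sum_(u in F) par T u).

Lemma twistD1 T F v : v \in F -> twist T (F :\ v) = par T v (+) twist T F.
Proof.
move=> vF; rewrite /twist (big_setD1 v vF) /= oddD addbA.
by rewrite oddb addbb addFb.
Qed.

(** In the squarefree multidegree supported off [T] only the sets [G] containing [T] occur. Writing
    [G] as the disjoint union of [T] and [F], such a [G] is admissible exactly when [F] is a
    face. *)
Definition hochster_fun (f : {set 'I_m} -> N) : {set 'I_m} -> cochain V m :=
  fun T => [ffun F : {set 'I_m} => if F :&: T == set0
    then sg (twist T F) (piece (mind (~: T)) f (T :|: F)) else 0].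

Fact hochster_linear : linear hochster_fun.
Proof.
move=> c f g; apply: funext => T.
rewrite -[RHS]/(c *: hochster_fun f T + hochster_fun g T).
apply/ffunP => F; rewrite !ffunE piece_lin; case: ifP => _; last first.
  by rewrite scaler0 addr0.
by rewrite -linearP.
Qed.

HB.instance Definition _ := GRing.isLinear.Build V ({set 'I_m} -> N)
  ({set 'I_m} -> cochain V m) *:%R hochster_fun hochster_linear.

Lemma msub_mind T F : F :&: T == set0 -> msub (mind (~: T)) (T :|: F) = mind F.
Proof.
move=> /eqP/setP FT; apply/mnmP => i; have := FT i; rewrite !mnmE !inE.
by case: (i \in F); case: (i \in T).
Qed.

Lemma msupport_mind F : msupport (mind F) = F.
Proof. by apply/setP => i; rewrite !inE mnmE; case: (i \in F). Qed.

Lemma piece_mind T F f : F :&: T == set0 ->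
  piece (mind (~: T)) f (T :|: F) = cf (mind F) (f (T :|: F)).
Proof.
by move=> FT; rewrite /piece msub_mind // msupport_mind setCS subsetUl.
Qed.

Lemma admissible_mind T F : F :&: T == set0 ->
  admissible (mind (~: T)) (T :|: F) = (F \in D).
Proof.
move=> FT; rewrite /admissible msub_mind // !msupport_mind.
by rewrite setCS subsetUl.
Qed.

Lemma mem_deletion T F : (F \in deletion D T) = (F \in D) && (F :&: T == set0).
Proof. by rewrite inE. Qed.

Lemma hochster_cobd f T :
  cobd (deletion D T) (hochster_fun f T) = hochster_fun (kos x f) T.
Proof.
apply/ffunP => F; rewrite !ffunE mem_deletion.
have [FT|FT] := boolP (F :&: T == set0); last by rewrite andbF.
rewrite andbT piece_kos admissible_mind //; case: ifP => FD; last by rewrite linear0.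
rewrite /kos linear_sum; apply/esym.
(* Removing a vertex of [T] leaves a set not containing [T], which has no part in this
   multidegree. *)
rewrite (bigID (fun v => v \in T)) /= [X in X + _]big1 ?add0r; last first.
  move=> v /andP[_ vT]; rewrite /piece msupport_mind setCS.
  case: ifPn => [/subsetP/(_ v vT)|_]; first by rewrite !inE eqxx.
  by rewrite !linear0.
rewrite (eq_bigl (fun v => v \in F)); last first.
  move=> v; rewrite !inE; have /setP/(_ v) := eqP FT; rewrite !inE.
  by case: (v \in F); case: (v \in T).
apply: eq_bigr => v vF; rewrite ffunE.
have vT : v \notin T.
  by have /setP/(_ v) := eqP FT; rewrite !inE vF /= => ->.
have FvT : (F :\ v) :&: T == set0.
  apply/eqP/setP => u; have /setP/(_ u) := eqP FT; rewrite !inE.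
  by case: (u == v); case: (u \in F).
have -> : (T :|: F) :\ v = T :|: F :\ v.
  by apply/setP => u; rewrite !inE; case: eqVneq => [->|] //=; rewrite (negPf vT).
rewrite FvT parU; last by rewrite disjoint_sym -setI_eq0.
(* The Koszul sign of [v] in [T :|: F] is that in [F] changed by [par T v], which is also the change
   of [twist]. *)
rewrite twistD1 // !sgM !sgE -[(-1) ^+ #|_|]signr_odd -/(par F v).
have -> (c d : V) : c * (d *: (piece (mind (~: T)) f (T :|: F :\ v) : V^o))
    = (c * d) *: (piece (mind (~: T)) f (T :|: F :\ v) : V^o) by rewrite -scalerA.
rewrite -signr_addb; congr ((-1) ^+ _ *: _).
by case: (twist T F); case: (par T v); case: (par F v).
Qed.

Lemma hochster_cochain f j T : kdeg j f ->
  hochster_fun f T \in cochain_pred (deletion D T) (j - 1 - #|T|%:Z).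
Proof.
move=> hf; apply/forallP => F; rewrite ffunE mem_deletion.
case: ifP => FT; last by rewrite eqxx.
apply/implyP => nz; rewrite andbT; apply/andP; split.
  apply: contraNT nz; rewrite -(admissible_mind FT) => /piece_admissible ->.
  by rewrite /sg oppr0 if_same.
have : #|T :|: F|%:Z == j.
  apply: contraNT nz => /hf fTF; rewrite /piece fTF linear0 if_same.
  by rewrite /sg oppr0 if_same.
have -> : #|T :|: F| = (#|T| + #|F|)%N.
  by apply/eqP; rewrite (leq_card_setU T F).2 disjoint_sym -setI_eq0.
by move=> /eqP <-; rewrite PoszD; apply/eqP; rewrite addrAC subrK addrC addKr.
Qed.

Lemma hochster_eq0 f T : hochster_fun f T = 0 -> piece (mind (~: T)) f = 0.
Proof.
move=> f0; apply: funext => G; have [TG|TG] := boolP (T \subset G); last first.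
  by rewrite /piece msupport_mind setCS (negPf TG).
have GT : (G :\: T) :&: T == set0 by rewrite setIDAC setDIl setDv setI0.
move/ffunP: f0 => /(_ (G :\: T)); rewrite !ffunE GT.
have -> : T :|: G :\: T = G.
  apply/setP => u; have := subsetP TG u; rewrite !inE.
  by case: (u \in T) => //= ->.
by move/eqP; rewrite sg_eq0 => /eqP.
Qed.

Lemma squarefreeP a : (forall i, a i <= 1)%N -> a = mind (~: ~: msupport a).
Proof.
move=> a1; apply/mnmP => i; rewrite mnmE setCK inE.
by case: (a i) (a1 i) => [|[|]].
Qed.

Lemma hochster_exact f j : kcycle x j f ->
  (forall T, hochster_fun f T = 0) -> kbound x j f.
Proof.
move=> cf0 f0; apply: (sel_acyclic (sel := fun a => [pick i | (1 < a i)%N])) cf0 _.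
  by move=> a i; case: pickP => // u au [<-]; apply: stable_at2.
move=> a; case: pickP => // au _; rewrite (@squarefreeP a); first exact: hochster_eq0.
by move=> i; rewrite leqNgt au.
Qed.

(** The last clause makes the preimage purely squarefree, so that it is a cocycle as soon as all
    [h T] are. *)
Lemma hochster_surj j (h : {set 'I_m} -> cochain V m) :
    (forall T, h T \in cochain_pred (deletion D T) (j - 1 - #|T|%:Z)) ->
  exists f, [/\ kdeg j f, hochster_fun f = h
    & forall a i, (1 < a i)%N -> piece a f = 0].
Proof.
move=> hh.
(* Inverse of [hochster_fun]: a squarefree monomial with support [F] inside [G] determines [T] as
   [G :\: F]. *)
pose c G b : V := let F := msupport b in
  if (b == mind F) && (F \subset G) then sg (twist (G :\: F) F) (h (G :\: F) F : V^o) else 0.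
have cP G b : c G b != 0 ->
    [/\ b = mind (msupport b), msupport b \in D, msupport b \subset G & #|G|%:Z = j].
  rewrite /c; case: ifP => [/andP[/eqP bF FG] nz|]; last by rewrite eqxx.
  have := forallP (hh (G :\: msupport b)) (msupport b).
  have hn : h (G :\: msupport b) (msupport b) != 0.
    by apply: contraNneq nz => ->; rewrite /sg oppr0 if_same.
  rewrite hn mem_deletion /= => /andP[/andP[FD _] /eqP FE]; split=> //.
  by rewrite -(cardsID (msupport b) G) (setIidPr FG) PoszD FE addrAC !subrK.
have /choice[f fP] G : exists u, forall b, cf b u = c G b.
  apply: (cf_exists (k := m.+1)) => b /cP[bE bD _ _]; split=> //.
  rewrite bE mdegE ltnS -[X in (_ <= X)%N]card_ord -sum1_card.
  by apply: leq_sum => i _; rewrite mnmE; case: (_ \in _).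
exists f; split.
- move=> G Gj; apply: cf_inj => b; rewrite fP; apply/eqP; apply: contraTT Gj.
  by move=> /cP[_ _ _ ->]; rewrite eqxx.
- apply: funext => T; apply/ffunP => F; rewrite ffunE; case: ifPn => FT; last first.
    have := forallP (hh T) F; rewrite mem_deletion (negPf FT) andbF implybF negbK.
    by move=> /eqP.
  rewrite piece_mind // fP /c msupport_mind eqxx subsetUr /=.
  have -> : (T :|: F) :\: F = T.
    by rewrite setDUl setDv setU0; apply/setDidPl; rewrite disjoint_sym -setI_eq0.
  by rewrite sgM addbb.
move=> a i ai; apply: funext => G; rewrite /piece; case: ifP => // Ga.
rewrite fP; apply/eqP; apply: contraTT ai => /cP[bE _ FG _].
rewrite -(msubK Ga) mnmDE {1}bE !mnmE inE -leqNgt.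
have := subsetP FG i; rewrite !inE mnmE.
by case: (i \in G) => [|/contraNF]; case: (a i - _ != 0)%N => //= /(_ isT).
Qed.

End Multidegree.

(** * Stanley-Reisner modules *)

Section RestrictedAction.
Context {A B : comNzRingType} (f : {rmorphism B -> A}) (L : lmodType A).

Definition ract (a : A) (u : restr f L) : restr f L := a *: (u : L).

Fact ract_linear a : linear (ract a).
Proof.
move=> c u v; rewrite /ract -[c *: u + v]/(f c *: (u : L) + (v : L)).
rewrite -[RHS]/(f c *: (a *: (u : L)) + a *: (v : L)).
by rewrite scalerDr !scalerA mulrC.
Qed.

HB.instance Definition _ a := GRing.isLinear.Build B (restr f L) (restr f L)
  *:%R (ract a) (ract_linear a).

Definition lact (m : nat) (y : 'I_m -> A) (v : 'I_m) :
  {linear restr f L -> restr f L} := ract (y v).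

Lemma kcycle_restr (m : nat) (y : 'I_m -> A) j (g : {set 'I_m} -> L) :
  kcycle (lact y) j (g : {set 'I_m} -> restr f L) <-> kcycle (yact y L) j g.
Proof. by []. Qed.

Lemma kbound_restr (m : nat) (y : 'I_m -> A) j (g : {set 'I_m} -> L) :
  kbound (lact y) j (g : {set 'I_m} -> restr f L) <-> kbound (yact y L) j g.
Proof. by []. Qed.

End RestrictedAction.

Definition pointwise (B : comNzRingType) (T : Type) (M N : lmodType B)
  (h : {linear M -> N}) (g : T -> M) : T -> N := fun x => h (g x).

Fact pointwise_linear (B : comNzRingType) T (M N : lmodType B) (h : {linear M -> N}) :
  linear (@pointwise B T M N h).
Proof. by move=> a u v; apply: funext => x; rewrite /pointwise; apply: linearP. Qed.

HB.instance Definition _ (B : comNzRingType) (T : Type) (M N : lmodType B)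
    (h : {linear M -> N}) :=
  GRing.isLinear.Build B (T -> M) (T -> N) *:%R (@pointwise B T M N h)
    (@pointwise_linear B T M N h).

Section MonomialCoefficients.
Variables (V : comNzRingType) (m : nat).

Lemma mcoeffXM (k b : 'X_{1..m}) (p : {mpoly V[m]}) :
  ('X_[k] * p)@_b = if (k <= b)%MM then p@_(b - k) else 0.
Proof.
case: ifPn => kb; first by rewrite -{1}(submK kb) addmC mulrC mcoeffMX.
apply/eqP; rewrite mcoeff_eq0 mulrC (perm_mem (msuppMX _ _)).
apply: contra kb => /mapP[c _ ->]; apply/mnm_lepP => i.
by rewrite mnmDE leq_addr.
Qed.

Lemma mcoeffXUM (v : 'I_m) b (p : {mpoly V[m]}) :
  ('X_v * p)@_b = if b v == 0%N then 0 else p@_(b - U_(v)).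
Proof.
rewrite mcoeffXM; have -> : (U_(v) <= b)%MM = (b v != 0%N).
  apply/mnm_lepP/idP => [/(_ v)|bv i]; first by rewrite mnm1E eqxx lt0n.
  by rewrite mnm1E; case: eqVneq => [<-|]; rewrite ?lt0n.
by case: eqVneq.
Qed.

End MonomialCoefficients.

Section Coordinates.
Variables (V : dvr) (n : nat) (D : {set {set 'I_n.+1}}).
Local Notation t := (unif V).
Local Notation m := n.+1.
Local Notation S := {mpoly V[m]}.
Hypothesis hD : simplicial D.
Variables (L : lmodType S) (pi : {linear S^o -> L}).
Hypothesis pi_surj : forall u, exists p, pi p = u.
Hypothesis pi_ker : forall p : S,
  pi p = 0 <-> forall b, msupport b \in D -> p@_b = 0.

Local Notation N := (restr (@mpolyC m V) L).

Definition lifting (u : L) : S := projT1 (cid (pi_surj u)).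

Lemma liftingK u : pi (lifting u) = u.
Proof. exact: projT2 (cid (pi_surj u)). Qed.

Lemma piM (p q : S) : pi (p * q) = p *: pi q.
Proof. by rewrite -[p * q]/(p *: (q : S^o)) linearZ. Qed.

(** By [pi_ker] the coefficient at a monomial supported on a face is independent of the chosen
    representative. *)
Definition coord (b : 'X_{1..m}) (u : N) : V^o :=
  if msupport b \in D then (lifting u)@_b else 0.

Lemma coord_pi b (p : S) :
  coord b (pi p) = if msupport b \in D then p@_b else 0.
Proof.
rewrite /coord; case: ifP => // bD; apply/eqP; rewrite -subr_eq0 -mcoeffB.
apply/eqP; have [h _] := pi_ker (lifting (pi p) - p).
by apply: h => //; rewrite linearB liftingK subrr.
Qed.

Fact coord_linear b : linear (coord b).
Proof.
move=> a u v; rewrite -[u in LHS]liftingK -[v in LHS]liftingK.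
rewrite -[X in coord b X]/(a%:MP *: pi (lifting u) + pi (lifting v)).
rewrite -piM -linearD coord_pi /coord.
case: ifP => _; last by rewrite scaler0 addr0.
by rewrite mcoeffD mcoeffCM.
Qed.

HB.instance Definition _ b := GRing.isLinear.Build V N V^o *:%R (coord b) (coord_linear b).

Definition coord_lin b : {linear N -> V^o} := coord b.

Lemma coord_inj u : (forall b, coord b u = 0) -> u = 0.
Proof.
move=> h; rewrite -(liftingK u); apply/pi_ker => b bD.
by have := h b; rewrite /coord bD.
Qed.

Lemma coord_nonface b u : msupport b \notin D -> coord b u = 0.
Proof. by rewrite /coord => /negPf ->. Qed.

Lemma coord_var b v u : msupport b \in D ->
  coord b (lact (@mpolyC m V) L (fun i => 'X_i) v u)
  = if b v == 0%N then 0 else coord (b - U_(v))%MM u.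
Proof.
move=> bD; rewrite /lact /= /ract -[u in LHS]liftingK -piM coord_pi bD mcoeffXUM.
case: ifP => // _; rewrite /coord (hD bD) //.
by apply/subsetP => i; rewrite !inE mnmBE; case: (b i).
Qed.

Lemma coord_bound u : exists k, forall b, coord b u != 0 -> (mdeg b < k)%N.
Proof.
exists (msize (lifting u)) => b; rewrite /coord; case: ifP => _; last by rewrite eqxx.
by rewrite -mcoeff_msupp => /msize_mdeg_lt.
Qed.

Lemma coord_exists (c : 'X_{1..m} -> V) k :
  (forall b, c b != 0 -> msupport b \in D /\ (mdeg b < k)%N) ->
  exists u, forall b, coord b u = c b.
Proof.
move=> h; exists (pi (\sum_(b : 'X_{1..m < k}) (c b *: 'X_[b] : S))) => b.
rewrite coord_pi; case: ifPn => bD; last first.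
  by apply/esym/eqP; apply: contraNT bD => /h[].
have [bk|kb] := ltnP (mdeg b) k; first exact: mcoeff_mpoly.
have -> : c b = 0 by apply/eqP; apply: contraTT kb => /h[_]; rewrite -ltnNge.
rewrite raddf_sum big1 //= => i _; rewrite mcoeffZ mcoeffX.
case: eqVneq => [ib|_]; last by rewrite mulr0.
by have := bmdeg i; rewrite ib ltnNge kb.
Qed.

Local Notation X := (lact (@mpolyC m V) L (fun i => 'X_i)).

Lemma coord_coordinates :
  monomial_coordinates D X coord_lin.
Proof.
split; [exact: coord_inj | exact: coord_nonface | | exact: coord_bound |].
  by move=> b v u; apply: coord_var.
exact: coord_exists.
Qed.

(** Every nonzero multidegree is contractible for the full simplex. Multidegree zero occurs only in
    the summand of [setT], so the sole obstruction is one constant coefficient. *)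
Lemma coord_exact_full j (f : {set 'I_m} -> L) : D = setT ->
  kcycle (yact (fun i => 'X_i) L) j f -> coord 0%MM (f setT) = 0 ->
  kbound (yact (fun i => 'X_i) L) j f.
Proof.
move=> DT /(kcycle_restr (@mpolyC m V)) cf f0; apply/(kbound_restr (@mpolyC m V)).
apply: (sel_acyclic coord_coordinates (sel := fun a => [pick i | a i != 0%N]) _ cf).
  by move=> a i; case: pickP => // u au [<-]; apply: stable_at1.
move=> a; case: pickP => // a0 _; apply: funext => F; rewrite /piece.
case: ifP => // /subsetP Fa.
have FT : F = setT.
  apply/setP => i; have := Fa i; rewrite !inE a0; case: (i \in F) => //.
  by move/(_ isT).
have -> : msub a F = 0%MM.
  apply/mnmP => i; rewrite mnmE mnm0E FT inE subn0.
  by apply/eqP; rewrite -[_ == _]negbK a0.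
by rewrite FT; apply: f0.
Qed.

(* multiplication by [x_0 - t] *)
Definition x0t : {linear N -> N} := ract (f := @mpolyC m V) (L := L) ('X_ord0 - t%:MP).

Lemma x0tE u : X ord0 u = x0t u + t *: u.
Proof.
rewrite /x0t /lact /= /ract -[t *: u]/(t%:MP *: (u : L)) scalerBl.
exact/esym/subrK.
Qed.

(** If [x_0 u = t u], then [t] times a coordinate is the coordinate with one less [x_0], or zero.
    Induction on the exponent of [x_0] concludes, as [t] is nonzero in a domain. *)
Lemma x0t_inj u : x0t u = 0 -> u = 0.
Proof.
move=> u0; apply: coord_inj => b; have [t0 _ _] := dvrP V.
have [k] := ubnP (b ord0); elim: k b => // k IH b; rewrite ltnS => bk.
have [bD|bD] := boolP (msupport b \in D); last exact: coord_nonface.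
have := congr1 (coord b) (x0tE u); rewrite u0 add0r linearZ /= coord_var //.
have -> : (if b ord0 == 0%N then 0 else coord (b - U_(ord0))%MM u) = 0.
  case: eqVneq => // b0; apply: IH; rewrite mnmBE mnm1E eqxx.
  by move: b0 bk; case: (b ord0) => // c _; rewrite subn1.
by move=> /esym/eqP; rewrite mulf_eq0 (negPf t0) => /eqP.
Qed.

End Coordinates.

Section Spans.
Context {A : comNzRingType}.

Lemma quotmod_pi_mem (M : lmodType A) (N : submodClosed M) x :
  quotmod_pi N x = 0 <-> x \in N.
Proof. by rewrite -quotmod_pi_eq0; split=> /eqP. Qed.

Lemma mem_span (M : lmodType A) (P : M -> Prop) x : P x -> x \in span_mod P.
Proof.
move=> Px; apply/asboolP; exists [:: (1, x)]; last by rewrite big_seq1 scale1r.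
by move=> u; rewrite inE => /eqP ->.
Qed.

Lemma span_family (m : nat) (y : 'I_m -> A) (P : A -> Prop) (a : A) :
    (forall f, P f <-> exists v, f = y v) ->
  a \in span_mod (P : A^o -> Prop) <-> exists c, a = \sum_v y v * c v.
Proof.
move=> Py; split=> [/asboolP[s sP ->]|[c ->]]; last first.
  have -> : \sum_v y v * c v = \sum_v c v *: (y v : A^o).
    by apply: eq_bigr => v _; rewrite mulrC.
  by apply: rpred_sum => v _; apply/rpredZ/mem_span/Py; exists v.
elim: s sP => [|u s IH] sP.
  by exists (fun=> 0); rewrite big_nil big1 // => v _; rewrite mulr0.
have [|c cE] := IH; first by move=> w ws; apply: sP; rewrite inE ws orbT.
have /Py[v uv] := sP u (mem_head _ _).
exists (fun w => c w + (w == v)%:R * u.1); rewrite big_cons cE uv.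
under [RHS]eq_bigr do rewrite mulrDr.
rewrite big_split addrC; congr (_ + _).
rewrite (bigD1 v) //= big1 ?addr0 => [|w /negPf ->]; last by rewrite mul0r mulr0.
by rewrite eqxx mul1r [RHS]mulrC.
Qed.

End Spans.

(** * Koszul exactness for the variables, and the substitution of [t] for [x_0] *)

Section PolynomialRing.
Variables (V : dvr) (n : nat).
Local Notation t := (unif V).
Local Notation m := n.+1.
Local Notation S := {mpoly V[m]}.
Local Notation R := {mpoly V[n]}.
Local Notation x := (fun i : 'I_m => 'X_i : S).

Lemma mpoly_closure k (P : {mpoly V[k]} -> Prop) :
    (forall c, P c%:MP) -> (forall i, P 'X_i) ->
    (forall p q, P p -> P q -> P (p + q)) ->
    (forall p q, P p -> P q -> P (p * q)) ->
  forall p, P p.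
Proof.
move=> PC PX PD PM; elim/mpolyind => [|c b p _ _ Pp]; first by rewrite -(mpolyC0 k V).
apply: PD Pp; rewrite -mul_mpolyC; apply: (PM) => //; rewrite mpolyXE_id.
elim/big_rec: _ => [|i q _ Pq]; first by rewrite -(mpolyC1 k V).
apply: (PM) Pq; elim: (b i) => [|e IH]; first by rewrite expr0 -(mpolyC1 k V).
by rewrite exprS; apply: PM.
Qed.

Section Exactness.

Definition idS : {linear S^o -> S^o} := idfun.

Lemma idS_surj u : exists p, idS p = u. Proof. by exists u. Qed.

Lemma idS_ker (p : S) : idS p = 0 <->
  forall b, msupport b \in [set: {set 'I_m}] -> p@_b = 0.
Proof.
split=> [/= -> b _|h]; first by rewrite mcoeff0.
by apply/mpolyP => b; rewrite mcoeff0; apply: h; rewrite inE.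
Qed.

Lemma simplicial_setT : simplicial [set: {set 'I_m}]. Proof. by move=> F G; rewrite !inE. Qed.

Lemma kosX_exact_coeff0 j f : kcycle (yact x S^o) j f -> (f setT : S)@_0%MM = 0 ->
  kbound (yact x S^o) j f.
Proof.
move=> cf f0.
have c0 : @coord V n [set: {set 'I_m}] S^o idS idS_surj 0%MM (f setT) = 0.
  by have := coord_pi idS_surj idS_ker 0%MM (f setT); rewrite f0 if_same.
exact: (@coord_exact_full V n [set: {set 'I_m}] simplicial_setT S^o idS idS_surj idS_ker
  j f (erefl _) cf c0).
Qed.

Lemma kosX_exact j f : j != m%:Z ->
  kcycle (yact x S^o) j f -> kbound (yact x S^o) j f.
Proof.
move=> jm cf; apply: (kosX_exact_coeff0 cf).
by rewrite cf.1 ?mcoeff0 // cardsT card_ord eq_sym.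
Qed.

Lemma kbound_coeff0 j f : kbound (yact x S^o) j f -> (f setT : S)@_0%MM = 0.
Proof.
case=> g _ ->; rewrite /kos raddf_sum big1 // => v _.
have e : ((yact x S^o v (g ([set: 'I_m] :\ v))) : S)@_0%MM = 0.
  by have := mcoeffXUM v 0%MM (g ([set: 'I_m] :\ v) : S); rewrite mnm0E.
have sg0 b (c : S^o) : (c : S)@_0%MM = 0 -> (sg b c : S)@_0%MM = 0.
  by case: b => //= c0; rewrite mcoeffN c0 oppr0.
exact: sg0.
Qed.

(** The constant coefficient detects the top cohomology, which therefore has no [t]-torsion. *)
Lemma kosX_exact_top f : kcycle (yact x S^o) m%:Z f ->
  kbound (yact x S^o) m%:Z (t%:MP *: f) -> kbound (yact x S^o) m%:Z f.
Proof.
move=> cf /kbound_coeff0 tf0; apply: (kosX_exact_coeff0 cf).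
have [t0 _ _] := dvrP V.
have : t * (f setT : S)@_0%MM = 0 by rewrite -mcoeffCM.
by move=> /eqP; rewrite mulf_eq0 (negPf t0) => /eqP.
Qed.

End Exactness.

Section Specialization.

Definition ev : S -> R := comp_mpoly [tuple (subst_x0 V i : R) | i < m].

HB.instance Definition _ := GRing.RMorphism.on ev.

Lemma evX i : ev 'X_i = subst_x0 V i.
Proof. by rewrite /ev comp_mpolyXU -tnth_nth tnth_mktuple. Qed.

Lemma evC c : ev c%:MP = c%:MP.
Proof. exact: comp_mpolyC. Qed.

Lemma ev_x0t : ev ('X_ord0 - t%:MP) = 0.
Proof. by rewrite rmorphB /= evX evC /subst_x0 unlift_none subrr. Qed.

(* a section of [ev] *)
Definition unev : R -> S := comp_mpoly [tuple ('X_(fintype.lift ord0 j) : S) | j < n].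

HB.instance Definition _ := GRing.RMorphism.on unev.

Lemma unevX j : unev 'X_j = 'X_(fintype.lift ord0 j).
Proof. by rewrite /unev comp_mpolyXU -tnth_nth tnth_mktuple. Qed.

Lemma unevC c : unev c%:MP = c%:MP.
Proof. exact: comp_mpolyC. Qed.

Lemma unevK : cancel unev ev.
Proof.
apply: mpoly_closure => [c|j|p q pE qE|p q pE qE].
- by rewrite unevC evC.
- by rewrite unevX evX /subst_x0 liftK.
- by rewrite !rmorphD /= pE qE.
- by rewrite !rmorphM /= pE qE.
Qed.

(** The ring morphism [unev \o ev] agrees with the identity modulo [x_0 - t] on constants and
    variables, hence everywhere. *)
Lemma unev_ev p : exists q, p - unev (ev p) = ('X_ord0 - t%:MP) * q.
Proof.
elim/mpoly_closure: p => [c|i|p q [p' pE] [q' qE]|p q [p' pE] [q' qE]].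
- by exists 0; rewrite evC unevC subrr mulr0.
- rewrite evX /subst_x0; case: unliftP => [j ->|->].
    by exists 0; rewrite unevX subrr mulr0.
  by exists 1; rewrite unevC mulr1.
- exists (p' + q'); rewrite mulrDr -pE -qE !rmorphD /=.
  by rewrite opprD addrACA.
- exists (p' * q + unev (ev p) * q'); rewrite mulrDr mulrA -pE mulrCA -qE.
  by rewrite !rmorphM /= mulrBl mulrBr addrA subrK.
Qed.

Lemma ev_ker p : ev p = 0 <-> exists q, p = ('X_ord0 - t%:MP) * q.
Proof.
split=> [p0|[q ->]]; last by rewrite rmorphM /= ev_x0t mul0r.
by have [q] := unev_ev p; rewrite p0 rmorph0 subr0 => ->; exists q.
Qed.

End Specialization.

Section StanleyReisnerKernel.
Variable D : {set {set 'I_m}}.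
Hypothesis hD : simplicial D.

Lemma prodX (F : {set 'I_m}) : \prod_(i in F) 'X_i = 'X_[mind F] :> S.
Proof.
rewrite mpolyXE_id [LHS]big_mkcond; apply: eq_bigr => i _; rewrite mnmE.
by case: (i \in F); rewrite ?expr0 ?expr1.
Qed.

Definition SRpi : {linear S^o -> SR V D} :=
  quotmod_pi (span_mod (nonface_monomial D x : S^o -> Prop)).

Lemma SRpi_surj u : exists p, SRpi p = u.
Proof. by exists (quotmod_repr u); apply: quotmod_reprK. Qed.

Lemma SRpi_span (p : S) : SRpi p = 0 <->
  p \in span_mod (nonface_monomial D x : S^o -> Prop).
Proof. exact: quotmod_pi_mem. Qed.

(** The ideal is spanned over [V] by the monomials whose support is not a face: such a monomial is
    divisible by the squarefree one on its support, and multiples of nonface monomials keep a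
    nonface support. *)
Lemma SRpi_ker (p : S) : SRpi p = 0 <->
  forall b, msupport b \in D -> p@_b = 0.
Proof.
rewrite SRpi_span; split=> [/asboolP[s sP ->] b bD|p0].
  rewrite raddf_sum big_seq big1 // => u /sP[F FD ->] /=.
  have -> : u.1 *: (\prod_(i in F) 'X_i : S^o) = 'X_[mind F] * u.1.
    by rewrite prodX mulrC.
  rewrite mcoeffXM; case: ifP => // /mnm_lepP Fb.
  case/negP: FD; apply: (hD bD); apply/subsetP => i iF.
  by rewrite inE -lt0n; have := Fb i; rewrite mnmE iF.
rewrite [p]mpolyE; apply: (big_ind (fun q : S => q \in span_mod (nonface_monomial D x : S^o -> Prop))).
- exact: rpred0.
- by move=> q r; apply: rpredD.
move=> b _; have [bD|bD] := boolP (msupport b \in D).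
  by rewrite p0 // scale0r; apply: rpred0.
have -> : p@_b *: 'X_[b]
    = (p@_b *: 'X_[b - mind (msupport b)] : S) *: (\prod_(i in msupport b) 'X_i : S^o).
  rewrite prodX -[RHS]/((p@_b *: 'X_[b - mind (msupport b)] : S) * 'X_[mind (msupport b)]).
  rewrite -scalerAl -mpolyXD submK //; apply/mnm_lepP => i.
  by rewrite mnmE inE; case: (b i).
by apply/rpredZ/mem_span; exists (msupport b).
Qed.

Definition tSRpi : {linear R^o -> tSR V D} :=
  quotmod_pi (span_mod (nonface_monomial D (@subst_x0 V n) : R^o -> Prop)).

Lemma tSRpi_surj u : exists p, tSRpi p = u.
Proof. by exists (quotmod_repr u); apply: quotmod_reprK. Qed.

Lemma ev_monomial (F : {set 'I_m}) :
  ev (\prod_(i in F) 'X_i) = \prod_(i in F) subst_x0 V i.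
Proof. by rewrite rmorph_prod; apply: eq_bigr => i _; apply: evX. Qed.

(** The kernel of the composite from [V[x_0, ..., x_n]] to the [t]-Stanley-Reisner ring is the
    Stanley-Reisner ideal plus the multiples of [x_0 - t]. *)
Lemma tSRpi_ker (p : S) :
  tSRpi (ev p) = 0 <-> exists q, SRpi (p - ('X_ord0 - t%:MP) * q) = 0.
Proof.
have spanE (r : R) : tSRpi r = 0 <->
    r \in span_mod (nonface_monomial D (@subst_x0 V n) : R^o -> Prop).
  exact: quotmod_pi_mem.
rewrite spanE; split=> [/asboolP[s sP evE]|[q /SRpi_span/asboolP[s sP pE]]].
  (* Lift the combination of generators to the Stanley-Reisner ideal, its coefficients through the
     section [unev]. *)
  have [w wI wE] : exists2 w : S, SRpi w = 0 & ev w = \sum_(u <- s) u.1 *: u.2.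
    elim: s sP {evE} => [|u s IH] sP.
      by exists 0; rewrite ?linear0 // big_nil rmorph0.
    have [|w wI wE] := IH; first by move=> w ws; apply: sP; rewrite inE ws orbT.
    have [F FD uF] := sP u (mem_head _ _).
    exists (unev u.1 * \prod_(i in F) 'X_i + w).
      have gI : SRpi (\prod_(i in F) 'X_i) = 0.
        by apply/SRpi_span/mem_span; exists F.
      have := linearP SRpi (unev u.1) (\prod_(i in F) 'X_i : S^o) w.
      by rewrite gI wI scaler0 addr0.
    by rewrite big_cons rmorphD rmorphM /= ev_monomial unevK wE uF.
  have /ev_ker[q qE] : ev (p - w) = 0 by rewrite rmorphB /= evE wE subrr.
  by exists q; rewrite -qE subKr.
have -> : ev p = ev (p - ('X_ord0 - t%:MP) * q).
  by rewrite rmorphB rmorphM /= ev_x0t mul0r subr0.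
rewrite pE rmorph_sum big_seq; apply: rpred_sum => u /sP[F FD uF].
have uE : ev (u.1 *: u.2) = ev u.1 *: (\prod_(i in F) subst_x0 V i : R^o).
  by rewrite -ev_monomial uF; apply: (rmorphM ev).
have : ev u.1 *: (\prod_(i in F) subst_x0 V i : R^o)
    \in span_mod (nonface_monomial D (@subst_x0 V n) : R^o -> Prop).
  by apply: rpredZ; apply: mem_span; exists F.
by rewrite -uE.
Qed.

End StanleyReisnerKernel.

End PolynomialRing.

(** * Specialization of the variable x_0 *)

Section Specialization.
Variables (V : dvr) (n : nat) (D : {set {set 'I_n.+1}}).
Local Notation t := (unif V).
Local Notation m := n.+1.
Local Notation S := {mpoly V[m]}.
Local Notation R := {mpoly V[n]}.
Hypothesis hD : simplicial D.
Variables (L : lmodType S) (pi : {linear S^o -> L}).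
Hypothesis pi_surj : forall u, exists p, pi p = u.
Hypothesis pi_ker : forall p : S,
  pi p = 0 <-> forall b, msupport b \in D -> p@_b = 0.
Variables (L' : lmodType R) (pi' : {linear R^o -> L'}).
Hypothesis pi'_surj : forall u, exists p, pi' p = u.
Hypothesis ker_ev : forall p : S,
  pi' (ev p) = 0 <-> exists q, pi (p - ('X_ord0 - t%:MP) * q) = 0.

Local Notation N := (restr (@mpolyC m V) L).
Local Notation N' := (restr (@mpolyC n V) L').
Local Notation X := (lact (@mpolyC m V) L (fun i => 'X_i)).
Local Notation X' := (lact (@mpolyC n V) L' (@subst_x0 V n)).
Local Notation C := ({set 'I_m} -> N).
Local Notation C' := ({set 'I_m} -> N').
Local Notation phi := (pointwise (x0t (V := V) (n := n) L)).

Definition spec (u : N) : N' := pi' (ev (lifting pi_surj u)).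

Lemma spec_pi (p : S) : spec (pi p) = pi' (ev p).
Proof.
apply/eqP; rewrite -subr_eq0 /spec.
have e : pi' (ev (lifting pi_surj (pi p) - p)) = 0.
  by apply/ker_ev; exists 0; rewrite mulr0 subr0 linearB liftingK subrr.
by rewrite -[X in X == _](linearB pi') -rmorphB e.
Qed.

Lemma pi'M (p q : R) : pi' (p * q) = p *: pi' q.
Proof. by rewrite -[p * q]/(p *: (q : R^o)) linearZ. Qed.

Fact spec_linear : linear spec.
Proof.
move=> a u v; rewrite -[u in LHS](liftingK pi_surj) -[v in LHS](liftingK pi_surj).
rewrite -[X in spec X]/(a%:MP *: pi (lifting pi_surj u) + pi (lifting pi_surj v)).
rewrite -piM -linearD spec_pi rmorphD rmorphM /= evC linearD pi'M.
by [].
Qed.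

HB.instance Definition _ := GRing.isLinear.Build V N N' *:%R spec spec_linear.

Lemma spec_surj u : exists v, spec v = u.
Proof.
have [r <-] := pi'_surj u; exists (pi (unev r)).
by rewrite spec_pi unevK.
Qed.

Lemma spec_act v u : spec (X v u) = X' v (spec u).
Proof.
rewrite -(liftingK pi_surj u) /lact /= /ract -piM !spec_pi rmorphM /= evX pi'M.
by [].
Qed.

Lemma spec_ker u : spec u = 0 <-> exists w, u = x0t (V := V) (n := n) L w.
Proof.
split=> [/ker_ev[q /eqP]|[w ->]].
  rewrite linearB liftingK subr_eq0 => /eqP ->; exists (pi q).
  by rewrite /x0t /= /ract -piM.
rewrite -(liftingK pi_surj w) /x0t /= /ract -piM spec_pi.
by rewrite rmorphM /= ev_x0t mul0r linear0.
Qed.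

Let sp (f : C) : C' := pointwise spec f.

Let sp_kos f : kos X' (sp f) = sp (kos X f).
Proof.
apply: funext => F; rewrite /sp /pointwise /kos linear_sum; apply: eq_bigr => v _.
by rewrite linear_sg -spec_act.
Qed.

Let sp_kdeg j f : kdeg j f -> kdeg j (sp f).
Proof. by move=> hf F Fj; rewrite /sp /pointwise hf // linear0. Qed.

Let sp_lift j (f' : C') : kdeg j f' -> exists2 f : C, kdeg j f & sp f = f'.
Proof.
move=> hf; have /choice[g gP] := spec_surj.
exists (fun F : {set 'I_m} => if #|F|%:Z == j then g (f' F) else 0).
  by move=> F /negPf ->.
apply: funext => F; rewrite /sp /pointwise; case: ifPn => Fj; first exact: gP.
by rewrite linear0 hf.
Qed.

Let sp_ker f : sp f = 0 <-> exists b, f = phi b.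
Proof.
split=> [f0|[b ->]]; last first.
  by apply: funext => F; apply/spec_ker; exists (b F).
have /choice[b bP] F : exists w, f F = x0t (V := V) (n := n) L w.
  by apply/spec_ker; have := congr1 (fun h => h F) f0.
by exists b; apply: funext.
Qed.

Let spD f g : sp (f + g) = sp f + sp g. Proof. exact: linearD. Qed.

Let spB f g : sp (f - g) = sp f - sp g. Proof. exact: linearB. Qed.

Local Notation Zq := (@qcyc V C (fun j f => kdeg j f) (kos X) phi).
Local Notation Bq := (@qbnd V C (fun j f => kdeg j f) (kos X) phi).

Lemma spec_cycle j f : Zq j f -> kcycle X' j (sp f).
Proof.
case=> hf [b fb]; split; first exact: sp_kdeg.
by rewrite sp_kos fb; apply/sp_ker; exists b.
Qed.

Lemma spec_bound j f : kbound X' j (sp f) <-> Bq j f.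
Proof.
split=> [[g' hg' fg]|[g [e [hg ->]]]]; last first.
  exists (sp g); first exact: sp_kdeg.
  have e0 : sp (phi e) = 0 by apply/sp_ker; exists e.
  by rewrite sp_kos spD e0 addr0.
have [g hg gg'] := sp_lift hg'.
have /sp_ker[e fe] : sp (f - kos X g) = 0.
  by rewrite spB -sp_kos gg' fg subrr.
have fE : f = kos X g + phi e by rewrite -fe addrC subrK.
by exists g, e; split; [| exact: fE].
Qed.

Lemma spec_cycle_surj j f' : kcycle X' j f' -> exists2 f, Zq j f & sp f = f'.
Proof.
case=> hf' cf'; have [f hf ff'] := sp_lift hf'; exists f => //.
by split=> //; apply/sp_ker; rewrite -sp_kos ff'.
Qed.

Lemma pres_spec (Y : lmodType V) j :
  pres Y (kcycle X' j) (kbound X' j) -> pres Y (Zq j) (Bq j).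
Proof.
apply: (pres_back (phi := sp)).
- by move=> a f g; rewrite /sp linearP.
- by move=> a f g; apply: kcycle_lin.
- exact: spec_cycle.
- by move=> f _; apply: spec_bound.
move=> f' /spec_cycle_surj[f Zf <-]; exists f => //.
by rewrite subrr; exists 0; [ | rewrite linear0].
Qed.

Let kdeg_closed j : closed_lin (fun f : C => kdeg j f).
Proof. by split=> // a f g; apply: kdeg_lin. Qed.

Let kdeg_phi j (f : C) : kdeg j (phi f) <-> kdeg j f.
Proof.
split=> hf F Fj; last by rewrite /pointwise hf // linear0.
by apply: (x0t_inj hD pi_surj pi_ker); apply: hf Fj.
Qed.

Let phi_inj (f : C) : phi f = 0 -> f = 0.
Proof.
move=> f0; apply: funext => F; apply: (x0t_inj hD pi_surj pi_ker).
by have /(congr1 (fun h => h F)) := f0.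
Qed.

Let x0t_act v u : x0t (V := V) (n := n) L (X v u) = X v (x0t (V := V) (n := n) L u).
Proof. by rewrite /x0t /lact /= /ract !scalerA mulrC. Qed.

Let kos_phi (f : C) : kos X (phi f) = phi (kos X f).
Proof.
apply: funext => F; rewrite /pointwise /kos linear_sum; apply: eq_bigr => v _.
by rewrite linear_sg x0t_act.
Qed.

Let contr_phi i (f : C) : contr i (phi f) = phi (contr i f).
Proof.
apply: funext => F; rewrite /pointwise /contr; case: ifP => _; first by rewrite linear0.
by rewrite linear_sg.
Qed.

Let kos_contr0 (f : C) :
  kos X (contr ord0 f) + contr ord0 (kos X f) = phi f + t *: f.
Proof. by rewrite kos_contr; apply: funext => F; rewrite /= x0tE. Qed.

Let XC u v w : X u (X v w) = X v (X u w).
Proof. by rewrite /lact /= /ract !scalerA mulrC. Qed.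

Let kdeg_kosX j (f : C) : kdeg j f -> kdeg (j + 1) (kos X f).
Proof. exact: kdeg_kos. Qed.

Lemma spec_killed j f : Zq j f -> Bq j (t *: f).
Proof.
apply: (qcyc_killed (s := contr ord0)).
- by move=> k g; apply: kdeg_contr.
- exact: contr_phi.
- exact: kos_contr0.
Qed.

Theorem spec_reduction j p q :
  qdim (fun f : C => kcycle X j f) (mod_rel (fun f : C => kcycle X j f) (kbound X j)) p ->
  qdim (ann_rel (fun f : C => kcycle X (j + 1) f) (kbound X (j + 1)))
    (kbound X (j + 1)) q ->
  qdim (Zq j) (Bq j) (p + q).
Proof.
apply: (qdim_reduction (s := contr ord0)).
- exact: kdeg_closed.
- exact: kdeg_kosX.
- by move=> k f; apply: kdeg_contr.
- exact: kdeg_phi.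
- by move=> f; apply: kos_kos.
- exact: phi_inj.
- exact: kos_phi.
- exact: contr_phi.
- exact: kos_contr0.
Qed.

(** The only delicate degree is the one below the top: the annihilator of [t] is then taken in the
    nonzero top cohomology, where the second hypothesis excludes torsion. *)
Theorem spec_exact :
    (forall j f, j != m%:Z ->
      kcycle (yact (fun i => 'X_i) L) j f -> kbound (yact (fun i => 'X_i) L) j f) ->
    (forall f, kcycle (yact (fun i => 'X_i) L) m%:Z f ->
      kbound (yact (fun i => 'X_i) L) m%:Z (t%:MP *: f) ->
      kbound (yact (fun i => 'X_i) L) m%:Z f) ->
  forall j f, j != m%:Z ->
    kcycle (yact (@subst_x0 V n) L') j f -> kbound (yact (@subst_x0 V n) L') j f.
Proof.
move=> exact_ top j f' jm /(kcycle_restr (@mpolyC n V)) cf'.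
apply/(kbound_restr (@mpolyC n V)).
have [f Zf <-] := spec_cycle_surj cf'; apply/spec_bound.
have kb k (g : C) : k != m%:Z -> kcycle X k g -> kbound X k g.
  by move=> km /(kcycle_restr (@mpolyC m V)) cg; apply/(kbound_restr (@mpolyC m V))/exact_.
(* Dimension zero is full exactness here: spanning by the empty family puts every cocycle in
   [Bq j]. *)
have [z [_ span _]] : qdim (Zq j) (Bq j) (0 + 0).
  apply: spec_reduction; apply: qdim0 => g.
    move=> cg; exists 0; last by rewrite scaler0 subr0; apply: kb.
    by split=> //; rewrite linear0.
  case=> cg tg; have [km|] := eqVneq (j + 1) m%:Z; last by move=> km; apply: kb.
  rewrite km in cg tg *; apply/(kbound_restr (@mpolyC m V))/top => //.
by have [a] := span f Zf; rewrite big_ord0 subr0.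
Qed.

End Specialization.

(** * Cochain presentations of the four Tor and Ext modules *)

Section Presentations.
Variables (V : dvr) (n : nat) (D : {set {set 'I_n.+1}}).
Hypothesis hD : simplicial D.
Local Notation t := (unif V).
Local Notation m := n.+1.
Local Notation S := {mpoly V[m]}.
Local Notation R := {mpoly V[n]}.
Local Notation x := (fun i : 'I_m => 'X_i : S).
Local Notation y := (@subst_x0 V n).

Lemma ev_ker_id (p : S) : (idfun : {linear R^o -> R^o}) (ev p) = 0 <->
  exists q, idS V n (p - ('X_ord0 - t%:MP) * q) = 0.
Proof.
split=> [/ev_ker[q ->]|[q /eqP]]; first by exists q; rewrite subrr.
by rewrite subr_eq0 => /eqP ->; apply/ev_ker; exists q.
Qed.

Lemma idR_surj (u : R^o) : exists p, (idfun : {linear R^o -> R^o}) p = u.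
Proof. by exists u. Qed.

Lemma kosY_exact j f : j != m%:Z ->
  kcycle (yact y R^o) j f -> kbound (yact y R^o) j f.
Proof.
exact: (@spec_exact V n setT (@simplicial_setT n) S^o (idS V n) (@idS_surj V n)
  (@idS_ker V n) R^o idfun idR_surj ev_ker_id (@kosX_exact V n) (@kosX_exact_top V n) j f).
Qed.

Definition Vpi : {linear S^o -> V_mod V n} :=
  quotmod_pi (span_mod ((fun f => exists i, f = 'X_i) : S^o -> Prop)).

Lemma Vpi_surj u : exists a, Vpi a = u.
Proof. by exists (quotmod_repr u); apply: quotmod_reprK. Qed.

Lemma Vpi_ker (a : S) : Vpi a = 0 <-> exists c, a = \sum_v x v * c v.
Proof. by rewrite quotmod_pi_mem; apply: span_family. Qed.

Definition Kpi : {linear R^o -> K_mod V n} :=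
  quotmod_pi (span_mod ((fun f => f = t%:MP \/ exists i, f = 'X_i) : R^o -> Prop)).

Lemma Kpi_surj u : exists a, Kpi a = u.
Proof. by exists (quotmod_repr u); apply: quotmod_reprK. Qed.

Lemma Kpi_ker (a : R) : Kpi a = 0 <-> exists c, a = \sum_v y v * c v.
Proof.
rewrite quotmod_pi_mem; apply: span_family => f; split.
  case=> [->|[j ->]]; first by exists ord0; rewrite /subst_x0 unlift_none.
  by exists (fintype.lift ord0 j); rewrite /subst_x0 liftK.
case=> v ->; rewrite /subst_x0; case: unliftP => [j _|_]; last by left.
by right; exists j.
Qed.

Local Notation X := (lact (@mpolyC m V) (SR V D) x).
Local Notation Y := (lact (@mpolyC n V) (tSR V D) y).

Lemma ExtV_pres j : pres (ExtV V j D) (kcycle X j%:Z) (kbound X j%:Z).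
Proof.
exact: (pres_restr (@mpolyC m V)
  (Ext_koszul Vpi_surj Vpi_ker (@kosX_exact V n) (SR V D) j)).
Qed.

Lemma TorV_pres (i : nat) :
  pres (TorV V i%:Z D) (kcycle X (m%:Z - i%:Z)) (kbound X (m%:Z - i%:Z)).
Proof.
exact: (pres_restr (@mpolyC m V)
  (Tor_koszul Vpi_surj Vpi_ker (@kosX_exact V n) (SR V D) i)).
Qed.

(** For [i = 0] both sides are zero: [Tor] in degree [-1] is the zero module, and no set has more
    than [m] vertices. *)
Lemma TorV_pred_pres (i : nat) : pres (TorV V (i%:Z - 1) D)
  (kcycle X (m%:Z - i%:Z + 1)) (kbound X (m%:Z - i%:Z + 1)).
Proof.
case: i => [|i].
  have X0 (u : 'rV[S]_0) : u = 0 by apply/rowP => -[].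
  exists (fun=> 0); split=> [a u v _ _||z [hz cz]].
  - by rewrite scaler0 addr0.
  - move=> u; exists 0; last exact/esym/X0.
    by split=> //; apply: linear0.
  - have -> : z = 0 by apply: kdeg_gt hz; lia.
    by split=> // _; exists 0; rewrite ?linear0.
have -> : i.+1%:Z - 1 = i%:Z by lia.
have -> : m%:Z - i.+1%:Z + 1 = m%:Z - i%:Z by lia.
exact: TorV_pres.
Qed.

Local Notation phi := (pointwise (x0t (V := V) (n := n) (SR V D))).
Local Notation C := ({set 'I_m} -> restr (@mpolyC m V) (SR V D)).
Local Notation Zq := (@qcyc V C (fun j f => kdeg j f) (kos X) phi).
Local Notation Bq := (@qbnd V C (fun j f => kdeg j f) (kos X) phi).

Lemma ExtK_pres j : pres (ExtK V j D) (Zq j%:Z) (Bq j%:Z).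
Proof.
apply: (pres_spec (@SRpi_surj V n D) (tSRpi_surj (D := D)) (@tSRpi_ker V n D)).
exact: (pres_restr (@mpolyC n V)
  (Ext_koszul Kpi_surj Kpi_ker kosY_exact (tSR V D) j)).
Qed.

Lemma TorK_pres (i : nat) :
  pres (TorK V i%:Z D) (Zq (m%:Z - i%:Z)) (Bq (m%:Z - i%:Z)).
Proof.
apply: (pres_spec (@SRpi_surj V n D) (tSRpi_surj (D := D)) (@tSRpi_ker V n D)).
exact: (pres_restr (@mpolyC n V)
  (Tor_koszul Kpi_surj Kpi_ker kosY_exact (tSR V D) i)).
Qed.

End Presentations.

(** * Dimension counts *)

Section CohomologyDimensions.
Variables (V : dvr) (m : nat) (D : {set {set 'I_m}}).
Local Notation t := (unif V).

Definition cocyc q (f : cochain V m) := f \in cocycle_pred D q.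
Definition cobnd q (f : cochain V m) := f \in cobound_pred D q.

Lemma cocyc_closed q : closed_lin (cocyc q).
Proof. exact: cocycle_submod. Qed.

Lemma cobnd_closed q : closed_lin (cobnd q).
Proof. exact: cobound_submod. Qed.

Lemma rcohomology_pres q : pres (rcohomology V D q) (cocyc q) (cobnd q).
Proof. exact: pres_subquot. Qed.

Definition cochain_eval (F : {set 'I_m}) (f : cochain V m) : V^o := f F.

Fact cochain_eval_linear F : linear (cochain_eval F).
Proof. by move=> a f g; rewrite /cochain_eval !ffunE. Qed.

HB.instance Definition _ F := GRing.isLinear.Build V (cochain V m) V^o *:%R
  (cochain_eval F) (cochain_eval_linear F).

Lemma cochain_qdim (Z B : cochain V m -> Prop) : closed_lin Z -> closed_lin B ->
  (forall f, Z f -> B (t *: f)) -> exists d, qdim Z B d.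
Proof.
move=> cZ cB tB.
have [|k [z [Zz zP]]] := @fg_coords V (cochain V m) (size (enum {set 'I_m}))
    (fun i => cochain_eval (nth set0 (enum {set 'I_m}) i)) Z cZ.
  move=> f _ f0; apply/ffunP => F; rewrite ffunE.
  have := f0 (index F (enum {set 'I_m})); rewrite index_mem mem_enum => /(_ isT).
  by rewrite /= nth_index // mem_enum.
apply: (qdim_exists (z := z)) => // f /zP[a ->]; exists a.
by rewrite subrr; apply: cB.1.
Qed.

Lemma cocyc_lt q f : q < -1 -> cocyc q f -> f = 0.
Proof.
move=> q1 /andP[/forallP fq _]; apply/ffunP => F; rewrite ffunE.
apply/eqP; have := fq F; apply: contraTT => ->; rewrite /= negb_and.
by apply/orP; right; apply: contraTneq q1; lia.
Qed.

(** The clause for [q < -1] lets sums over all [T] be cut down later to the range of Hochster's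
    formula. *)
Lemma cohomology_mod_dim q : exists d,
  qdim (cocyc q) (mod_rel (cocyc q) (cobnd q)) d /\ (q < -1 -> d = 0%N).
Proof.
have [q1|q1] := boolP (q < -1).
  exists 0%N; split=> //; apply: qdim0 => f /(cocyc_lt q1) ->.
  exact: (mod_rel_closed (cocyc_closed q) (cobnd_closed q)).1.
have [| | |d dP] := @cochain_qdim (cocyc q) (mod_rel (cocyc q) (cobnd q)).
- exact: cocyc_closed.
- by apply: mod_rel_closed; [apply: cocyc_closed | apply: cobnd_closed].
- by move=> f Zf; exists f => //; rewrite subrr; apply: (cobnd_closed q).1.
by exists d.
Qed.

Lemma cohomology_ann_dim q : exists d,
  qdim (ann_rel (cocyc q) (cobnd q)) (cobnd q) d /\ (q < -1 -> d = 0%N).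
Proof.
have [q1|q1] := boolP (q < -1).
  exists 0%N; split=> //; apply: qdim0 => f [/(cocyc_lt q1) -> _].
  exact: (cobnd_closed q).1.
have [| | |d dP] := @cochain_qdim (ann_rel (cocyc q) (cobnd q)) (cobnd q).
- by apply: ann_rel_closed; [apply: cocyc_closed | apply: cobnd_closed].
- exact: cobnd_closed.
- by move=> f [].
by exists d.
Qed.

End CohomologyDimensions.

(** * Hochster's formula for dimensions *)

Section HochsterDimensions.
Variables (V : dvr) (n : nat) (D : {set {set 'I_n.+1}}).
Hypothesis hD : simplicial D.
Local Notation t := (unif V).
Local Notation m := n.+1.
Local Notation S := {mpoly V[m]}.
Local Notation x := (fun i : 'I_m => 'X_i : S).
Local Notation X := (lact (@mpolyC m V) (SR V D) x).
Local Notation N := (restr (@mpolyC m V) (SR V D)).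
Local Notation C := ({set 'I_m} -> N).
Variables (r a : int -> {set 'I_m} -> nat).
Hypothesis rP : forall q T,
  qdim (@cocyc V m (deletion D T) q)
    (mod_rel (@cocyc V m (deletion D T) q) (@cobnd V m (deletion D T) q)) (r q T).
Hypothesis aP : forall q T,
  qdim (ann_rel (@cocyc V m (deletion D T) q) (@cobnd V m (deletion D T) q))
    (@cobnd V m (deletion D T) q) (a q T).

Let mc := coord_coordinates hD (@SRpi_surj V n D) (@SRpi_ker V n D hD).
Let cf := coord_lin (@SRpi_surj V n D) (@SRpi_ker V n D hD).
Let hoch : {linear C -> ({set 'I_m} -> cochain V m)} :=
  hochster_fun cf.

Let Zp j (g : {set 'I_m} -> cochain V m) :=
  forall T, @cocyc V m (deletion D T) (j - 1 - #|T|%:Z) (g T).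
Let Bp j (g : {set 'I_m} -> cochain V m) :=
  forall T, @cobnd V m (deletion D T) (j - 1 - #|T|%:Z) (g T).

Let Zp_closed j : closed_lin (Zp j).
Proof.
split=> [T|c f g Zf Zg T]; first exact: (@cocyc_closed V m _ _).1.
exact: (@cocyc_closed V m _ _).2.
Qed.

Let Bp_closed j : closed_lin (Bp j).
Proof.
split=> [T|c f g Zf Zg T]; first exact: (@cobnd_closed V m _ _).1.
exact: (@cobnd_closed V m _ _).2.
Qed.

Let kcycle_closed j : closed_lin (fun f : C => kcycle X j f).
Proof.
split; first by split=> //; apply: linear0.
by move=> c f g; apply: kcycle_lin.
Qed.

Let kbound_closed j : closed_lin (fun f : C => kbound X j f).
Proof.
split; first by exists 0 => //; rewrite linear0.
by move=> c f g; apply: kbound_lin.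
Qed.

Let hoch_cycle j (f : C) : kcycle X j f -> Zp j (hoch f).
Proof.
move=> [hf df] T; apply/andP; split; first exact: (hochster_cochain mc T hf).
by rewrite (hochster_cobd mc) df linear0.
Qed.

Let hoch_bound j (f : C) : kcycle X j f -> kbound X j f -> Bp j (hoch f).
Proof.
move=> _ [g hg ->] T; apply/asboolP; exists (hoch g T).
  have := hochster_cochain mc T hg.
  by have -> : j - 1 - 1 - #|T|%:Z = j - 1 - #|T|%:Z - 1 by rewrite addrAC.
by rewrite (hochster_cobd mc).
Qed.

Let hoch_bound_inv j (f : C) : kcycle X j f -> Bp j (hoch f) -> kbound X j f.
Proof.
move=> Zf Bf.
have /choice[h hP] T : exists g, g \in cochain_pred (deletion D T) (j - 1 - 1 - #|T|%:Z)
    /\ hoch f T = cobd (deletion D T) g.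
  have /asboolP[g gq gE] := Bf T; exists g; split=> //.
  by have -> : j - 1 - 1 - #|T|%:Z = j - 1 - #|T|%:Z - 1 by rewrite addrAC.
(* The bounding cochains of all the deletions come from a single [g]; then [f - kos X g] has no
   squarefree part and is a coboundary. *)
have [g [hg gh _]] := hochster_surj mc (fun T => (hP T).1).
have cg : kbound X j (kos X g) by exists g.
have [||u hu uE] := @hochster_exact _ _ _ _ _ _ mc (f - kos X g) j.
- rewrite addrC -scaleN1r; apply: kcycle_lin Zf; apply: kbound_cycle cg.
  by move=> u v w; rewrite /lact /= /ract !scalerA mulrC.
- move=> T.
  have hT : hoch (f - kos X g) T = hoch f T - hoch (kos X g) T by rewrite linearB.
  have kT : hoch (kos X g) T = cobd (deletion D T) (hoch g T).
    exact: esym (hochster_cobd mc g T).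
  have gT : hoch g T = h T by rewrite -gh.
  by rewrite [LHS]hT kT gT -(hP T).2 subrr.
exists (u + g); last first.
  have -> : kos X (u + g) = kos X u + kos X g by apply: linearD.
  have -> : kos X u = f - kos X g by [].
  by rewrite subrK.
by rewrite -[u]scale1r; apply: kdeg_lin.
Qed.

Let hoch_surj j g : Zp j g -> exists2 f : C, kcycle X j f & Bp j (g - hoch f).
Proof.
move=> Zg; have hg T := (andP (Zg T)).1.
have [f [hf fg f0]] := hochster_surj mc hg.
exists f; last first.
  have -> : hoch f = g by [].
  by rewrite subrr; apply: (Bp_closed j).1.
(* The cocycle condition is checked in each multidegree: [f] vanishes in the non-squarefree ones,
   and in the others it is the condition on [g]. *)
split=> //; apply: (piece_eq0 mc) => b; apply: funext => F.
have [i bi|b1] := pickP (fun i => 1 < b i)%N.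
  rewrite (piece_kos mc) (f0 b i bi); case: ifP => // _.
  by rewrite linear0.
rewrite (@squarefreeP _ b) => [|i]; last by rewrite leqNgt b1.
suff -> : piece cf
    (mind (~: ~: msupport b)) (kos X f) = 0 by [].
apply: hochster_eq0; rewrite -(hochster_cobd mc) fg.
by have /andP[_ /eqP] := Zg (~: msupport b).
Qed.

Theorem hochster_mod_dim j :
  qdim (fun f : C => kcycle X j f) (mod_rel (fun f : C => kcycle X j f) (kbound X j))
    (\sum_(T : {set 'I_m}) r (j - 1 - #|T|%:Z) T).
Proof.
apply: (qdim_back_mod (phi := hoch) (Z' := Zp j) (B' := Bp j)) => //.
- exact: hoch_cycle.
- exact: hoch_bound_inv.
- exact: hoch_bound.
- exact: hoch_surj.
have := @qdim_fun V _ (cochain V m) (fun T => @cocyc V m (deletion D T) (j - 1 - #|T|%:Z))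
  (fun T => mod_rel (@cocyc V m (deletion D T) (j - 1 - #|T|%:Z))
     (@cobnd V m (deletion D T) (j - 1 - #|T|%:Z))) _
  (fun T => (mod_rel_closed (@cocyc_closed V m _ _) (@cobnd_closed V m _ _)).1)
  (fun T => (@cocyc_closed V m _ _).1) (fun T => rP (j - 1 - #|T|%:Z) T).
apply: qdim_ext => // g; split=> [h|[w Zw Bw] T].
  have /choice[w wP] T : exists w, @cocyc V m (deletion D T) (j - 1 - #|T|%:Z) w /\
      @cobnd V m (deletion D T) (j - 1 - #|T|%:Z) (g T - t *: w).
    by have [w Zw Bw] := h T; exists w.
  by exists w => T; [apply: (wP T).1 | apply: (wP T).2].
by exists (w T); [apply: Zw | apply: Bw].
Qed.

Theorem hochster_ann_dim j :
  qdim (ann_rel (fun f : C => kcycle X j f) (kbound X j)) (kbound X j)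
    (\sum_(T : {set 'I_m}) a (j - 1 - #|T|%:Z) T).
Proof.
apply: (qdim_back_ann (phi := hoch) (Z' := Zp j) (B' := Bp j)) => //.
- exact: hoch_cycle.
- exact: hoch_bound_inv.
- exact: hoch_bound.
- exact: hoch_surj.
have := @qdim_fun V _ (cochain V m)
  (fun T => ann_rel (@cocyc V m (deletion D T) (j - 1 - #|T|%:Z))
     (@cobnd V m (deletion D T) (j - 1 - #|T|%:Z)))
  (fun T => @cobnd V m (deletion D T) (j - 1 - #|T|%:Z)) _
  (fun T => (@cobnd_closed V m _ _).1)
  (fun T => (ann_rel_closed (@cocyc_closed V m _ _) (@cobnd_closed V m _ _)).1)
  (fun T => aP (j - 1 - #|T|%:Z) T).
by apply: qdim_ext => // g; split=> [h|[Zg Bg] T]; [split=> T; case: (h T) | split].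
Qed.

End HochsterDimensions.

Lemma sum_restrict (I : finType) (F : I -> nat) (P : pred I) :
  (forall i, ~~ P i -> F i = 0%N) -> (\sum_i F i = \sum_(i | P i) F i)%N.
Proof.
by move=> F0; rewrite (bigID P) /= [X in (_ + X)%N]big1 ?addn0.
Qed.

Theorem corollary3p9 (V : dvr) (n : nat) (Delta : {set {set 'I_n.+1}})
    (hDelta : simplicial Delta) :
  [/\
      forall i : nat,
        exists hK : killed (TorK V i%:Z Delta),
          lin_iso (kspace hK)
            (mod_t (TorV V i%:Z Delta) * ann_t (TorV V (i%:Z - 1) Delta))%type,
      forall j : nat,
        exists hK : killed (ExtK V j Delta),
          lin_iso (kspace hK)
            (mod_t (ExtV V j Delta) * ann_t (ExtV V j.+1 Delta))%type
    & (* [r q T] and [a q T] are the dimensions of [H / tH] and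
         [Ann_H t] for [H = H~^q(Delta - T; V)] *)
      exists r a : int -> {set 'I_n.+1} -> nat,
        [/\ forall (q : int) (T : {set 'I_n.+1}),
              has_dim (mod_t (rcohomology V (deletion Delta T) q)) (r q T),
            forall (q : int) (T : {set 'I_n.+1}),
              has_dim (ann_t (rcohomology V (deletion Delta T) q)) (a q T),
            forall (i : nat) (hK : killed (TorK V i%:Z Delta)),
              has_dim (kspace hK)
                (\sum_(T : {set 'I_n.+1} | (-1 <= n%:Z - i%:Z - #|T|%:Z)%R)
                    r (n%:Z - i%:Z - #|T|%:Z)%R T +
                 \sum_(T : {set 'I_n.+1} | (-1 <= n%:Z - (i%:Z - 1) - #|T|%:Z)%R)
                    a (n%:Z - (i%:Z - 1) - #|T|%:Z)%R T)%N
          & forall (j : nat) (hK : killed (ExtK V j Delta)),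
              has_dim (kspace hK)
                (\sum_(T : {set 'I_n.+1} | (-1 <= j%:Z - 1 - #|T|%:Z)%R)
                    r (j%:Z - 1 - #|T|%:Z)%R T +
                 \sum_(T : {set 'I_n.+1} | (-1 <= (j.+1)%:Z - 1 - #|T|%:Z)%R)
                    a ((j.+1)%:Z - 1 - #|T|%:Z)%R T)%N]].
Proof.
pose D := Delta; pose m := n.+1.
have /choice[r' r'P] (qT : int * {set 'I_m}) : exists d,
    qdim (@cocyc V m (deletion D qT.2) qT.1)
      (mod_rel (@cocyc V m (deletion D qT.2) qT.1) (@cobnd V m (deletion D qT.2) qT.1)) d
    /\ (qT.1 < -1 -> d = 0%N) by apply: cohomology_mod_dim.
have /choice[a' a'P] (qT : int * {set 'I_m}) : exists d,
    qdim (ann_rel (@cocyc V m (deletion D qT.2) qT.1) (@cobnd V m (deletion D qT.2) qT.1))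
      (@cobnd V m (deletion D qT.2) qT.1) d
    /\ (qT.1 < -1 -> d = 0%N) by apply: cohomology_ann_dim.
pose r q T := r' (q, T); pose a q T := a' (q, T).
have rP q T : qdim (@cocyc V m (deletion D T) q)
    (mod_rel (@cocyc V m (deletion D T) q) (@cobnd V m (deletion D T) q)) (r q T).
  exact: (r'P (q, T)).1.
have aP q T : qdim (ann_rel (@cocyc V m (deletion D T) q) (@cobnd V m (deletion D T) q))
    (@cobnd V m (deletion D T) q) (a q T).
  exact: (a'P (q, T)).1.
pose X := lact (@mpolyC m V) (SR V D) (fun i : 'I_m => 'X_i : {mpoly V[m]}).
pose Z j (f : {set 'I_m} -> restr (@mpolyC m V) (SR V D)) := kcycle X j f.
pose B j (f : {set 'I_m} -> restr (@mpolyC m V) (SR V D)) := kbound X j f.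
have cZ j : closed_lin (Z j).
  split; first by split=> //; apply: linear0.
  by move=> c f g; apply: kcycle_lin.
have cB j : closed_lin (B j).
  split; first by exists 0 => //; rewrite linear0.
  by move=> c f g; apply: kbound_lin.
pose phi := pointwise (T := {set 'I_m}) (x0t (V := V) (n := n) (SR V D)).
pose Zq j (f : {set 'I_m} -> restr (@mpolyC m V) (SR V D)) :=
  qcyc (fun j f => kdeg j f) (kos X) phi j f.
pose Bq j (f : {set 'I_m} -> restr (@mpolyC m V) (SR V D)) :=
  qbnd (fun j f => kdeg j f) (kos X) phi j f.
have cZq j : closed_lin (Zq j).
  apply: qcyc_closed => k; split=> // c f g; exact: kdeg_lin.
pose rs (j : int) := (\sum_(T : {set 'I_m}) r (j - 1 - #|T|%:Z)%R T)%N.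
pose as_ (j : int) := (\sum_(T : {set 'I_m}) a (j - 1 - #|T|%:Z)%R T)%N.
have dimZ j : qdim (Z j) (mod_rel (Z j) (B j)) (rs j) := hochster_mod_dim hDelta rP j.
have dimA j : qdim (ann_rel (Z j) (B j)) (B j) (as_ j) := hochster_ann_dim hDelta aP j.
have dimQ j : qdim (Zq j) (Bq j) (rs j + as_ (j + 1)).
  exact: (spec_reduction hDelta (@SRpi_surj V n D) (@SRpi_ker V n D hDelta)
    (dimZ j) (dimA (j + 1))).
have kil j f : Zq j f -> Bq j (unif V *: f) := @spec_killed V n (SR V D) j f.
have mod_dim (M : lmodType V) j : pres M (Z j) (B j) -> has_dim (mod_t M) (rs j).
  by move=> /(pres_mod_t (cZ j)) h; apply: has_dim_kspace (cZ j) h (dimZ j).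
have ann_dim (M : lmodType V) j : pres M (Z j) (B j) -> has_dim (ann_t M) (as_ j).
  move=> /(pres_ann_t (cZ j)) h; apply: has_dim_kspace h (dimA j).
  exact: ann_rel_closed.
have k_dim (M : lmodType V) j (hK : killed M) : pres M (Zq j) (Bq j) ->
    has_dim (kspace hK) (rs j + as_ (j + 1)).
  by move=> h; apply: has_dim_kspace (cZq j) h (dimQ j).
have main (M M1 M2 : lmodType V) j : pres M (Zq j) (Bq j) ->
    pres M1 (Z j) (B j) -> pres M2 (Z (j + 1)) (B (j + 1)) ->
    exists hK : killed M, lin_iso (kspace hK) (mod_t M1 * ann_t M2)%type.
  move=> hM h1 h2; have hK : killed M := pres_killed (cZq j) (kil j) hM.
  exists hK; apply: has_dim_iso (k_dim _ _ hK hM) _.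
  exact: has_dim_prod (mod_dim _ _ h1) (ann_dim _ _ h2).
(* Terms with cohomological degree below [-1] are zero, so the restricted sums of the statement
   equal the sums over all [T]. *)
have rE (f : {set 'I_m} -> int) j : (forall T, f T = j - 1 - #|T|%:Z) ->
    (\sum_(T | (-1 <= f T)%R) r (f T) T)%N = rs j.
  move=> fE; rewrite /rs (sum_restrict (P := fun T => (-1 <= f T)%R)) => [|T].
    by apply: eq_bigr => T _; rewrite fE.
  by rewrite -ltNge -fE => /(r'P (f T, T)).2.
have aE (f : {set 'I_m} -> int) j : (forall T, f T = j - 1 - #|T|%:Z) ->
    (\sum_(T | (-1 <= f T)%R) a (f T) T)%N = as_ j.
  move=> fE; rewrite /as_ (sum_restrict (P := fun T => (-1 <= f T)%R)) => [|T].
    by apply: eq_bigr => T _; rewrite fE.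
  by rewrite -ltNge -fE => /(a'P (f T, T)).2.
have jS (j : nat) : j.+1%:Z = j%:Z + 1 by rewrite intS addrC.
split.
(* [Tor_i] sits in cohomological degree [m - i], so the annihilator, taken one degree higher,
   belongs to [Tor_(i-1)]. *)
- move=> i; apply: (main _ _ _ (m%:Z - i%:Z)).
  + exact: TorK_pres.
  + exact: TorV_pres.
  + exact: TorV_pred_pres.
- move=> j; apply: (main _ _ _ j%:Z).
  + exact: ExtK_pres.
  + exact: ExtV_pres.
  + by rewrite -jS; apply: ExtV_pres.
exists r, a; split.
- move=> q T; have cT := @cocyc_closed V m (deletion Delta T) q.
  have h := pres_mod_t cT (@rcohomology_pres V m (deletion Delta T) q).
  exact: has_dim_kspace cT h (rP q T).
- move=> q T; have cT := @cocyc_closed V m (deletion Delta T) q.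
  have h := pres_ann_t cT (@rcohomology_pres V m (deletion Delta T) q).
  apply: has_dim_kspace h (aP q T).
  by apply: ann_rel_closed => //; apply: cobnd_closed.
(* The shift by one in [j - 1 - #|T|] is absorbed by [m = n + 1], giving the exponents
   [n - i - #|T|] and [n - (i - 1) - #|T|]. *)
- move=> i hK; rewrite (rE _ (m%:Z - i%:Z)) ?(aE _ (m%:Z - i%:Z + 1)).
  + by apply: k_dim; apply: TorK_pres.
  + by move=> T; rewrite /m; lia.
  + by move=> T; rewrite /m; lia.
- move=> j hK; rewrite (rE _ j%:Z) ?(aE _ (j%:Z + 1)) //.
  + by apply: k_dim; apply: ExtK_pres.
  + by move=> T; rewrite jS.
Qed.
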